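(* Let $f\in L^2([-\pi,\pi]^d)$ be such that, for $\delta>0$, there exists a truncation radius $R=R(\delta)$ providing the following smallness estimate on the moments of the truncated collision term: $$\|\langle Q^R(f,f),\Phi\rangle\|_2\le \tilde C\,\delta .$$ Then for any integer $r\ge 1$ there exists a constant $C=C(\|f\|_{L^2},R,r)$ such that, for all $N\ge1$, $$\|Q^R(f,f)-Q_N^{R,c}(f_N^c,f_N^c)\|_{L^2}\le C\left(\|f-f_N^c\|_{L^2}+\frac{\|Q^R(f_N^c,f_N^c)\|_{H^r_p}}{N^r}+\delta\right),$$ where $f_N^c=\mathcal P_N^c f$.
   Context: $d\le 3$ is the velocity dimension. Functions on $[-\pi,\pi]^d$ are real-valued and extended periodically to $\mathbb R^d$; $\langle f,g\rangle=\int_{[-\pi,\pi]^d}fg\,dv$, $\|f\|_{L^2_p}^2=\langle f,f\rangle$, and $H^r_p$ is the subspace of periodic functions in the Sobolev space $H^r([-\pi,\pi]^d)$. $\Phi(v)=(1,v_1,\dots,v_d,|v|^2)^T\in\mathbb R^{d+2}$, $\langle f,\Phi\rangle=\int_{[-\pi,\pi]^d} f\,\Phi\,dv\in\mathbb R^{d+2}$ componentwise, and $\|\cdot\|_2$ is the Euclidean norm. Truncated periodized Boltzmann operator: with $\mathcal B_0(2R)$ the ball of radius $2R$ centred at $0$, $$Q^R(f,f)(v)=\int_{\mathcal B_0(2R)\times\mathbb S^{d-1}}B(|q|,\cos\theta)\,\bigl(f(v_*')f(v')-f(v_* )f(v)\bigr)\,dq\,d\sigma,$$ where $q=v-v_*$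 is the relative velocity, $\cos\theta=\frac{q}{|q|}\cdot\sigma$, $v'=\frac{v+v_*}{2}+\frac{|v-v_*|}{2}\sigma$, $v_*'=\frac{v+v_*}{2}-\frac{|v-v_*|}{2}\sigma$. The collision kernel $B\ge0$ has the form $B(|q|,\cos\theta)=|q|\,\sigma(|q|,\cos\theta)$, where $\sigma(\cdot,\cdot)$ denotes the scattering cross-section, and is bounded on the truncated domain. The velocity variable is scaled so that the periodicity box is $[-\pi,\pi]^d$; $R$ is the truncation radius (in the normalized setting $R=\lambda\pi$ with $\lambda=2/(3+\sqrt2)$). $\mathbb P^N=\mathrm{span}\{e^{ik\cdot v}:k\in\mathbb Z^d,\ -N\le k_j\le N,\ j=1,\dots,d\}$. Conservative projection: $$\mathcal P_N^c f=\operatorname{argmin}\{\|g_N-f\|_{L^2_p}^2: g_N\in\mathbb P^N,\ \langle g_N,\Phi\rangle=\langle f,\Phi\rangle\}.$$ Moment-constrained collision operator: $$Q_N^{R,c}(f,f)=\operatorname{argmin}\{\|g_N-Q^R(f,f)\|_{L^2_p}^2: g_N\in\mathbb P^N,\ \langle g_N,\Phi\rangle=0\}.$$ $\tilde C>0$ is a constant; the constant $C$ may also depend on the fixed data $d$, $B$ and $\tilde C$. *)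

(* Defs.v *)
From HB Require Import structures.
From mathcomp Require Import all_boot all_order all_algebra.
From mathcomp Require Import complex.
From mathcomp Require Import all_classical all_reals all_analysis.
From mathcomp Require Import measurable_realfun.

Set Implicit Arguments.
Unset Strict Implicit.
Unset Printing Implicit Defensive.

Import Order.TTheory GRing.Theory Num.Theory.
Import numFieldNormedType.Exports.

Local Open Scope classical_set_scope.
Local Open Scope ring_scope.

Definition measure_rV_display : measure_display.
Proof. by []. Qed.

Section measurable_rV.
Context {R : realType} (n : nat).

Let coors (i : 'I_n) (v : 'rV[R]_n) : measurableTypeR R := v ord0 i.

Let rV_set0 : g_sigma_preimage coors set0.
Proof. exact: sigma_algebra0. Qed.

Let rV_setC A : g_sigma_preimage coors A -> g_sigma_preimage coors (~` A).
Proof. exact: sigma_algebraC. Qed.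

Let rV_bigcup (F : _^nat) : (forall i, g_sigma_preimage coors (F i)) ->
  g_sigma_preimage coors (\bigcup_i (F i)).
Proof. exact: sigma_algebra_bigcup. Qed.

HB.instance Definition _ := @isMeasurable.Build measure_rV_display
  'rV[R]_n (g_sigma_preimage coors) rV_set0 rV_setC rV_bigcup.

Lemma measurable_coor (i : 'I_n) :
  measurable_fun [set: 'rV[R]_n] (fun v => v ord0 i : measurableTypeR R).
Proof.
move=> _ Y mY; rewrite setTI; apply: sub_sigma_algebra => /=.
rewrite -bigcup_seq/=; exists i => /=; first by rewrite mem_index_enum.
by exists Y => //; rewrite setTI.
Qed.

Lemma measurable_rVP d (T : measurableType d) (f : T -> 'rV[R]_n) :
  (forall i, measurable_fun [set: T] (fun x => f x ord0 i : measurableTypeR R)) ->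
  measurable_fun [set: T] f.
Proof.
move=> mf.
have H : g_sigma_preimage (fun i => coors i \o f) `<=` measurable.
  apply: smallest_sub; first exact: sigma_algebra_measurable.
  rewrite -bigcup_seq; apply: bigcup_sub => i _.
  by move=> A [B mB <-]; exact: mf.
move=> _ A mA; apply: H; rewrite g_sigma_preimage_comp.
by exists A.
Qed.

End measurable_rV.

Section lebesgue_rV.
Context {R : realType}.

Definition rV_cons n (p : measurableTypeR R * 'rV[R]_n) : 'rV[R]_n.+1 :=
  \row_(i < n.+1) (if unlift ord0 i is Some j then p.2 ord0 j else p.1).

Lemma measurable_rV_cons n : measurable_fun setT (@rV_cons n).
Proof.
apply: measurable_rVP => i.
under eq_fun do rewrite mxE.
case: unliftP => [j _|_].
  apply: (@measurableT_comp _ _ _ _ _ _ (fun v : 'rV[R]_n => v ord0 j : measurableTypeR R)).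
    exact: measurable_coor.
  exact: measurable_snd.
exact: measurable_fst.
Qed.

Definition rV_uncons n (v : 'rV[R]_n.+1) : measurableTypeR R * 'rV[R]_n :=
  (v ord0 ord0, \row_j v ord0 (lift ord0 j)).

Lemma measurable_rV_uncons n : measurable_fun setT (@rV_uncons n).
Proof.
apply: measurable_fun_pair; first exact: measurable_coor.
apply: measurable_rVP => i; under eq_fun do rewrite mxE.
exact: measurable_coor.
Qed.

Lemma rV_consK n : cancel (@rV_cons n) (@rV_uncons n).
Proof.
case=> x v; congr pair; first by rewrite !mxE unlift_none.
by apply/rowP => j; rewrite !mxE liftK.
Qed.


HB.instance Definition _ n := @isMeasurableFun.Build _ _ _ _ (@rV_cons n)
  (@measurable_rV_cons n).

Section step.
Variables (n : nat) (mu : {sigma_finite_measure set 'rV[R]_n -> \bar R}).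

Definition lebesgue_rV_step : set 'rV[R]_n.+1 -> \bar R :=
  pushforward (@lebesgue_measure R \x mu)%E (@rV_cons n).

Let step0 : lebesgue_rV_step set0 = 0%E.
Proof. exact: measure0. Qed.

Let step_ge0 A : (0 <= lebesgue_rV_step A)%E.
Proof. exact: measure_ge0. Qed.

Let step_sigma_additive : semi_sigma_additive lebesgue_rV_step.
Proof. exact: measure_semi_sigma_additive. Qed.

HB.instance Definition _ := isMeasure.Build _ _ _ lebesgue_rV_step
  step0 step_ge0 step_sigma_additive.

Let step_sigma_finite : sigma_finite setT lebesgue_rV_step.
Proof.
have /sigma_finiteP[F [FT ndF Foo]] := sigma_finiteT (@lebesgue_measure R).
have /sigma_finiteP[G [GT ndG Goo]] := sigma_finiteT mu.
exists (fun k => @rV_uncons n @^-1` (F k `*` G k)).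
  apply/seteqP; split=> // v _.
  have : [set: measurableTypeR R] (rV_uncons v).1 by [].
  rewrite FT => -[k _ Fk].
  have : [set: 'rV[R]_n] (rV_uncons v).2 by [].
  rewrite GT => -[l _ Gl].
  exists (maxn k l) => //; split => /=.
    exact: (subsetPset _ _ (ndF _ _ (leq_maxl k l))).
  exact: (subsetPset _ _ (ndG _ _ (leq_maxr k l))).
move=> k; have [mF Fk] := Foo k; have [mG Gk] := Goo k; split.
  rewrite -[X in measurable X]setTI; apply: measurable_rV_uncons => //.
  exact: measurableX.
rewrite /lebesgue_rV_step /pushforward -comp_preimage.
rewrite (_ : _ \o _ = idfun); last exact/funext/rV_consK.
by rewrite preimage_id product_measure1E// lte_mul_pinfty// ge0_fin_numE.
Qed.

HB.instance Definition _ := Measure_isSigmaFinite.Build _ _ _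
  lebesgue_rV_step step_sigma_finite.

End step.

Fixpoint lebesgue_rV n : {sigma_finite_measure set 'rV[R]_n -> \bar R} :=
  match n with
  | 0 => \d_(0 : 'rV[R]_0)
  | m.+1 => lebesgue_rV_step (lebesgue_rV m)
  end.

Definition cube n (a b : R) : set 'rV[R]_n :=
  [set v | forall i, v ord0 i \in `[a, b]].

Lemma measurable_cube n a b : measurable (@cube n a b).
Proof.
rewrite (_ : cube a b = \bigcap_(i in [set: 'I_n])
    ((fun v : 'rV[R]_n => v ord0 i : measurableTypeR R) @^-1` `[a, b])).
  apply: fin_bigcap_measurable => // i _.
  by rewrite -[X in measurable X]setTI; apply: measurable_coor.
by apply/seteqP; split => v /= vab i; [move=> _|]; exact: vab.
Qed.

Lemma lebesgue_rV_cube n a b : a <= b ->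
  lebesgue_rV n (cube a b) = ((b - a) ^+ n)%:E.
Proof.
move=> ab; elim: n => [|n IHn].
  rewrite /= diracE expr0 mem_set//; by case.
rewrite /= /lebesgue_rV_step /pushforward.
rewrite (_ : _ @^-1` _ = `[a, b]%classic `*` cube a b).
  rewrite product_measure1E//; last exact: measurable_cube.
  rewrite [X in (X * _)%E](lebesgue_measure_itv `[a, b])/= lte_fin IHn exprS.
  have [_|ba] := ltP a b; first by rewrite -EFinD -EFinM.
  by have -> : a = b; [apply/eqP; rewrite eq_le ab|rewrite subrr mul0r mul0e].
apply/seteqP; split => -[x v] /=.
  move=> H; split; first by have := H ord0; rewrite mxE unlift_none.
  by move=> j; have := H (lift ord0 j); rewrite mxE liftK.
by move=> [xab vab] i; rewrite mxE; case: unliftP => [j _|_]; [exact: vab|].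
Qed.

End lebesgue_rV.

Section euclidean.
Context {R : realType} (n : nat).

Definition dot (u v : 'rV[R]_n) : R := \sum_(i < n) u ord0 i * v ord0 i.

Definition enorm (v : 'rV[R]_n) : R := Num.sqrt (dot v v).

Lemma dot_ge0 v : 0 <= dot v v.
Proof. by apply: sumr_ge0 => i _; rewrite -expr2 sqr_ge0. Qed.

Lemma measurable_enorm :
  measurable_fun [set: 'rV[R]_n] (enorm : _ -> measurableTypeR R).
Proof.
rewrite (_ : (enorm : _ -> _) = fun v => dot v v `^ 2^-1); last first.
  by apply/funext => v; rewrite powR12_sqrt// dot_ge0.
apply: (@measurableT_comp _ _ _ _ _ _ (fun x : measurableTypeR R => x `^ 2^-1)).
  exact: measurable_powR.
apply: measurable_sum => i.
by apply: measurable_funM; exact: measurable_coor.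
Qed.

Definition eball (r : R) : set 'rV[R]_n := [set v | enorm v < r].

Definition esphere : set 'rV[R]_n := [set v | enorm v = 1].

Lemma measurable_eball r : measurable (eball r).
Proof.
rewrite (_ : eball r = enorm @^-1` `]-oo, r[); last first.
  by apply/seteqP; split => v /=; rewrite in_itv.
by rewrite -[X in measurable X]setTI; apply: measurable_enorm.
Qed.

Definition direction (v : 'rV[R]_n) : 'rV[R]_n := (enorm v)^-1 *: v.

Lemma measurable_direction : measurable_fun setT direction.
Proof.
apply: measurable_rVP => i.
rewrite (_ : (fun _ => _) = fun v => enorm v `^ (-1) * v ord0 i); last first.
  by apply/funext => v; rewrite mxE powR_inv1// sqrtr_ge0.
apply: measurable_funM; last exact: measurable_coor.
apply: (@measurableT_comp _ _ _ _ _ _ (fun x : measurableTypeR R => x `^ (-1))).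
  exact: measurable_powR.
exact: measurable_enorm.
Qed.

HB.instance Definition _ := @isMeasurableFun.Build _ _ _ _ direction
  measurable_direction.

(* Surface measure as the cone measure:
   sphere_measure A = n * Leb {t *: w | 0 < t < 1, w in A},
   for A a Borel subset of the unit sphere.
   When n = 1 it is the counting measure on {-1, 1}. *)
Definition sphere_measure : set 'rV[R]_n -> \bar R :=
  pushforward (mscale n%:R%:nng
    (mrestr (lebesgue_rV n) (measurable_eball 1))) direction.

Let sphere0 : sphere_measure set0 = 0%E.
Proof. exact: measure0. Qed.

Let sphere_ge0 A : (0 <= sphere_measure A)%E.
Proof. exact: measure_ge0. Qed.

Let sphere_sigma_additive : semi_sigma_additive sphere_measure.
Proof. exact: measure_semi_sigma_additive. Qed.

HB.instance Definition _ := isMeasure.Build _ _ _ sphere_measure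
  sphere0 sphere_ge0 sphere_sigma_additive.

Let sphere_fin : fin_num_fun sphere_measure.
Proof.
move=> A mA; rewrite ge0_fin_numE//.
rewrite /sphere_measure /pushforward /mscale /mrestr.
rewrite lte_mul_pinfty ?lee_fin ?ler0n//.
apply: (@le_lt_trans _ _ (lebesgue_rV n (cube (-1) 1))); last first.
  by rewrite lebesgue_rV_cube ?ltry// lerNl opprK ler01.
apply: le_measure; rewrite ?inE.
- apply: measurableI; last exact: measurable_eball.
  by rewrite -[X in measurable X]setTI; apply: measurable_direction.
- exact: measurable_cube.
- move=> v [_ /= v1] i; rewrite in_itv/= -ler_norml.
  apply: (le_trans _ (ltW v1)).
  rewrite -sqrtr_sqr ler_wsqrtr// /dot (bigD1 i)//= -expr2 lerDl.
  by apply: sumr_ge0 => j _; rewrite -expr2 sqr_ge0.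
Qed.

HB.instance Definition _ := Measure_isFinite.Build _ _ _ sphere_measure
  sphere_fin.

End euclidean.

Section periodic_functions.
Context {R : realType} (n : nat).
Local Notation V := 'rV[R]_n.

(* Functions on [-pi, pi]^n are represented by their periodic extension to the
   whole space; integrals and norms are over one period cell. *)
Definition periodic (f : V -> R) :=
  forall v (i : 'I_n), f (v + (2 * pi) *: delta_mx ord0 i) = f v.

Definition box_measure : set V -> \bar R :=
  mrestr (lebesgue_rV n) (@measurable_cube R n (- pi) pi).

HB.instance Definition _ := Measure.on box_measure.

Let box_fin : fin_num_fun box_measure.
Proof.
move=> A mA; rewrite ge0_fin_numE//.
apply: (@le_lt_trans _ _ (lebesgue_rV n (cube (- pi) pi))).
  apply: le_measure; rewrite ?inE.
  - by apply: measurableI => //; exact: measurable_cube.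
  - exact: measurable_cube.
  - by move=> v [].
by rewrite lebesgue_rV_cube ?ltry// ge0_cp// pi_ge0.
Qed.

HB.instance Definition _ := Measure_isFinite.Build _ _ _ box_measure box_fin.

Definition L2p (f : V -> R) := periodic f /\ f \in Lfun box_measure 2%:E.

Definition L2norm (f : V -> R) : \bar R := 'N[box_measure]_2%:E[EFin \o f]%E.

Definition inner (f g : V -> R) : R := \int[box_measure]_v (f v * g v).

Definition Phi (v : V) : 'rV[R]_(1 + n + 1) :=
  row_mx (row_mx 1%:M v) (enorm v ^+ 2)%:M.

Definition moments (f : V -> R) : 'rV[R]_(1 + n + 1) :=
  \row_j inner f (fun v => Phi v ord0 j).

Definition partials (s : seq 'I_n) (f : V -> R) : V -> R :=
  foldr (fun i (g : V -> R) v => 'D_(delta_mx ord0 i) g v) f s.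

Definition smooth (f : V -> R) := forall s : seq 'I_n,
  continuous (partials s f) /\
  forall (i : 'I_n) v, derivable (partials s f) v (delta_mx ord0 i).

Section sobolev.
Variable r : nat.

(* Every multi-index of length at most r has all its entries at most r. *)
Definition multi_index := {ffun 'I_n -> 'I_r.+1}.

Definition mlength (a : multi_index) : nat := (\sum_(i < n) a i)%N.

Definition mpartial (a : multi_index) : (V -> R) -> V -> R :=
  partials (flatten [seq nseq (a i) i | i <- enum 'I_n]).

Definition weak_partial (a : multi_index) (f h : V -> R) :=
  forall phi : V -> R, periodic phi -> smooth phi ->
    inner f (mpartial a phi) = (-1) ^+ mlength a * inner h phi.

(* The weak derivatives are unique almost everywhere, so the set below has at
   most one element; it is empty, and the norm is +oo, when f is not in H^r_p. *)
Definition sobolev_norm (f : V -> R) : \bar R :=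
  ereal_inf [set sqrte (\sum_(a : multi_index | (mlength a <= r)%N)
                          (L2norm (D a) ^+ 2))%E
            | D in [set D : multi_index -> V -> R |
                forall a, (mlength a <= r)%N ->
                  L2p (D a) /\ weak_partial a f (D a)]].

End sobolev.

(* Real-valued elements of the complex span of the exponentials e^{ik.v};
   k ranges over [-N, N]^n, encoded as {0, ..., 2N}^n shifted by N. *)
Definition trig_poly (N : nat) (g : V -> R) :=
  exists c : {ffun 'I_n -> 'I_(2 * N).+1} -> R[i], forall v,
    ((g v)%:C)%C = \sum_k c k *
      (let t := \sum_(j < n) ((k j)%:R - N%:R) * v ord0 j in
       (cos t +i* sin t)%C).

(* An arbitrary function (the zero one) when there is no minimizer. *)
Definition argmin (J : (V -> R) -> \bar R) (S : set (V -> R)) : V -> R :=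
  xget (cst 0) [set g | S g /\ forall h, S h -> (J g <= J h)%E].

Definition conservative_proj (N : nat) (f : V -> R) : V -> R :=
  argmin (fun g => L2norm (g \- f)%R ^+ 2)%E
    [set g | trig_poly N g /\ moments g = moments f].

End periodic_functions.

Section boltzmann.
Context {R : realType} (n : nat).
Local Notation V := 'rV[R]_n.

(* The kernel is |q| times the scattering cross-section sec. *)
Variable sec : R -> R -> R.

Definition kernel (r c : R) : R := r * sec r c.

Definition kernel_domain :
    set (measurableTypeR R * measurableTypeR R)%type :=
  [set p | 0 <= p.1 /\ -1 <= p.2 <= 1].

Definition is_collision_kernel :=
  measurable_fun kernel_domain
    (fun p => kernel p.1 p.2 : measurableTypeR R) /\
  (forall p, kernel_domain p -> 0 <= kernel p.1 p.2).

Variable Rt : R.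

Definition bounded_kernel :=
  exists M : R, forall p, kernel_domain p -> p.1 < 2 * Rt ->
    kernel p.1 p.2 <= M.

Definition collision (f : V -> R) (v : V) : R :=
  \int[(lebesgue_rV n \x @sphere_measure R n)%E]_(p in
       @eball R n (2 * Rt) `*` @esphere R n)
    (let q := p.1 in
     let s := p.2 in
     let vs := v - q in
     let v' := 2^-1 *: (v + vs) + (enorm (v - vs) / 2) *: s in
     let vs' := 2^-1 *: (v + vs) - (enorm (v - vs) / 2) *: s in
     let cos_theta := dot (direction q) s in
     kernel (enorm q) cos_theta * (f vs' * f v' - f vs * f v)).

Definition constrained_collision (N : nat) (f : V -> R) : V -> R :=
  argmin (fun g => L2norm (g \- collision f)%R ^+ 2)%E
    [set g | trig_poly N g /\ moments g = 0].

End boltzmann.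

(* Main.v *)
From HB Require Import structures.
Require Import Defs.
From mathcomp Require Import all_boot all_order all_algebra.
From mathcomp Require Import complex.
From mathcomp Require Import all_classical all_reals all_analysis.
From mathcomp Require Import measurable_realfun ring lra.

Set Implicit Arguments.
Unset Strict Implicit.
Unset Printing Implicit Defensive.

Import Order.TTheory GRing.Theory Num.Theory.
Import numFieldNormedType.Exports.

Local Open Scope classical_set_scope.
Local Open Scope ring_scope.


(** Write [H] for the collision term of [f], [G] for that of its projection
    [fN] and [X] for the minimiser that defines the constrained operator at
    [fN]. The error [H - X] splits into [H - G] and [G - X].

    The first difference is handled by a local Lipschitz estimate for the
    collision operator in mean square, [collision_lipschitz]. The difference of
    two collision terms is a sum of four bilinear terms, each with a factor
    [f - fN], weighted by a bounded kernel, so everything rests on the bounds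
    [loss_bilinear_le] and [gain_bilinear_le] for products of squares. In the
    loss term the two velocities differ by [q], which ranges over a ball; a ball
    is covered by finitely many period cells. In the gain term both velocities
    move with the collision parameters, but they differ by [|q| s] only; a
    translation of [v] removes the rest, and in polar coordinates [|q| s] is
    distributed like [q] itself ([integral_polar]), so the gain term is no worse
    than the loss term. The Lipschitz constant involves the norm of [fN], which
    is bounded by a multiple of that of [f] ([conservative_proj_stable]) since
    [fN] is at least as close to [f] as any fixed trigonometric polynomial with
    the same moments.

    For the second difference, [X] is the best approximation of [G] of degree
    [N] with vanishing moments. It is compared with [S - g], where [S] is the
    Fourier truncation of [G] and [g] is a polynomial of degree one that has the
    moments of [S]. Such lifts exist with a norm controlled by the moments
    ([moment_lift]), because the sines and cosines of single coordinates have
    nondegenerate moments. The moments of [S] are those of [H], which are small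
    by hypothesis, up to the distance from [S] to [H]. There remains the
    truncation error [G - S], bounded in [jackson] by the [r]-th weak
    derivatives of [G]: Bessel's inequality is applied to these derivatives, and
    completeness of the trigonometric system ([trig_dense]) shows that the
    neglected frequencies account for the whole error.

    Completeness is proved through sets. The measurable sets whose indicator is
    a limit in mean square of trigonometric polynomials with values in [[0, 1]]
    form a sigma-algebra; it contains the half-spaces orthogonal to the axes,
    whose indicators are obtained by sharpening the graph of a cosine
    polynomially ([cvg_sharpen_lo], [cvg_sharpen_hi]). Simple functions then
    reach every square integrable function. *)

(** * Lebesgue integrals over cubes and periods *)

(** Bundles the pushforward as a measure for maps whose measurability is given
    by a proof. *)
Definition image_measure d d' (T1 : measurableType d) (T2 : measurableType d')
    (R : realFieldType) (m : {measure set T1 -> \bar R}) (f : T1 -> T2)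
    (mf : measurable_fun setT f) : {measure set T2 -> \bar R}.
Proof. by unshelve refine (pushforward m f : {measure set T2 -> \bar R}). Defined.

Lemma integral_image_measure d d' (T1 : measurableType d)
    (T2 : measurableType d') (R : realType) (m : {measure set T1 -> \bar R})
    (f : T1 -> T2) (mf : measurable_fun setT f) (h : T2 -> \bar R) :
  measurable_fun setT h -> (forall y, 0 <= h y)%E ->
  (\int[image_measure m mf]_y h y = \int[m]_x h (f x))%E.
Proof.
move=> mh h0; rewrite -[LHS]/(\int[pushforward m f]_y h y)%E.
by rewrite ge0_integral_pushforward// preimage_setT.
Qed.

(** Both sides are integrals against measures that agree on half-open
    intervals. *)
Lemma lebesgue_integral_affine (R : realType) (t a : R) (f : measurableTypeR R -> \bar R) :
  t != 0 -> measurable_fun setT f -> (forall x, 0 <= f x)%E ->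
  (`|t|%:E * \int[lebesgue_measure]_x f (t * x + a)%R =
    \int[lebesgue_measure]_x f x)%E.
Proof.
move=> t0 mf f0.
have maff : measurable_fun setT
    ((fun x => t * x + a) : measurableTypeR R -> measurableTypeR R).
  apply: measurable_funD; last exact: measurable_cst.
  exact: mulrl_measurable.
pose mu : {measure set (measurableTypeR R) -> \bar R} :=
  mscale (NngNum (normr_ge0 t)) (image_measure (@lebesgue_measure R) maff).
have muE A : measurable A -> lebesgue_measure A = mu A.
  apply: (lebesgue_measure_unique (mu := mu)) => _ [[u v] _ <-] /=.
  rewrite /mu /mscale/= /image_measure/= /pushforward lebesgue_measure_itv/= lte_fin.
  have [tp|tn|] := ltgtP 0 t; last by move=> e; rewrite -e eqxx in t0.
  - rewrite (_ : _ @^-1` _ = `](u - a) / t, (v - a) / t]%classic); last first.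
      apply/seteqP; split => x /=; rewrite !in_itv/= ltr_pdivrMr// ler_pdivlMr//.
        by rewrite ltrBlDr lerBrDr mulrC.
      by rewrite ltrBlDr lerBrDr mulrC.
    rewrite lebesgue_measure_itv/= lte_fin ltr_pM2r ?invr_gt0// ltrD2r.
    case: ifPn => _; last by rewrite mule0.
    rewrite -!EFinB -EFinM gtr0_norm//; congr EFin.
    by rewrite -mulrBl mulrCA divff ?gt_eqF// mulr1; ring.
  - rewrite (_ : _ @^-1` _ = `[(v - a) / t, (u - a) / t[%classic); last first.
      apply/seteqP; split => x /=; rewrite !in_itv/= ltr_ndivlMr// ler_ndivrMr//.
        by rewrite ltrBlDr lerBrDr mulrC => /andP[-> ->].
      by rewrite ltrBlDr lerBrDr mulrC => /andP[-> ->].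
    rewrite lebesgue_measure_itv/= lte_fin ltr_nM2r ?invr_lt0// ltrD2r.
    case: ifPn => _; last by rewrite mule0.
    rewrite -!EFinB -EFinM ltr0_norm//; congr EFin.
    rewrite -mulrBl mulrCA mulNr divff ?lt_eqF//; ring.
rewrite [RHS](eq_measure_integral mu); last by move=> A mA _; exact: muE.
by rewrite [RHS]ge0_integral_mscale// integral_image_measure.
Qed.

Lemma measurable_addr_rV (R : realType) n (a : 'rV[R]_n) :
  measurable_fun setT (fun v : 'rV[R]_n => v + a).
Proof.
apply: measurable_rVP => i; under eq_fun do rewrite mxE.
by apply: measurable_funD; [exact: measurable_coor|exact: measurable_cst].
Qed.

Lemma measurable_scale_rV (R : realType) n (t : R) :
  measurable_fun setT (fun v : 'rV[R]_n => t *: v).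
Proof.
apply: measurable_rVP => i; under eq_fun do rewrite mxE.
by apply: measurable_funM; [exact: measurable_cst|exact: measurable_coor].
Qed.

Lemma measurable_rV_cons1 (R : realType) n (x : R) :
  measurable_fun setT (fun w : 'rV[R]_n => rV_cons (x, w)).
Proof.
apply: (measurableT_comp (@measurable_rV_cons R n)).
exact: pair1_measurable.
Qed.

(** One-dimensional facts propagate coordinate by coordinate through this
    identity. *)
Lemma integral_rV_cons (R : realType) n (f : 'rV[R]_n.+1 -> \bar R) :
  measurable_fun setT f -> (forall v, 0 <= f v)%E ->
  (\int[lebesgue_rV n.+1]_v f v =
   \int[lebesgue_measure]_x \int[lebesgue_rV n]_w f (rV_cons (x, w)))%E.
Proof.
move=> mf f0; rewrite /= /lebesgue_rV_step.
rewrite (ge0_integral_pushforward (@measurable_rV_cons R n))// preimage_setT.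
have mfc : measurable_fun setT (fun p => f (@rV_cons R n p)).
  by apply: measurableT_comp => //; exact: measurable_rV_cons.
by rewrite (fubini_tonelli1 (fun p => f (@rV_cons R n p))).
Qed.

Lemma measurable_integral_rV_cons (R : realType) n (f : 'rV[R]_n.+1 -> \bar R) :
  measurable_fun setT f -> (forall v, 0 <= f v)%E ->
  measurable_fun setT (fun x : measurableTypeR R =>
    \int[lebesgue_rV n]_w f (rV_cons (x, w)))%E.
Proof.
move=> mf f0.
apply: (measurable_fun_fubini_tonelli_F (m2 := lebesgue_rV n)
  (fun p => f (rV_cons p))) => //.
by apply: measurableT_comp => //; exact: measurable_rV_cons.
Qed.

Lemma ge0_integral_mrestr d (T : measurableType d) (R : realType)
    (m : {measure set T -> \bar R}) (D : set T) (mD : measurable D)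
    (f : T -> \bar R) :
  measurable_fun setT f -> (forall x, 0 <= f x)%E ->
  (\int[mrestr m mD]_x f x = \int[m]_(x in D) f x)%E.
Proof.
move=> mf f0.
have mC : measurable (~` D) by exact: measurableC.
have mC0 : mrestr m mD (~` D) = 0%E by rewrite /mrestr setICl measure0.
rewrite [LHS](ge0_negligible_integral mC _ _ _ mC0)// setTD setCK.
apply: eq_measure_integral => A mA AD.
by rewrite /mrestr; congr (m _); exact/setIidPl.
Qed.

Lemma integral_box (R : realType) n (f : 'rV[R]_n -> \bar R) :
  measurable_fun setT f -> (forall v, 0 <= f v)%E ->
  (\int[@box_measure R n]_v f v = \int[lebesgue_rV n]_(v in cube (- pi) pi) f v)%E.
Proof. exact: ge0_integral_mrestr. Qed.

Lemma cube_rV_cons (R : realType) n (a b x : R) (w : 'rV[R]_n) :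
  cube a b (rV_cons (x, w)) <-> x \in `[a, b] /\ cube a b w.
Proof.
split=> [H|[xab wab] i].
  split; first by have := H ord0; rewrite mxE unlift_none.
  by move=> j; have := H (lift ord0 j); rewrite mxE liftK.
by rewrite mxE; case: unliftP => [j _|_]; [exact: wab|].
Qed.

Lemma integral_cube_rV_cons (R : realType) n (a b : R)
    (f : 'rV[R]_n.+1 -> \bar R) :
  measurable_fun setT f -> (forall v, 0 <= f v)%E ->
  (\int[lebesgue_rV n.+1]_(v in cube a b) f v =
   \int[lebesgue_measure]_(x in `[a, b])
     \int[lebesgue_rV n]_(w in cube a b) f (rV_cons (x, w)))%E.
Proof.
move=> mf f0; rewrite integral_mkcond integral_rV_cons//; last 2 first.
- apply/(measurable_restrictT _ (measurable_cube a b)).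
  exact: measurable_funTS.
- by move=> v; apply: erestrict_ge0 => *; exact: f0.
rewrite [RHS]integral_mkcond; apply: eq_integral => x _; rewrite patchE.
case: ifPn => xab.
  rewrite [RHS]integral_mkcond; apply: eq_integral => w _.
  rewrite !patchE; congr (if _ then _ else _).
  apply/idP/idP; rewrite !inE => H; first by have /cube_rV_cons[] := H.
  by apply/cube_rV_cons; split => //; move: xab; rewrite inE.
rewrite integral0_eq// => w _; rewrite patchE ifF//.
apply/negbTE; apply: contra xab; rewrite !inE => /cube_rV_cons[].
by [].
Qed.

Lemma measurable_integral_cube_rV_cons (R : realType) n (a b : R)
    (f : 'rV[R]_n.+1 -> \bar R) :
  measurable_fun setT f -> (forall v, 0 <= f v)%E ->
  measurable_fun setT (fun x : measurableTypeR R =>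
    \int[lebesgue_rV n]_(w in cube a b) f (rV_cons (x, w)))%E.
Proof.
move=> mf f0.
under eq_fun do rewrite integral_mkcond.
have mC : measurable ((fun p : measurableTypeR R * 'rV[R]_n => p.2) @^-1` cube a b).
  rewrite -[X in measurable X]setTI; apply: measurable_snd => //.
  exact: measurable_cube.
apply: (measurable_fun_fubini_tonelli_F (m2 := lebesgue_rV n)
  (fun p => ((fun w => f (rV_cons (p.1, w))) \_ (cube a b)) p.2)) => //=.
  rewrite (_ : (fun _ => _) = (fun p => f (@rV_cons R n p)) \_
    ((fun p : measurableTypeR R * 'rV[R]_n => p.2) @^-1` cube a b)).
    apply/(measurable_restrictT _ mC); apply: measurable_funTS.
    by apply: measurableT_comp => //; exact: measurable_rV_cons.
  by apply/funext => -[x w]; rewrite !patchE.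
by move=> p; apply: erestrict_ge0 => *; exact: f0.
Qed.

Lemma lebesgue_integral_co_shift (R : realType) (s a b : R)
    (f : measurableTypeR R -> \bar R) :
  measurable_fun setT f -> (forall x, 0 <= f x)%E ->
  (\int[lebesgue_measure]_(x in `[a, b[) f (x + s)%R =
   \int[lebesgue_measure]_(x in `[(a + s)%R, (b + s)%R[) f x)%E.
Proof.
move=> mf f0; rewrite [RHS]integral_mkcond.
rewrite -(@lebesgue_integral_affine R 1 s)//; last 2 first.
- have mI : measurable (`[a + s, b + s[%classic : set (measurableTypeR R)).
    exact: measurable_itv.
  by apply/(measurable_restrictT _ mI); exact: measurable_funTS.
- by move=> x; apply: erestrict_ge0 => *; exact: f0.
rewrite normr1 mul1e integral_mkcond; apply: eq_integral => x _.
rewrite !patchE mul1r; congr (if _ then _ else _).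
by apply/idP/idP; rewrite !inE/= !in_itv/= lerD2r ltrD2r.
Qed.

Lemma periodic_intmul (R : realType) (T : Type) (f : R -> T) (p : R) :
  (forall x, f (x + p) = f x) -> forall (m : int) x, f (x + m%:~R * p) = f x.
Proof.
move=> fp m x.
have fn (n : nat) y : f (y + n%:R * p) = f y.
  elim: n y => [|n IHn] y; first by rewrite mul0r addr0.
  by rewrite -natr1 mulrDl mul1r addrA fp IHn.
case: m => n; first exact: fn.
by rewrite NegzE mulrNz mulNr -{2}(subrK (n.+1%:R * p) x) fn.
Qed.

Lemma ge0_integral_co_split (R : realType) (a b c : R)
    (f : measurableTypeR R -> \bar R) :
  measurable_fun setT f -> (forall x, 0 <= f x)%E -> a <= b -> b <= c ->
  (\int[lebesgue_measure]_(x in `[a, c[) f x =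
   \int[lebesgue_measure]_(x in `[a, b[) f x +
   \int[lebesgue_measure]_(x in `[b, c[) f x)%E.
Proof.
move=> mf f0 ab bc; rewrite -ge0_integral_setU//=.
- congr (integral _ _ _); apply/seteqP; split => x /=; rewrite !in_itv/=.
    by case: (ltP x b) => xb /andP[-> xc]; [left|right].
  move=> [] /andP[ax xb]; rewrite ?ax/=; first exact: lt_le_trans bc.
  by rewrite xb (le_trans ab).
- exact: measurable_funTS.
- apply/disj_setPS => x [] /=; rewrite !in_itv/= => /andP[_ xb] /andP[bx _].
  by move: (lt_le_trans xb bx); rewrite ltxx.
Qed.

Lemma integral_period_co (R : realType) (s : R) (f : measurableTypeR R -> \bar R) :
  measurable_fun setT f -> (forall x, 0 <= f x)%E ->
  (forall x : R, f (x + 2 * pi) = f x) ->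
  (\int[lebesgue_measure]_(x in `[(- pi)%R, pi[) f (x + s)%R =
   \int[lebesgue_measure]_(x in `[(- pi)%R, pi[) f x)%E.
Proof.
move=> mf f0 fp.
(* For a shift shorter than a period, the piece that leaves the cell on one
   side is a translate by one period of the piece that enters on the other. *)
have small t : 0 <= t -> t <= 2 * pi ->
    (\int[lebesgue_measure]_(x in `[(- pi)%R, pi[) f (x + t)%R =
     \int[lebesgue_measure]_(x in `[(- pi)%R, pi[) f x)%E.
  move=> t0 t2; rewrite lebesgue_integral_co_shift//.
  rewrite (@ge0_integral_co_split _ (- pi + t) pi (pi + t))//; [|lra|lra].
  rewrite (@ge0_integral_co_split _ (- pi) (- pi + t) pi)//; [|lra|lra].
  rewrite addeC; congr (_ + _)%E.
  rewrite [in LHS](_ : pi = - pi + 2 * pi); last by lra.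
  rewrite [in X in `[_, X[](_ : - pi + 2 * pi + t = (- pi + t) + 2 * pi); last by lra.
  by rewrite -lebesgue_integral_co_shift//; apply: eq_integral => x _; exact: fp.
have p0 : 0 < 2 * pi :> R by rewrite mulr_gt0// pi_gt0.
pose m := Num.floor (s / (2 * pi)).
have st : s = (s - m%:~R * (2 * pi)) + m%:~R * (2 * pi) by rewrite subrK.
have /andP[m1 m2] := floor_itv (s / (2 * pi)).
rewrite -[RHS](small (s - m%:~R * (2 * pi))).
- apply: eq_integral => x _; rewrite [in LHS]st addrA.
  exact: (periodic_intmul fp).
- by rewrite subr_ge0 -ler_pdivlMr.
- move: m2; rewrite ltr_pdivrMr// intrD mulrDl => m2.
  rewrite lerBlDr addrC; apply: ltW; move: m2; by rewrite mul1r.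
Qed.

Lemma integral_period (R : realType) (s : R) (f : measurableTypeR R -> \bar R) :
  measurable_fun setT f -> (forall x, 0 <= f x)%E ->
  (forall x : R, f (x + 2 * pi) = f x) ->
  (\int[lebesgue_measure]_(x in `[(- pi)%R, pi]) f (x + s)%R =
   \int[lebesgue_measure]_(x in `[(- pi)%R, pi]) f x)%E.
Proof.
move=> mf f0 fp.
rewrite -!integral_itv_bndo_bndc ?integral_period_co//.
- exact: measurable_funTS.
- apply: measurable_funTS; apply: measurableT_comp => //.
  by apply: measurable_funD => //; exact: measurable_cst.
Qed.

Lemma integral_itv_opp (R : realType) (a : R) (f : measurableTypeR R -> \bar R) :
  measurable_fun setT f -> (forall x, 0 <= f x)%E ->
  (\int[lebesgue_measure]_(x in `[(- a)%R, a]) f (- x)%R =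
   \int[lebesgue_measure]_(x in `[(- a)%R, a]) f x)%E.
Proof.
move=> mf f0; rewrite [RHS]integral_mkcond.
rewrite -(@lebesgue_integral_affine R (-1) 0)//; last 2 first.
- have mI : measurable (`[- a, a]%classic : set (measurableTypeR R)).
    exact: measurable_itv.
  by apply/(measurable_restrictT _ mI); exact: measurable_funTS.
- by move=> x; apply: erestrict_ge0 => *; exact: f0.
rewrite normrN normr1 mul1e integral_mkcond; apply: eq_integral => x _.
rewrite !patchE mulN1r addr0; congr (if _ then _ else _).
by apply/idP/idP; rewrite !inE/= !in_itv/= lerN2 lerNl andbC.
Qed.

Lemma integral_periods (R : realType) (c : R) (M : nat)
    (f : measurableTypeR R -> \bar R) :
  measurable_fun setT f -> (forall x, 0 <= f x)%E ->
  (forall x : R, f (x + 2 * pi) = f x) ->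
  (\int[lebesgue_measure]_(x in `[c, (c + 2 * pi * M%:R)%R]) f x =
   M%:R%:E * \int[lebesgue_measure]_(x in `[(- pi)%R, pi]) f x)%E.
Proof.
move=> mf f0 fp.
have p0 : 0 <= pi :> R by exact: pi_ge0.
rewrite -!integral_itv_bndo_bndc; [|exact: measurable_funTS..].
elim: M => [|M IHM].
  by rewrite mulr0 addr0 mul0e set_itvco0 integral_set0.
rewrite (@ge0_integral_co_split _ _ (c + 2 * pi * M%:R))//; last 2 first.
- by rewrite lerDl !mulr_ge0.
- by rewrite lerD2l ler_wpM2l ?mulr_ge0// ler_nat.
have -> : M.+1%:R = M%:R + 1 :> R by rewrite natr1.
rewrite IHM EFinD ge0_muleDl ?lee_fin// mul1e; congr (_ + _)%E.
rewrite -(integral_period_co (c + 2 * pi * M%:R + pi))//.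
rewrite [RHS]lebesgue_integral_co_shift//.
have -> : - pi + (c + 2 * pi * M%:R + pi) = c + 2 * pi * M%:R by ring.
by have -> : pi + (c + 2 * pi * M%:R + pi) = c + 2 * pi * (M%:R + 1) by ring.
Qed.

Lemma rV_consD (R : realType) n (x y : R) (v w : 'rV[R]_n) :
  rV_cons (x, v) + rV_cons (y, w) = rV_cons (x + y, v + w).
Proof. by apply/rowP => i; rewrite !mxE; case: unliftP => [j|] _; rewrite ?mxE. Qed.

Lemma rV_consZ (R : realType) n (t x : R) (v : 'rV[R]_n) :
  t *: rV_cons (x, v) = rV_cons (t * x, t *: v).
Proof. by apply/rowP => i; rewrite !mxE; case: unliftP => [j|] _; rewrite ?mxE. Qed.

Lemma rV_unconsK (R : realType) n : cancel (@rV_uncons R n) (@rV_cons R n).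
Proof. by move=> v; apply/rowP => i; rewrite !mxE; case: unliftP => [j ->|->]; rewrite ?mxE. Qed.

Lemma delta_mx_cons0 (R : realType) n (t : R) :
  t *: delta_mx ord0 ord0 = rV_cons (t, 0 : 'rV[R]_n).
Proof.
apply/rowP => i; rewrite !mxE eqxx/=; case: unliftP => [j ->|->].
  by rewrite mxE mulr0.
by rewrite eqxx mulr1.
Qed.

Lemma delta_mx_consS (R : realType) n (t : R) (j : 'I_n) :
  t *: delta_mx ord0 (lift ord0 j) = rV_cons (0, t *: delta_mx ord0 j : 'rV[R]_n).
Proof.
apply/rowP => i; rewrite !mxE eqxx/=; case: unliftP => [k ->|->].
  by rewrite !mxE eqxx/= (inj_eq lift_inj).
by rewrite mulr0.
Qed.

(** Periodicity is asked only in the directions along which the vector [a]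
    moves, so that a coordinate function times a wave in the other coordinates
    can be translated. *)
Lemma integral_cube_translate (R : realType) n (a : 'rV[R]_n)
    (f : 'rV[R]_n -> \bar R) :
  measurable_fun setT f -> (forall v, 0 <= f v)%E ->
  (forall i, a ord0 i = 0 \/ forall v, f (v + (2 * pi) *: delta_mx ord0 i) = f v) ->
  (\int[lebesgue_rV n]_(v in cube (- pi) pi) f (v + a)%R =
   \int[lebesgue_rV n]_(v in cube (- pi) pi) f v)%E.
Proof.
elim: n a f => [|n IHn] a f mf f0 fp.
  by apply: eq_integral => v _; congr f; apply/rowP => -[].
have mfa : measurable_fun setT (fun v : 'rV[R]_n.+1 => f (v + a)).
  by apply: measurableT_comp => //; exact: measurable_addr_rV.
rewrite (@integral_cube_rV_cons R n _ _ _ mfa (fun=> f0 _)).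
rewrite (@integral_cube_rV_cons R n _ _ _ mf f0).
pose phi (x : measurableTypeR R) :=
  (\int[lebesgue_rV n]_(w in cube (- pi) pi) f (rV_cons (x, w)))%E.
pose a0 := a ord0 ord0; pose a' := (rV_uncons a).2.
have aE : a = rV_cons (a0, a') by rewrite -[LHS]rV_unconsK.
transitivity (\int[lebesgue_measure]_(x in `[(- pi)%R, pi]) phi (x + a0)%R)%E.
  apply: eq_integral => x _; rewrite /phi -[RHS](IHn a')//.
  - by apply: eq_integral => w _; rewrite {1}aE rV_consD.
  - by apply: measurableT_comp => //; exact: measurable_rV_cons1.
  - move=> i; have [ai|per] := fp (lift ord0 i); [left|right].
      by rewrite /a' /= mxE.
    by move=> w; rewrite -[RHS]per delta_mx_consS rV_consD addr0.
have mphi : measurable_fun setT phi by exact: measurable_integral_cube_rV_cons.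
have [a00|per] := fp ord0.
  by apply: eq_integral => x _; rewrite /a0 a00 addr0.
rewrite integral_period//; first by move=> x; exact: integral_ge0.
move=> x; apply: eq_integral => w _.
by rewrite -[RHS]per delta_mx_cons0 rV_consD addr0.
Qed.

Lemma measurable_opp_rV (R : realType) n :
  measurable_fun setT (fun v : 'rV[R]_n => - v).
Proof.
apply: measurable_rVP => i; under eq_fun do rewrite mxE.
by apply: measurable_funN; exact: measurable_coor.
Qed.

Lemma integral_cube_opp (R : realType) n (a : R) (f : 'rV[R]_n -> \bar R) :
  measurable_fun setT f -> (forall v, 0 <= f v)%E ->
  (\int[lebesgue_rV n]_(v in cube (- a) a) f (- v)%R =
   \int[lebesgue_rV n]_(v in cube (- a) a) f v)%E.
Proof.
elim: n f => [|n IHn] f mf f0.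
  by apply: eq_integral => v _; congr f; apply/rowP => -[].
have mfa : measurable_fun setT (fun v : 'rV[R]_n.+1 => f (- v)).
  apply: measurableT_comp => //.
  exact: measurable_opp_rV.
rewrite (@integral_cube_rV_cons R n _ _ _ mfa (fun=> f0 _)).
rewrite (@integral_cube_rV_cons R n _ _ _ mf f0).
pose phi (x : measurableTypeR R) :=
  (\int[lebesgue_rV n]_(w in cube (- a) a) f (rV_cons (x, w)))%E.
transitivity (\int[lebesgue_measure]_(x in `[(- a)%R, a]) phi (- x)%R)%E.
  apply: eq_integral => x _; rewrite /phi -[RHS]IHn//.
    by apply: eq_integral => w _; rewrite -scaleN1r rV_consZ scaleN1r mulN1r.
  by apply: measurableT_comp => //; exact: measurable_rV_cons1.
rewrite integral_itv_opp//; first exact: measurable_integral_cube_rV_cons.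
by move=> x; exact: integral_ge0.
Qed.

Lemma integral_cube_periods (R : realType) n (c : R) (M : nat)
    (f : 'rV[R]_n -> \bar R) :
  measurable_fun setT f -> (forall v, 0 <= f v)%E ->
  (forall v i, f (v + (2 * pi) *: delta_mx ord0 i) = f v) ->
  (\int[lebesgue_rV n]_(v in cube c (c + 2 * pi * M%:R)) f v =
   (M%:R ^+ n)%:E * \int[lebesgue_rV n]_(v in cube (- pi) pi) f v)%E.
Proof.
elim: n f => [|n IHn] f mf f0 fp.
  rewrite expr0 mul1e; congr (integral _ _ _).
  by apply/seteqP; split => v _ [].
rewrite 2!(@integral_cube_rV_cons R n _ _ _ mf f0).
pose phi (x : measurableTypeR R) :=
  (\int[lebesgue_rV n]_(w in cube (- pi) pi) f (rV_cons (x, w)))%E.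
have mphi : measurable_fun setT phi by exact: measurable_integral_cube_rV_cons.
have phi0 x : (0 <= phi x)%E by exact: integral_ge0.
transitivity (\int[lebesgue_measure]_(x in `[c, (c + 2 * pi * M%:R)%R])
   ((M%:R ^+ n)%:E * phi x))%E.
  apply: eq_integral => x _; rewrite IHn//.
    by apply: measurableT_comp => //; exact: measurable_rV_cons1.
  by move=> w i; rewrite -[RHS](fp _ (lift ord0 i)) delta_mx_consS rV_consD addr0.
rewrite ge0_integralZl_EFin ?exprn_ge0//; last exact: measurable_funTS.
rewrite integral_periods//; first by rewrite muleA -EFinM exprSr.
by move=> x; apply: eq_integral => w _; rewrite -[RHS](fp _ ord0) delta_mx_cons0 rV_consD addr0.
Qed.

Lemma lebesgue_rV_integral_scale (R : realType) n (t : R) (f : 'rV[R]_n -> \bar R) :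
  0 < t -> measurable_fun setT f -> (forall v, 0 <= f v)%E ->
  ((t ^+ n)%:E * \int[lebesgue_rV n]_v f (t *: v) =
   \int[lebesgue_rV n]_v f v)%E.
Proof.
move=> t0; elim: n f => [|n IHn] f mf f0.
  rewrite expr0 mul1e; apply: eq_integral => v _; congr f; apply/rowP => -[].
  by [].
have mft : measurable_fun setT (fun v : 'rV[R]_n.+1 => f (t *: v)).
  by apply: measurableT_comp => //; exact: measurable_scale_rV.
rewrite (@integral_rV_cons R n _ mft (fun=> f0 _)) (@integral_rV_cons R n _ mf f0).
pose phi (x : measurableTypeR R) :=
  (\int[lebesgue_rV n]_w f (rV_cons (x, w)))%E.
have mphi : measurable_fun setT phi by exact: measurable_integral_rV_cons.
have phi0 x : (0 <= phi x)%E by exact: integral_ge0.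
rewrite -[RHS](@lebesgue_integral_affine R t 0 phi (lt0r_neq0 t0) mphi phi0) gtr0_norm//.
rewrite exprS EFinM -muleA; congr (_ * _)%E.
rewrite -ge0_integralZl_EFin ?exprn_ge0 ?ltW//; last 2 first.
- by move=> x _; exact: integral_ge0.
- exact: (measurable_integral_rV_cons mft).
apply: eq_integral => x _; rewrite addr0 -[RHS]IHn//; last first.
  by apply: measurableT_comp => //; exact: measurable_rV_cons1.
congr (_ * _)%E; apply: eq_integral => w _; rewrite rV_consZ//.
Qed.

(** * Euclidean norm and polar coordinates *)

Lemma enormZ (R : realType) n (t : R) (v : 'rV[R]_n) :
  enorm (t *: v) = `|t| * enorm v.
Proof.
rewrite /enorm -sqrtr_sqr -sqrtrM ?sqr_ge0//; congr Num.sqrt.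
by rewrite /dot mulr_sumr; apply: eq_bigr => i _; rewrite !mxE; ring.
Qed.

Lemma enorm_ge0 (R : realType) n (v : 'rV[R]_n) : 0 <= enorm v.
Proof. exact: sqrtr_ge0. Qed.

Lemma ler_coor_enorm (R : realType) n (v : 'rV[R]_n) i : `|v ord0 i| <= enorm v.
Proof.
rewrite -sqrtr_sqr ler_wsqrtr// /dot (bigD1 i)//= -expr2 lerDl.
by apply: sumr_ge0 => j _; rewrite -expr2 sqr_ge0.
Qed.

Lemma enorm_eq0 (R : realType) n (v : 'rV[R]_n) : enorm v = 0 -> v = 0.
Proof.
move=> v0; apply/rowP => i; rewrite mxE; apply/eqP; rewrite -normr_le0 -v0.
exact: ler_coor_enorm.
Qed.

Lemma enorm_direction (R : realType) n (v : 'rV[R]_n) :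
  enorm v *: direction v = v.
Proof.
rewrite /direction scalerA; have [v0|v0] := eqVneq (enorm v) 0.
  by rewrite (enorm_eq0 v0) scaler0.
by rewrite divff// scale1r.
Qed.

Lemma directionZ (R : realType) n (t : R) (v : 'rV[R]_n) : 0 < t ->
  direction (t *: v) = direction v.
Proof.
move=> t0; rewrite /direction enormZ gtr0_norm// scalerA invfM mulrAC.
by rewrite mulVf ?gt_eqF// mul1r.
Qed.

Lemma eball_cube (R : realType) n (r : R) :
  @eball R n r `<=` cube (- r) r.
Proof.
move=> v vr i; rewrite in_itv/= -ler_norml.
exact: le_trans (ler_coor_enorm v i) (ltW vr).
Qed.

Lemma lebesgue_eball_lty (R : realType) n (r : R) :
  (lebesgue_rV n (eball r) < +oo)%E.
Proof.
have [r0|r0] := ltP r 0.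
  rewrite (_ : @eball R n r = set0) ?measure0 ?ltry//; apply/seteqP; split => // v /= vr.
  by move: (lt_trans vr r0); rewrite ltNge enorm_ge0.
apply: (@le_lt_trans _ _ (lebesgue_rV n (cube (- r) r))).
  apply: le_measure; rewrite ?inE; [exact: measurable_eball|exact: measurable_cube|].
  exact: eball_cube.
by rewrite lebesgue_rV_cube ?ltry// ge0_cp.
Qed.

Lemma lebesgue_cone_scale (R : realType) n (t : R) (B : set 'rV[R]_n) :
  0 < t -> measurable B ->
  lebesgue_rV n (eball t `&` (@direction R n) @^-1` B) =
  ((t ^+ n)%:E * lebesgue_rV n (eball 1 `&` (@direction R n) @^-1` B))%E.
Proof.
move=> t0 mB.
have mC r : measurable (eball r `&` (@direction R n) @^-1` B).
  apply: measurableI; first exact: measurable_eball.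
  by rewrite -[X in measurable X]setTI; exact: measurable_direction.
have indicE' (X : set 'rV[R]_n) : measurable X ->
    lebesgue_rV n X = (\int[lebesgue_rV n]_v (\1_X v)%:E)%E.
  by move=> mX; rewrite integral_indic// setIT.
rewrite !indicE'// -[LHS](lebesgue_rV_integral_scale t0)//.
- congr (_ * _)%E; apply: eq_integral => v _; rewrite !indicE; congr ((nat_of_bool _)%:R%:E).
  apply/idP/idP; rewrite !inE/= /eball/= enormZ gtr0_norm// directionZ//.
    by rewrite gtr_pMr.
  by rewrite gtr_pMr.
- apply/measurable_EFinP; exact: measurable_indic.
Qed.

Section polar_coordinates.
Context {R : realType} (n : nat) (rho : R).
Hypothesis rho0 : 0 < rho.

Let nu : {measure set 'rV[R]_n -> \bar R} :=
  mrestr (lebesgue_rV n) (@measurable_eball R n rho).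

Definition radial_law : set (measurableTypeR R) -> \bar R :=
  image_measure nu (@measurable_enorm R n).
HB.instance Definition _ := Measure.on radial_law.
Local Notation radial := radial_law.

Let nu_lty A : measurable A -> (nu A < +oo)%E.
Proof.
move=> mA; apply: le_lt_trans (lebesgue_eball_lty n rho).
apply: le_measure; rewrite ?inE//.
- by apply: measurableI => //; exact: measurable_eball.
- exact: measurable_eball.
Qed.

Let radial_fin : fin_num_fun radial.
Proof.
move=> A mA; rewrite ge0_fin_numE//; apply: nu_lty.
by rewrite -[X in measurable X]setTI; exact: measurable_enorm.
Qed.

HB.instance Definition _ := Measure_isFinite.Build _ _ _ radial radial_fin.

Let polar (v : 'rV[R]_n) : measurableTypeR R * 'rV[R]_n :=
  (enorm v, direction v).

Let measurable_polar : measurable_fun setT polar.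
Proof.
by apply: measurable_fun_pair; [exact: measurable_enorm|exact: measurable_direction].
Qed.

Let cone (B : set 'rV[R]_n) := lebesgue_rV n (eball 1 `&` (@direction R n) @^-1` B).

Let measurable_dir (B : set 'rV[R]_n) : measurable B ->
  measurable ((@direction R n) @^-1` B).
Proof.
by move=> mB; rewrite -[X in measurable X]setTI; exact: measurable_direction.
Qed.

Let sphereE B : sphere_measure B = (n%:R%:E * cone B)%E.
Proof.
by rewrite -[LHS]/(n%:R%:E * lebesgue_rV n ((@direction R n) @^-1` B `&` eball 1))%E setIC.
Qed.

Let nu_cone t B : measurable B -> 0 < t ->
  nu ((@enorm R n) @^-1` `]-oo, t[ `&` (@direction R n) @^-1` B) =
  ((Num.min t rho ^+ n)%:E * cone B)%E.
Proof.
move=> mB t0; rewrite -lebesgue_cone_scale ?lt_min ?t0 ?rho0//.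
rewrite /nu /mrestr; congr (lebesgue_rV n _).
apply/seteqP; split => v /=; rewrite in_itv/= /eball/= lt_min.
  by move=> [[-> ?] ->].
by move=> [/andP[-> ->]].
Qed.

Let nu_ball t : 0 < t ->
  nu ((@enorm R n) @^-1` `]-oo, t[) = ((Num.min t rho ^+ n)%:E * cone setT)%E.
Proof. by move=> t0; rewrite -nu_cone// preimage_setT setIT. Qed.

Let nu0 t : t <= 0 -> (@enorm R n) @^-1` `]-oo, t[ = set0.
Proof.
move=> t0; apply/seteqP; split => // v /=; rewrite in_itv/= => vt.
by move: (lt_le_trans vt t0); rewrite ltNge enorm_ge0.
Qed.

Let sphere_ge0 B : 0 <= fine (@sphere_measure R n B).
Proof. exact: fine_ge0. Qed.

Let sphereK B : measurable B ->
  ((fine (@sphere_measure R n B))%:E = sphere_measure B)%E.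
Proof. by move=> mB; rewrite fineK// fin_num_measure. Qed.

(** Under Lebesgue measure on a ball the modulus and the direction of a vector
    are independent. Both sides are finite measures in [A], so intervals
    [`]-oo, t[] are enough, and for these the sets are truncated cones, whose
    volumes scale with the radius. *)
Let independence (A : set (measurableTypeR R)) B : measurable A -> measurable B ->
  (sphere_measure [set: 'rV[R]_n] *
    nu ((@enorm R n) @^-1` A `&` (@direction R n) @^-1` B) =
   radial A * sphere_measure B)%E.
Proof.
move=> mA mB.
pose k1 : {measure set (measurableTypeR R) -> \bar R} :=
  mscale (NngNum (sphere_ge0 setT))
    (image_measure (mrestr nu (measurable_dir mB)) (@measurable_enorm R n)).
pose k2 : {measure set (measurableTypeR R) -> \bar R} :=
  mscale (NngNum (sphere_ge0 B)) radial.
have k1E X : k1 X = (sphere_measure [set: 'rV[R]_n] *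
    nu ((@enorm R n) @^-1` X `&` (@direction R n) @^-1` B))%E.
  by rewrite -sphereK.
have k2E X : k2 X = (sphere_measure B * radial X)%E.
  by rewrite -sphereK.
rewrite -k1E [RHS]muleC -k2E.
apply: (measure_unique (T := measurableTypeR R) (@RGenInftyO.G R)
  (fun k => `]-oo, k%:R[%classic)) => //.
- exact: RGenInftyO.measurableE.
- move=> _ _ [x ->] [y ->]; exists (Num.min x y).
  apply/seteqP; split => z /=; rewrite !in_itv/= lt_min; first by move=> [-> ->].
  by move=> /andP[-> ->].
- by move=> k; exists k%:R.
- apply/seteqP; split => // x _; exists (Num.truncn (x : R)).+1 => //=.
  by rewrite in_itv/= truncnS_gt.
- move=> _ [t ->]; rewrite k1E k2E.
  rewrite -[radial _]/(nu ((@enorm R n) @^-1` `]-oo, t[)).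
  have [t0|t0] := leP t 0; first by rewrite nu0// set0I measure0 !mule0.
  rewrite nu_cone// nu_ball// !sphereE.
  by rewrite -!muleA; congr (_ * _)%E; rewrite muleCA muleC -muleA muleCA; congr (_ * _)%E; rewrite muleC.
- move=> k; rewrite k1E lte_mul_pinfty//.
    by rewrite fin_num_measure.
  apply: nu_lty; apply: measurableI; last exact: measurable_dir.
  by rewrite -[X in measurable X]setTI; exact: measurable_enorm.
Qed.

(** Since modulus and direction are independent, replacing the direction of [q]
    by an independent uniform one does not change the law of [q]. *)
Lemma integral_polar (H : 'rV[R]_n -> \bar R) :
  measurable_fun setT H -> (forall v, 0 <= H v)%E ->
  (\int[lebesgue_rV n]_(q in eball rho) \int[@sphere_measure R n]_s H (enorm q *: s) =
   sphere_measure [set: 'rV[R]_n] * \int[lebesgue_rV n]_(y in eball rho) H y)%E.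
Proof.
move=> mH H0.
pose g (p : measurableTypeR R * 'rV[R]_n) := H (p.1 *: p.2).
have mg : measurable_fun setT g.
  apply: measurableT_comp => //; apply: measurable_rVP => i.
  under eq_fun do rewrite mxE.
  apply: measurable_funM; first exact: measurable_fst.
  apply: (measurableT_comp (measurable_coor i)); exact: measurable_snd.
have mF := measurable_fun_fubini_tonelli_F (m2 := @sphere_measure R n) g mg
  (fun=> H0 _).
rewrite -(ge0_integral_mrestr _ (@measurable_eball R n rho))//; last 2 first.
- exact: (measurableT_comp mF (@measurable_enorm R n)).
- by move=> q; apply: integral_ge0.
transitivity (\int[radial]_r \int[@sphere_measure R n]_s g (r, s))%E.
  rewrite [RHS](integral_image_measure nu (@measurable_enorm R n) mF)//.
  by move=> r; apply: integral_ge0 => s _; exact: H0.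
rewrite -(fubini_tonelli1 (m1 := radial) g mg (fun=> H0 _)).
pose m' : {measure set (measurableTypeR R * 'rV[R]_n) -> \bar R} :=
  mscale (NngNum (sphere_ge0 setT)) (image_measure nu measurable_polar).
rewrite (eq_measure_integral m'); last first.
  move=> X mX _; apply: product_measure_unique => // A B mA mB.
  by rewrite -independence// -[in RHS]sphereK.
rewrite ge0_integral_mscale//; last by move=> p _; exact: H0.
rewrite (integral_image_measure nu measurable_polar mg (fun=> H0 _)).
rewrite -[X in (X * _)%E]/((fine (@sphere_measure R n setT))%:E)%E sphereK//; congr (_ * _)%E.
rewrite -(ge0_integral_mrestr _ (@measurable_eball R n rho))//; apply: eq_integral => y _.
by rewrite /g/= enorm_direction.
Qed.

End polar_coordinates.

(** * Square integrable functions over a finite measure *)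

Section square_integrable.
Context d (T : measurableType d) (R : realType).
Variable mu : {finite_measure set T -> \bar R}.
Implicit Types f g h : T -> R.

Definition square_integrable f :=
  measurable_fun setT f /\ (\int[mu]_x (f x ^+ 2)%:E < +oo)%E.

Definition ip f g : R := \int[mu]_x (f x * g x).

Definition nrm f : R := Num.sqrt (ip f f).

Lemma Lfun2P f : f \in Lfun mu 2%:E <-> square_integrable f.
Proof.
have NE : measurable_fun setT f ->
    ('N[mu]_2%:E[EFin \o f] `^ 2 = \int[mu]_x (f x ^+ 2)%:E)%E.
  move=> mf; rewrite poweR_Lnorm//; apply: eq_integral => x _ /=.
  by rewrite powR_mulrn// real_normK// num_real.
split=> [|[mf fi]].
  rewrite inE => /andP[/[!inE]/= mf ffin]; split => //.
  by rewrite -NE//; apply: poweR_lty.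
rewrite inE; apply/andP; split; rewrite inE//= /finite_norm.
apply: (@lty_poweRy _ _ 2); first by [].
by rewrite NE.
Qed.

Lemma square_integrableP f : measurable_fun setT f ->
  mu.-integrable setT (EFin \o (fun x => f x ^+ 2)) <-> square_integrable f.
Proof.
move=> mf; have E : {in [set: T], (fun x => `|(f x ^+ 2)%:E|%E) =1 (fun x => (f x ^+ 2)%:E)}.
  by move=> x _; rewrite /= ger0_norm ?sqr_ge0.
split=> [/integrableP[_]|[_ fi]]; first by rewrite (eq_integral _ _ E).
apply/integrableP; split; first by apply/measurable_EFinP; exact: measurable_funX.
by rewrite (eq_integral _ _ E).
Qed.

Lemma integrable_mul f g : square_integrable f -> square_integrable g ->
  mu.-integrable setT (EFin \o (fun x => f x * g x)).
Proof.
move=> [mf fi] [mg gi].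
have f2 : mu.-integrable setT (EFin \o (fun x => f x ^+ 2)).
  by apply/square_integrableP.
have g2 : mu.-integrable setT (EFin \o (fun x => g x ^+ 2)).
  by apply/square_integrableP.
apply: (le_integrable measurableT _ _ (integrableD measurableT f2 g2)).
  by apply/measurable_EFinP; exact: measurable_funM.
move=> x _ /=; rewrite lee_fin [leRHS]ger0_norm ?addr_ge0 ?sqr_ge0//.
rewrite ler_norml; apply/andP; split.
  rewrite -subr_ge0 (_ : _ - _ = 2^-1 * ((f x + g x) ^+ 2 + f x ^+ 2 + g x ^+ 2)).
    by rewrite mulr_ge0 ?invr_ge0// !addr_ge0 ?sqr_ge0.
  by field.
rewrite -subr_ge0 (_ : _ - _ = 2^-1 * ((f x - g x) ^+ 2 + f x ^+ 2 + g x ^+ 2)).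
  by rewrite mulr_ge0 ?invr_ge0// !addr_ge0 ?sqr_ge0.
by field.
Qed.

Lemma square_integrableZ (a : R) f : square_integrable f ->
  square_integrable (fun x => a * f x).
Proof.
move=> [mf fi].
have maf : measurable_fun setT (fun x => a * f x).
  by apply: measurable_funM => //; exact: measurable_cst.
apply/(square_integrableP maf).
have /(square_integrableP mf) f2 : square_integrable f by [].
have := integrableZl measurableT (a ^+ 2) f2.
by apply: eq_integrable => // x _; rewrite /= -EFinM exprMn.
Qed.

Lemma square_integrableD f g : square_integrable f -> square_integrable g ->
  square_integrable (fun x => f x + g x).
Proof.
move=> Lf Lg; have [mf _] := Lf; have [mg _] := Lg.
have mfg : measurable_fun setT (fun x => f x + g x) by exact: measurable_funD.
apply/(square_integrableP mfg).
have /(square_integrableP mf) f2 := Lf; have /(square_integrableP mg) g2 := Lg.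
have h2 := integrableZl measurableT 2 (integrable_mul Lf Lg).
have := integrableD measurableT (integrableD measurableT f2 h2) g2.
by apply: eq_integrable => // x _; rewrite /= -!EFinM -!EFinD; congr EFin; ring.
Qed.

Lemma square_integrableN f : square_integrable f ->
  square_integrable (fun x => - f x).
Proof.
move=> /(square_integrableZ (-1)); congr square_integrable.
by apply/funext => x; rewrite mulN1r.
Qed.

Lemma square_integrableB f g : square_integrable f -> square_integrable g ->
  square_integrable (fun x => f x - g x).
Proof. by move=> Lf Lg; apply: square_integrableD => //; exact: square_integrableN. Qed.

Lemma square_integrable_le f g : measurable_fun setT f ->
  square_integrable g -> (forall x, `|f x| <= `|g x|) -> square_integrable f.
Proof.
move=> mf [mg gi] fg; split => //; apply: le_lt_trans gi.
apply: ge0_le_integral => //.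
- by move=> x _; rewrite lee_fin sqr_ge0.
- by apply/measurable_EFinP; exact: measurable_funX.
- by apply/measurable_EFinP; exact: measurable_funX.
- move=> x _; rewrite lee_fin -(real_normK (num_real (f x))).
  by rewrite -(real_normK (num_real (g x))) lerXn2r ?nnegrE.
Qed.

Lemma square_integrable_bounded f (C : R) : measurable_fun setT f ->
  (forall x, `|f x| <= C) -> square_integrable f.
Proof.
move=> mf fC; split => //.
apply: (@le_lt_trans _ _ (\int[mu]_x (cst (C ^+ 2)%:E x))%E).
  apply: ge0_le_integral => //.
  - by move=> x _; rewrite lee_fin sqr_ge0.
  - by apply/measurable_EFinP; exact: measurable_funX.
  - by move=> x _; rewrite lee_fin -(real_normK (num_real (f x))) lerXn2r ?nnegrE// (le_trans _ (fC x)).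
by rewrite integral_cst// lte_mul_pinfty ?lee_fin ?sqr_ge0// -ge0_fin_numE// fin_num_measure.
Qed.

Lemma square_integrable_cst (c : R) : square_integrable (fun=> c).
Proof. exact: (square_integrable_bounded (C := `|c|)). Qed.

Lemma square_integrable_sum (I : Type) (s : seq I) (P : pred I) (F : I -> T -> R) :
  (forall i, P i -> square_integrable (F i)) ->
  square_integrable (fun x => \sum_(i <- s | P i) F i x).
Proof.
move=> LF; elim: s => [|i s IHs].
  by under eq_fun do rewrite big_nil; exact: square_integrable_cst.
under eq_fun do rewrite big_cons.
by case Pi : (P i) => //; apply: square_integrableD => //; exact: LF.
Qed.

Lemma ipE f g : square_integrable f -> square_integrable g ->
  ((ip f g)%:E = \int[mu]_x (f x * g x)%:E)%E.
Proof.
by move=> Lf Lg; rewrite /ip /Rintegral fineK//; apply: integrable_fin_num => //; exact: integrable_mul.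
Qed.

Lemma ipC f g : ip f g = ip g f.
Proof. by apply: eq_Rintegral => x _; rewrite mulrC. Qed.

Lemma ipDl f g h : square_integrable f -> square_integrable g ->
  square_integrable h -> ip (fun x => f x + g x) h = ip f h + ip g h.
Proof.
move=> Lf Lg Lh; rewrite /ip -RintegralD//; try exact: integrable_mul.
by apply: eq_Rintegral => x _; rewrite mulrDl.
Qed.

Lemma ipZl (a : R) f g : square_integrable f -> square_integrable g ->
  ip (fun x => a * f x) g = a * ip f g.
Proof.
move=> Lf Lg; rewrite /ip -RintegralZl//; last exact: integrable_mul.
by apply: eq_Rintegral => x _; rewrite mulrA.
Qed.

Lemma ipNl f g : square_integrable f -> square_integrable g ->
  ip (fun x => - f x) g = - ip f g.
Proof.
move=> Lf Lg; rewrite -mulN1r -ipZl//; apply: eq_Rintegral => x _.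
by rewrite mulN1r.
Qed.

Lemma ipBl f g h : square_integrable f -> square_integrable g ->
  square_integrable h -> ip (fun x => f x - g x) h = ip f h - ip g h.
Proof. by move=> Lf Lg Lh; rewrite ipDl ?ipNl//; exact: square_integrableN. Qed.

Lemma ipDr f g h : square_integrable f -> square_integrable g ->
  square_integrable h -> ip h (fun x => f x + g x) = ip h f + ip h g.
Proof. by move=> *; rewrite ipC ipDl// ipC [ip g h]ipC. Qed.

Lemma ipBr f g h : square_integrable f -> square_integrable g ->
  square_integrable h -> ip h (fun x => f x - g x) = ip h f - ip h g.
Proof. by move=> *; rewrite ipC ipBl// ipC [ip g h]ipC. Qed.

Lemma ipZr (a : R) f g : square_integrable f -> square_integrable g ->
  ip g (fun x => a * f x) = a * ip g f.
Proof. by move=> *; rewrite ipC ipZl// ipC. Qed.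

Lemma ip_suml (I : Type) (s : seq I) (P : pred I) (F : I -> T -> R) g :
  (forall i, P i -> square_integrable (F i)) -> square_integrable g ->
  ip (fun x => \sum_(i <- s | P i) F i x) g = \sum_(i <- s | P i) ip (F i) g.
Proof.
move=> LF Lg; elim: s => [|i s IHs].
  rewrite big_nil /ip; under eq_Rintegral do rewrite big_nil mul0r.
  by rewrite Rintegral_cst// mul0r.
rewrite big_cons; under [X in ip X _]eq_fun do rewrite big_cons.
case Pi : (P i) => //; rewrite -IHs -ipDl//; first exact: LF.
exact: square_integrable_sum.
Qed.

Lemma ip_ge0 f : 0 <= ip f f.
Proof. by apply: Rintegral_ge0 => x _; rewrite -expr2 sqr_ge0. Qed.

Lemma nrm_ge0 f : 0 <= nrm f.
Proof. exact: sqrtr_ge0. Qed.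

Lemma sqr_nrm f : nrm f ^+ 2 = ip f f.
Proof. by rewrite sqr_sqrtr// ip_ge0. Qed.

Lemma sqr_nrmE f : square_integrable f ->
  ((nrm f ^+ 2)%:E = \int[mu]_x (f x ^+ 2)%:E)%E.
Proof.
by move=> Lf; rewrite sqr_nrm ipE//; apply: eq_integral => x _; rewrite expr2.
Qed.

Lemma Lnorm2E f : square_integrable f -> ('N[mu]_2%:E[EFin \o f] = (nrm f)%:E)%E.
Proof.
move=> Lf; rewrite unlock.
have -> : (\int[mu]_x `|(EFin \o f) x| `^ 2 = (nrm f ^+ 2)%:E)%E.
  rewrite sqr_nrmE//; apply: eq_integral => x _ /=.
  by rewrite powR_mulrn// real_normK// num_real.
by rewrite poweR_EFin powR12_sqrt ?sqr_ge0// sqrtr_sqr ger0_norm// nrm_ge0.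
Qed.

Lemma nrm_le f g : square_integrable f -> square_integrable g ->
  (forall x, `|f x| <= `|g x|) -> nrm f <= nrm g.
Proof.
move=> Lf Lg fg; rewrite -(ler_pXn2r (n := 2)) ?nnegrE ?nrm_ge0//.
rewrite -lee_fin !sqr_nrmE//; apply: ge0_le_integral => //.
- by move=> x _; rewrite lee_fin sqr_ge0.
- by apply/measurable_EFinP; apply: measurable_funX; exact: Lf.1.
- by apply/measurable_EFinP; apply: measurable_funX; exact: Lg.1.
- move=> x _; rewrite lee_fin -(real_normK (num_real (f x))).
  by rewrite -(real_normK (num_real (g x))) lerXn2r ?nnegrE.
Qed.

Lemma nrmZ (a : R) f : square_integrable f -> nrm (fun x => a * f x) = `|a| * nrm f.
Proof.
move=> Lf; have La := square_integrableZ a Lf.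
by rewrite /nrm ipZl// ipZr// mulrA -expr2 sqrtrM ?sqr_ge0// sqrtr_sqr.
Qed.

Lemma sqr_nrmD f g : square_integrable f -> square_integrable g ->
  nrm (fun x => f x + g x) ^+ 2 = nrm f ^+ 2 + 2 * ip f g + nrm g ^+ 2.
Proof.
move=> Lf Lg; have Lfg := square_integrableD Lf Lg.
by rewrite !sqr_nrm ipDl// !ipDr// [ip g f]ipC; ring.
Qed.

(** The quadratic form [t |-> nrm (g - t f) ^+ 2] is affine in [t] when
    [nrm f = 0], and it is nonnegative for all [t], hence constant. *)
Lemma nrm_eq0_ip f g : square_integrable f -> square_integrable g ->
  nrm f = 0 -> ip f g = 0.
Proof.
move=> Lf Lg f0; apply/eqP; rewrite -normr_le0; apply/ler_addgt0Pl => e e0.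
rewrite addr0.
have ip_le (t : R) : 2 * t * ip f g <= nrm g ^+ 2.
  have := sqr_ge0 (nrm (fun x => - t * f x + g x)).
  rewrite sqr_nrmD//; last exact: square_integrableZ.
  rewrite nrmZ// f0 mulr0 expr0n/= add0r ipZl//; lra.
have n1 : 0 < nrm g ^+ 2 + 1 by rewrite ltr_wpDl ?sqr_ge0.
rewrite leNgt; apply/negP => ee.
(* The value of [t] at which the affine bound fails. *)
have := ip_le ((nrm g ^+ 2 + 1) / (2 * ip f g)).
have i0 : ip f g != 0 by rewrite -normr_gt0 (lt_trans e0).
rewrite (_ : _ * _ * _ = nrm g ^+ 2 + 1); last by field; rewrite i0.
by lra.
Qed.

Lemma cauchy_schwarz f g : square_integrable f -> square_integrable g ->
  `|ip f g| <= nrm f * nrm g.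
Proof.
move=> Lf Lg.
have [g0|g0] := eqVneq (nrm g) 0.
  by rewrite ipC nrm_eq0_ip// g0 mulr0 normr0.
have gp : 0 < nrm g ^+ 2 by rewrite exprn_gt0// lt_neqAle eq_sym g0 nrm_ge0.
rewrite -ler_sqr ?nnegrE ?mulr_ge0 ?nrm_ge0// exprMn real_normK ?num_real//.
rewrite -ler_pdivrMr//.
have := sqr_ge0 (nrm (fun x => f x + (- (ip f g / nrm g ^+ 2)) * g x)).
rewrite sqr_nrmD//; last exact: square_integrableZ.
rewrite nrmZ// exprMn real_normK ?num_real// ipZr//.
set a := ip f g; set b := nrm g ^+ 2.
rewrite (_ : _ + _ = nrm f ^+ 2 - a ^+ 2 / b); first by rewrite subr_ge0.
by field; rewrite gt_eqF.
Qed.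

Lemma nrmD f g : square_integrable f -> square_integrable g ->
  nrm (fun x => f x + g x) <= nrm f + nrm g.
Proof.
move=> Lf Lg.
rewrite -ler_sqr ?nnegrE ?addr_ge0 ?nrm_ge0// sqr_nrmD// sqrrD.
rewrite lerD2r lerD2l mulr_natl lerMn2r/=.
exact: le_trans (ler_norm _) (cauchy_schwarz Lf Lg).
Qed.

Lemma nrmN f : square_integrable f -> nrm (fun x => - f x) = nrm f.
Proof.
move=> Lf; rewrite -[RHS]mul1r -(normr1 R) -normrN -nrmZ//; congr nrm.
by apply/funext => x; rewrite mulN1r.
Qed.

Lemma nrmB f g : square_integrable f -> square_integrable g ->
  nrm (fun x => f x - g x) <= nrm f + nrm g.
Proof.
by move=> Lf Lg; rewrite -(nrmN Lg); apply: nrmD => //; exact: square_integrableN.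
Qed.

Lemma nrm_distC f g : square_integrable f -> square_integrable g ->
  nrm (fun x => f x - g x) = nrm (fun x => g x - f x).
Proof.
move=> Lf Lg; rewrite -nrmN; last exact: square_integrableB.
by congr nrm; apply/funext => x; rewrite opprB.
Qed.

Lemma nrm_triangle f g h : square_integrable f -> square_integrable g ->
  square_integrable h ->
  nrm (fun x => f x - h x) <= nrm (fun x => f x - g x) + nrm (fun x => g x - h x).
Proof.
move=> Lf Lg Lh; have := nrmD (square_integrableB Lf Lg) (square_integrableB Lg Lh).
by congr (nrm _ <= _); apply/funext => x; ring.
Qed.

End square_integrable.

(** * Collision parameters and bilinear estimates *)

Lemma integral_box_translate (R : realType) n (a : 'rV[R]_n)
    (f : 'rV[R]_n -> \bar R) :
  measurable_fun setT f -> (forall v, 0 <= f v)%E ->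
  (forall i, a ord0 i = 0 \/ forall v, f (v + (2 * pi) *: delta_mx ord0 i) = f v) ->
  (\int[@box_measure R n]_v f (v + a)%R = \int[@box_measure R n]_v f v)%E.
Proof.
move=> mf f0 fp; rewrite !integral_box ?integral_cube_translate//.
by apply: measurableT_comp => //; exact: measurable_addr_rV.
Qed.

Lemma integral_box_opp (R : realType) n (f : 'rV[R]_n -> \bar R) :
  measurable_fun setT f -> (forall v, 0 <= f v)%E ->
  (\int[@box_measure R n]_v f (- v)%R = \int[@box_measure R n]_v f v)%E.
Proof.
move=> mf f0; rewrite !integral_box ?integral_cube_opp//.
by apply: measurableT_comp => //; exact: measurable_opp_rV.
Qed.

(** A number of period cells that covers a ball of radius [r]. *)
Definition cover_number (R : realType) (n : nat) (r : R) : R :=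
  (Num.truncn (r / pi)).+1%:R ^+ n.

Lemma cover_number_ge0 (R : realType) (n : nat) (r : R) : 0 <= cover_number n r.
Proof. by rewrite exprn_ge0. Qed.

Lemma measurable_subl_rV (R : realType) n (v : 'rV[R]_n) :
  measurable_fun setT (fun y : 'rV[R]_n => v - y).
Proof.
apply: measurable_rVP => i; under eq_fun do rewrite !mxE.
by apply: measurable_funB; [exact: measurable_cst|exact: measurable_coor].
Qed.

Lemma integral_eball_cover (R : realType) n (r : R) (v : 'rV[R]_n)
    (f : 'rV[R]_n -> \bar R) :
  measurable_fun setT f -> (forall v, 0 <= f v)%E ->
  (forall v i, f (v + (2 * pi) *: delta_mx ord0 i) = f v) ->
  (\int[lebesgue_rV n]_(y in eball r) f (v - y)%R <=
   (cover_number n r)%:E * \int[@box_measure R n]_y f y)%E.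
Proof.
move=> mf f0 fp; pose M := (Num.truncn (r / pi)).+1.
pose g y := f (v - y).
have mg : measurable_fun setT g.
  exact: (measurableT_comp mf (measurable_subl_rV v)).
have gp y i : g (y + (2 * pi) *: delta_mx ord0 i) = g y.
  by rewrite /g -[LHS](fp _ i); congr f; rewrite opprD addrA subrK.
apply: (@le_trans _ _ (\int[lebesgue_rV n]_(y in cube (- r) (- r + 2 * pi * M%:R)) g y)%E).
  apply: ge0_subset_integral => //.
  - exact: measurable_eball.
  - exact: measurable_cube.
  - exact: measurable_funTS.
  - move=> y /eball_cube yr i; move: (yr i); rewrite !in_itv/= => /andP[-> yir]/=.
    apply: (le_trans yir).
    have : r < M%:R * pi by rewrite -ltr_pdivrMr ?pi_gt0// truncnS_gt.
    by lra.
have g0 y : (0 <= g y)%E by exact: f0.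
rewrite (integral_cube_periods _ _ mg g0 gp) -(integral_box mg g0).
rewrite -(integral_box_opp mg g0) -(integral_box_translate mf f0 (a := v)); last by right.
rewrite -[M%:R ^+ n]/(cover_number n r).
by under eq_integral do rewrite /g opprK addrC.
Qed.

Lemma measurable_rVD d (T : measurableType d) (R : realType) n
    (f g : T -> 'rV[R]_n) : measurable_fun setT f -> measurable_fun setT g ->
  measurable_fun setT (fun x => f x + g x).
Proof.
move=> mf mg; apply: measurable_rVP => i; under eq_fun do rewrite mxE.
by apply: measurable_funD; apply: (measurableT_comp (measurable_coor i)).
Qed.

Lemma measurable_rVZ d (T : measurableType d) (R : realType) n
    (c : T -> R) (f : T -> 'rV[R]_n) :
  measurable_fun setT (c : T -> measurableTypeR R) -> measurable_fun setT f ->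
  measurable_fun setT (fun x => c x *: f x).
Proof.
move=> mc mf; apply: measurable_rVP => i; under eq_fun do rewrite mxE.
by apply: measurable_funM => //; apply: (measurableT_comp (measurable_coor i)).
Qed.

Lemma measurable_rVB d (T : measurableType d) (R : realType) n
    (f g : T -> 'rV[R]_n) : measurable_fun setT f -> measurable_fun setT g ->
  measurable_fun setT (fun x => f x - g x).
Proof.
move=> mf mg; apply: measurable_rVD => //.
exact: (measurableT_comp (@measurable_opp_rV R n)).
Qed.

Section collision_measure.
Context {R : realType} (n : nat) (rho : R).
Local Notation V := 'rV[R]_n.

Lemma measurable_esphere : measurable (@esphere R n).
Proof.
rewrite (_ : @esphere R n = (@enorm R n) @^-1` [set 1])//.
by rewrite -[X in measurable X]setTI; exact: measurable_enorm.
Qed.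

Lemma measurable_collision_domain :
  measurable (@eball R n rho `*` @esphere R n).
Proof.
by apply: measurableX; [exact: measurable_eball|exact: measurable_esphere].
Qed.

Let parameter_measure : {measure set (V * V) -> \bar R} :=
  (lebesgue_rV n \x @sphere_measure R n)%E.

Definition collision_measure : set (V * V) -> \bar R :=
  mrestr parameter_measure measurable_collision_domain.

HB.instance Definition _ := Measure.on collision_measure.

Let collision_measure_fin : fin_num_fun collision_measure.
Proof.
move=> A mA; rewrite ge0_fin_numE//.
apply: (@le_lt_trans _ _ (parameter_measure (@eball R n rho `*` @esphere R n))).
  apply: (le_measure parameter_measure); rewrite ?inE.
  - by apply: (measurableI _ _ mA); exact: measurable_collision_domain.
  - exact: measurable_collision_domain.
  - by move=> p [].
have -> : parameter_measure (@eball R n rho `*` @esphere R n) =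
    (lebesgue_rV n (eball rho) * sphere_measure (@esphere R n))%E.
  by apply: product_measure1E; [exact: measurable_eball|exact: measurable_esphere].
rewrite lte_mul_pinfty// ?lebesgue_eball_lty//.
  by rewrite ge0_fin_numE// lebesgue_eball_lty.
by rewrite -ge0_fin_numE// fin_num_measure//; exact: measurable_esphere.
Qed.

HB.instance Definition _ := Measure_isFinite.Build _ _ _ collision_measure
  collision_measure_fin.

(** The integral over the sphere is enlarged to the whole space, where Tonelli's
    theorem gives an iterated integral. *)
Lemma ge0_integral_collision_le (X : V * V -> \bar R) :
  measurable_fun setT X -> (forall p, 0 <= X p)%E ->
  (\int[collision_measure]_p X p <=
   \int[lebesgue_rV n]_(q in eball rho) \int[@sphere_measure R n]_s X (q, s))%E.
Proof.
move=> mX X0; rewrite ge0_integral_mrestr//.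
have mB : measurable (@eball R n rho `*` [set: V]).
  by apply: measurableX => //; exact: measurable_eball.
apply: (@le_trans _ _ (\int[(lebesgue_rV n \x @sphere_measure R n)%E]_(p in
   @eball R n rho `*` [set: V]) X p)%E).
  apply: ge0_subset_integral => //; [exact: measurable_collision_domain| |].
    exact: measurable_funTS.
  by move=> p [].
rewrite integral_mkcond fubini_tonelli1//; last 2 first.
- by apply/(measurable_restrictT _ mB); exact: measurable_funTS.
- by move=> p; apply: erestrict_ge0 => *; exact: X0.
rewrite [leRHS]integral_mkcond; rewrite le_eqVlt; apply/orP; left; apply/eqP.
apply: eq_integral => q _.
rewrite /fubini_F patchE; case: ifPn => qB.
  apply: eq_integral => s _; rewrite patchE ifT// inE; split => //=.
  by move: qB; rewrite inE.
rewrite integral0_eq// => s _; rewrite patchE ifF//; apply/negbTE.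
by apply: contra qB; rewrite !inE => -[].
Qed.

Hypothesis rho0 : 0 < rho.

Definition collision_constant : R :=
  fine (@sphere_measure R n setT) * cover_number n rho.

Lemma collision_constant_ge0 : 0 <= collision_constant.
Proof. by rewrite mulr_ge0 ?fine_ge0 ?cover_number_ge0. Qed.

Let sphereK : ((fine (@sphere_measure R n setT))%:E = sphere_measure [set: V])%E.
Proof. by rewrite fineK// fin_num_measure. Qed.

Variable F : V -> \bar R.
Hypothesis mF : measurable_fun setT F.
Hypothesis F0 : forall v, (0 <= F v)%E.
Hypothesis Fp : forall v i, F (v + (2 * pi) *: delta_mx ord0 i) = F v.

Let measurable_relative : measurable_fun setT (fun p : V * V => enorm p.1 *: p.2).
Proof.
apply: measurable_rVZ; last exact: measurable_snd.
exact: (measurableT_comp (@measurable_enorm R n) measurable_fst).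
Qed.

Lemma integral_relative_le v :
  (\int[collision_measure]_p F (v - enorm p.1 *: p.2) <=
   collision_constant%:E * \int[@box_measure R n]_y F y)%E.
Proof.
apply: le_trans (ge0_integral_collision_le _ _) _ => //.
  apply: (measurableT_comp mF).
  exact: (measurableT_comp (measurable_subl_rV v) measurable_relative).
have mFv := measurableT_comp mF (measurable_subl_rV v).
rewrite /= (integral_polar rho0 mFv (fun=> F0 _)).
rewrite -sphereK EFinM -muleA lee_wpmul2l// ?lee_fin ?fine_ge0//.
exact: integral_eball_cover.
Qed.

Lemma integral_velocity_le v :
  (\int[collision_measure]_p F (v - p.1) <=
   collision_constant%:E * \int[@box_measure R n]_y F y)%E.
Proof.
have mFv := measurableT_comp mF (measurable_subl_rV v).
apply: le_trans (ge0_integral_collision_le _ _) _ => //.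
  exact: (measurableT_comp mFv measurable_fst).
under eq_integral do rewrite /= integral_cst//.
rewrite ge0_integralZr//; [|exact: measurable_eball|exact: measurable_funTS].
rewrite -[X in (_ * X)%E]/(sphere_measure [set: V]) muleC.
rewrite -sphereK EFinM -muleA lee_wpmul2l// ?lee_fin ?fine_ge0//.
exact: integral_eball_cover.
Qed.

Variable G : V -> \bar R.
Hypothesis mG : measurable_fun setT G.
Hypothesis G0 : forall v, (0 <= G v)%E.
Hypothesis Gp : forall v i, G (v + (2 * pi) *: delta_mx ord0 i) = G v.

Let bilinear_le (Y : V -> V * V -> \bar R) :
  (forall v, measurable_fun setT (Y v)) -> (forall v p, 0 <= Y v p)%E ->
  measurable_fun setT (fun v => \int[collision_measure]_p Y v p)%E ->
  (forall v, \int[collision_measure]_p Y v p <=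
    collision_constant%:E * \int[@box_measure R n]_y F y)%E ->
  (\int[@box_measure R n]_v \int[collision_measure]_p (Y v p * G v) <=
   collision_constant%:E * \int[@box_measure R n]_y F y *
     \int[@box_measure R n]_y G y)%E.
Proof.
move=> mY Y0 mIY YF; rewrite -ge0_integralZl//; last first.
  by rewrite mule_ge0 ?lee_fin ?collision_constant_ge0 ?integral_ge0.
apply: ge0_le_integral => //.
- by move=> v _; apply: integral_ge0 => p _; exact: mule_ge0.
- under eq_fun do rewrite ge0_integralZr//.
  exact: emeasurable_funM.
- exact: measurable_funeM.
- by move=> v _; rewrite ge0_integralZr// lee_wpmul2r.
Qed.

(** For fixed [v], the variable [v - q] ranges over a ball, which meets a bounded
    number of period cells. *)
Lemma loss_bilinear_le :
  (\int[@box_measure R n]_v \int[collision_measure]_p (F (v - p.1) * G v) <=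
   collision_constant%:E * \int[@box_measure R n]_y F y *
     \int[@box_measure R n]_y G y)%E.
Proof.
apply: bilinear_le => //.
- by move=> v; exact: (measurableT_comp (measurableT_comp mF (measurable_subl_rV v)) measurable_fst).
- apply: (measurable_fun_fubini_tonelli_F (m2 := collision_measure)
    (fun z : V * (V * V) => F (z.1 - z.2.1))) => //.
  apply: (measurableT_comp mF); apply: measurable_rVB; first exact: measurable_fst.
  exact: (measurableT_comp measurable_fst measurable_snd).
- exact: integral_velocity_le.
Qed.

(** For fixed collision parameters the two velocities differ by [|q| s], so
    after a translation of [v] only the distribution of [|q| s] matters, and
    polar coordinates show that it is a multiple of the uniform one on a
    ball. *)
Lemma gain_bilinear_le (c : V * V -> V) : measurable_fun setT c ->
  (\int[@box_measure R n]_v \int[collision_measure]_p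
     (F (v + c p - enorm p.1 *: p.2) * G (v + c p)) <=
   collision_constant%:E * \int[@box_measure R n]_y F y *
     \int[@box_measure R n]_y G y)%E.
Proof.
move=> mc.
have m1 : measurable_fun setT (fun z : V * (V * V) => z.1 + c z.2).
  apply: measurable_rVD; first exact: measurable_fst.
  exact: (measurableT_comp mc measurable_snd).
have m2 : measurable_fun setT (fun z : V * (V * V) => enorm z.2.1 *: z.2.2).
  exact: (measurableT_comp measurable_relative measurable_snd).
rewrite (fubini_tonelli (m1 := @box_measure R n) (m2 := collision_measure)
  (fun z : V * (V * V) => F (z.1 + c z.2 - enorm z.2.1 *: z.2.2) * G (z.1 + c z.2))%E)/=;
  last 2 first.
- apply: emeasurable_funM; last exact: measurableT_comp.
  by apply: measurableT_comp => //; exact: measurable_rVB.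
- by move=> z; exact: mule_ge0.
under eq_integral => p _.
  rewrite (integral_box_translate (a := c p)
    (f := fun v => F (v - enorm p.1 *: p.2) * G v)%E); last 3 first.
  - apply: emeasurable_funM => //; apply: measurableT_comp => //.
    exact: measurable_addr_rV.
  - by move=> v; exact: mule_ge0.
  - by move=> i; right => v; rewrite Gp addrAC Fp.
  over.
have mF2 : measurable_fun setT (fun z : V * (V * V) => F (z.1 - enorm z.2.1 *: z.2.2)).
  by apply: (measurableT_comp mF); apply: measurable_rVB => //; exact: measurable_fst.
rewrite -(fubini_tonelli (m1 := @box_measure R n) (m2 := collision_measure)
  (fun z : V * (V * V) => F (z.1 - enorm z.2.1 *: z.2.2) * G z.1)%E)/=; last 2 first.
- by apply: emeasurable_funM => //; exact: (measurableT_comp mG measurable_fst).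
- by move=> z; exact: mule_ge0.
apply: bilinear_le => //.
- move=> v; apply: (measurableT_comp mF).
  exact: (measurableT_comp (measurable_subl_rV v) measurable_relative).
- exact: (measurable_fun_fubini_tonelli_F (m2 := collision_measure)
    (fun z : V * (V * V) => F (z.1 - enorm z.2.1 *: z.2.2))).
- exact: integral_relative_le.
Qed.

End collision_measure.

(** * Lipschitz estimate for the collision operator *)

Lemma integral_mrestr d (T : measurableType d) (R : realType)
    (m : {measure set T -> \bar R}) (D : set T) (mD : measurable D)
    (f : T -> \bar R) :
  measurable_fun setT f ->
  (\int[mrestr m mD]_x f x = \int[m]_(x in D) f x)%E.
Proof.
move=> mf; rewrite [LHS]integralE [RHS]integralE !ge0_integral_mrestr//.
  exact: measurable_funeneg.
exact: measurable_funepos.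
Qed.

Lemma dot_direction_le1 (R : realType) n (q s : 'rV[R]_n) :
  esphere s -> -1 <= dot (direction q) s <= 1.
Proof.
move=> s1; set u := direction q.
have ss : dot s s = 1.
  have := sqr_sqrtr (dot_ge0 s); rewrite -[Num.sqrt _]/(enorm s).
  by rewrite s1 expr1n.
have uu : dot u u <= 1.
  rewrite -(sqr_sqrtr (dot_ge0 u)) -[Num.sqrt _]/(enorm u) exprn_ile1 ?enorm_ge0//.
  rewrite /u /direction enormZ ger0_norm ?invr_ge0 ?enorm_ge0//.
  have [->|q0] := eqVneq (enorm q) 0; first by rewrite mulr0.
  by rewrite mulVf.
have dotD (t : R) : 0 <= dot u u + 2 * t * dot u s + t ^+ 2 * dot s s.
  have := dot_ge0 (u + t *: s); congr (0 <= _).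
  rewrite /dot !mulr_sumr -!big_split/=; apply: eq_bigr => i _.
  by rewrite !mxE; ring.
have := dotD 1; have := dotD (-1); rewrite ss; lra.
Qed.

Section collision_estimate.
Context {R : realType} (n : nat) (sec : R -> R -> R) (Rt : R).
Hypothesis hsec : is_collision_kernel sec.
Hypothesis Rt0 : 0 < Rt.
Variable M : R.

Hypothesis kernelM : forall p, kernel_domain p -> p.1 < 2 * Rt ->
  Defs.kernel sec p.1 p.2 <= M.
Local Notation V := 'rV[R]_n.
Local Notation D := (@eball R n (2 * Rt) `*` @esphere R n).
Local Notation cmu := (@collision_measure R n (2 * Rt)).
Local Notation bmu := (@box_measure R n).

Let rho0 : 0 < 2 * Rt. Proof. by rewrite mulr_gt0. Qed.

(** Truncating the kernel to the collision domain makes it bounded and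
    measurable on the whole parameter space. *)
Let weight : V * V -> R :=
  (fun p => Defs.kernel sec (enorm p.1) (dot (direction p.1) p.2)) \_ D.

Let domainP p : D p ->
  kernel_domain (enorm p.1, dot (direction p.1) p.2) /\ enorm p.1 < 2 * Rt.
Proof.
move=> [p1 p2]; split => //; split; first exact: enorm_ge0.
exact: dot_direction_le1.
Qed.

Let weight_bound p : `|weight p| <= M.
Proof.
have z0 : kernel_domain (0 : R, 0 : R).
  by split => //=; rewrite lerN10 ler01.
rewrite /weight patchE; case: ifPn => [|_]; last first.
  rewrite normr0; apply: le_trans (kernelM z0 rho0).
  by case: hsec => _; exact.
rewrite inE => /domainP[kd pr].
rewrite ger0_norm; first exact: (kernelM kd).
by case: hsec => _ /(_ _ kd).
Qed.

Let M0 : 0 <= M. Proof. exact: le_trans (normr_ge0 _) (weight_bound 0). Qed.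

Let measurable_kernel_domain : measurable (@kernel_domain R).
Proof.
rewrite (_ : kernel_domain = `[0, +oo[ `*` `[-1, 1])//.
  by apply: measurableX; exact: measurable_itv.
apply/seteqP; split => -[x y] /=; rewrite /kernel_domain/= !in_itv/=.
  by move=> [-> ->].
by move=> [/andP[-> _] ->].
Qed.

Let measurable_weight : measurable_fun setT weight.
Proof.
have mD := @measurable_collision_domain R n (2 * Rt).
apply/(measurable_restrictT _ mD).
pose g (p : V * V) : measurableTypeR R * measurableTypeR R :=
  (enorm p.1, dot (direction p.1) p.2).
have mg : measurable_fun setT g.
  apply: measurable_fun_pair.
    exact: (measurableT_comp (@measurable_enorm R n) measurable_fst).
  apply: measurable_sum => i; apply: measurable_funM.
    apply: (measurableT_comp (measurable_coor i)).
    exact: (measurableT_comp (@measurable_direction R n) measurable_fst).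
  exact: (measurableT_comp (measurable_coor i) measurable_snd).
apply: (measurable_comp (F := @kernel_domain R) (g := g)
  (f := fun p => Defs.kernel sec p.1 p.2)) => //.
- by move=> _ [p Dp <-]; exact: (domainP Dp).1.
- by case: hsec.
- exact: measurable_funTS.
Qed.

(** In terms of [q] and [s], one outgoing velocity is [v + shift (q, s)] and the
    other is [v + shift (q, s) - |q| s]. *)
Let shift (p : V * V) : V := (enorm p.1 / 2) *: p.2 - 2^-1 *: p.1.

Let measurable_shift : measurable_fun setT shift.
Proof.
apply: measurable_rVB; apply: measurable_rVZ => //; try exact: measurable_snd;
  try exact: measurable_fst.
apply: measurable_funM => //.
exact: (measurableT_comp (@measurable_enorm R n) measurable_fst).
Qed.

Let integrand (f : V -> R) (z : V * (V * V)) : R :=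
  weight z.2 * (f (z.1 + shift z.2 - enorm z.2.1 *: z.2.2) *
    f (z.1 + shift z.2) - f (z.1 - z.2.1) * f z.1).

Let measurable_in : measurable_fun setT (fun z : V * (V * V) => z.1 + shift z.2).
Proof.
apply: measurable_rVD; first exact: measurable_fst.
exact: (measurableT_comp measurable_shift measurable_snd).
Qed.

Let measurable_instar : measurable_fun setT
  (fun z : V * (V * V) => z.1 + shift z.2 - enorm z.2.1 *: z.2.2).
Proof.
apply: measurable_rVB => //; apply: measurable_rVZ.
  apply: (measurableT_comp (@measurable_enorm R n)).
  exact: (measurableT_comp measurable_fst measurable_snd).
exact: (measurableT_comp measurable_snd measurable_snd).
Qed.

Let measurable_outstar : measurable_fun setT (fun z : V * (V * V) => z.1 - z.2.1).
Proof.
apply: measurable_rVB; first exact: measurable_fst.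
exact: (measurableT_comp measurable_fst measurable_snd).
Qed.

Let measurable_integrand f : measurable_fun setT f ->
  measurable_fun setT (integrand f).
Proof.
move=> mf; apply: measurable_funM; first exact: (measurableT_comp measurable_weight measurable_snd).
apply: measurable_funB; apply: measurable_funM.
- exact: (measurableT_comp mf measurable_instar).
- exact: (measurableT_comp mf measurable_in).
- exact: (measurableT_comp mf measurable_outstar).
- exact: (measurableT_comp mf measurable_fst).
Qed.

Let collisionE f v : measurable_fun setT f ->
  collision sec Rt f v = \int[cmu]_p integrand f (v, p).
Proof.
move=> mf; rewrite /collision /Rintegral; apply: (congr1 fine).
have mI : measurable_fun setT (fun p => (integrand f (v, p))%:E).
  apply/measurable_EFinP; apply: (measurableT_comp (measurable_integrand mf)).
  exact: pair1_measurable.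
rewrite [RHS]integral_mrestr//; apply: eq_integral => p.
rewrite inE => Dp; congr EFin.
rewrite /integrand /weight/= patchE mem_set//.
have -> : v - (v - p.1) = p.1 by rewrite opprB addrC subrK.
have -> : 2^-1 *: (v + (v - p.1)) + (enorm p.1 / 2) *: p.2 = v + shift p.
  by apply/rowP => i; rewrite !mxE; field.
have -> : 2^-1 *: (v + (v - p.1)) - (enorm p.1 / 2) *: p.2 =
    v + shift p - enorm p.1 *: p.2.
  by apply/rowP => i; rewrite !mxE; field.
by [].
Qed.

Let measurable_collision (f : V -> R) : measurable_fun setT f ->
  measurable_fun setT (collision sec Rt f).
Proof.
move=> mf; have mI : measurable_fun setT (fun z => (integrand f z)%:E).
  by apply/measurable_EFinP; exact: measurable_integrand.
have -> : collision sec Rt f = fun v => fine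
    (\int[cmu]_p ((fun z => (integrand f z)%:E)^\+ (v, p)) -
     \int[cmu]_p ((fun z => (integrand f z)%:E)^\- (v, p)))%E.
  apply/funext => v; rewrite collisionE//; apply: (congr1 fine).
  by rewrite [LHS]integralE; congr (_ - _)%E; apply: eq_integral => p _;
    rewrite ?funeposE ?funenegE.
apply: (measurableT_comp (fine_measurable _)) => //.
apply: emeasurable_funB.
  apply: (measurable_fun_fubini_tonelli_F (m2 := cmu)
    ((fun z => (integrand f z)%:E)^\+)%E) => //.
  exact: measurable_funepos.
apply: (measurable_fun_fubini_tonelli_F (m2 := cmu)
  ((fun z => (integrand f z)%:E)^\-)%E) => //.
exact: measurable_funeneg.
Qed.

Let sqrE (f : V -> R) (v : V) := (f v ^+ 2)%:E.

Let measurable_sqrE f : measurable_fun setT f -> measurable_fun setT (sqrE f).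
Proof. by move=> mf; apply/measurable_EFinP; exact: measurable_funX. Qed.

Let sqrE_ge0 f v : (0 <= sqrE f v)%E.
Proof. by rewrite lee_fin sqr_ge0. Qed.

Let sqrE_periodic f : Defs.periodic f ->
  forall v i, sqrE f (v + (2 * pi) *: delta_mx ord0 i) = sqrE f v.
Proof. by move=> fp v i; rewrite /sqrE fp. Qed.

Definition periodic_L2 (f : V -> R) :=
  square_integrable bmu f /\ Defs.periodic f.

Let K := collision_constant n (2 * Rt).

Let K0 : 0 <= K. Proof. exact: collision_constant_ge0. Qed.

Let gain f g (z : V * (V * V)) : \bar R :=
  (sqrE f (z.1 + shift z.2 - enorm z.2.1 *: z.2.2) * sqrE g (z.1 + shift z.2))%E.

Let loss f g (z : V * (V * V)) : \bar R :=
  (sqrE f (z.1 - z.2.1) * sqrE g z.1)%E.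

Let measurable_gain f g : measurable_fun setT f -> measurable_fun setT g ->
  measurable_fun setT (gain f g).
Proof.
move=> mf mg; apply: emeasurable_funM.
  exact: (measurableT_comp (measurable_sqrE mf) measurable_instar).
exact: (measurableT_comp (measurable_sqrE mg) measurable_in).
Qed.

Let measurable_loss f g : measurable_fun setT f -> measurable_fun setT g ->
  measurable_fun setT (loss f g).
Proof.
move=> mf mg; apply: emeasurable_funM.
  exact: (measurableT_comp (measurable_sqrE mf) measurable_outstar).
exact: (measurableT_comp (measurable_sqrE mg) measurable_fst).
Qed.

Let gain_ge0 f g z : (0 <= gain f g z)%E. Proof. exact: mule_ge0. Qed.

Let loss_ge0 f g z : (0 <= loss f g z)%E. Proof. exact: mule_ge0. Qed.

Let nu := (bmu \x cmu)%E.

Let gain_le f g : periodic_L2 f -> periodic_L2 g ->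
  (\int[nu]_z gain f g z <= (K * nrm bmu f ^+ 2 * nrm bmu g ^+ 2)%:E)%E.
Proof.
move=> [Lf fp] [Lg gp]; have [mf _] := Lf; have [mg _] := Lg.
rewrite /nu fubini_tonelli1//; last exact: measurable_gain.
rewrite (EFinM (K * _)) (EFinM K) !sqr_nrmE//.
exact: (gain_bilinear_le rho0 (measurable_sqrE mf) (sqrE_ge0 f)
  (sqrE_periodic fp) (measurable_sqrE mg) (sqrE_ge0 g) (sqrE_periodic gp)
  measurable_shift).
Qed.

Let loss_le f g : periodic_L2 f -> periodic_L2 g ->
  (\int[nu]_z loss f g z <= (K * nrm bmu f ^+ 2 * nrm bmu g ^+ 2)%:E)%E.
Proof.
move=> [Lf fp] [Lg gp]; have [mf _] := Lf; have [mg _] := Lg.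
rewrite /nu fubini_tonelli1//; last exact: measurable_loss.
rewrite (EFinM (K * _)) (EFinM K) !sqr_nrmE//.
exact: (loss_bilinear_le (2 * Rt) (measurable_sqrE mf) (sqrE_ge0 f)
  (sqrE_periodic fp) (measurable_sqrE mg) (sqrE_ge0 g)).
Qed.

Let periodic_L2B f h : periodic_L2 f -> periodic_L2 h ->
  periodic_L2 (fun v => f v - h v).
Proof.
move=> [Lf fp] [Lh hp]; split; first exact: square_integrableB.
by move=> v i; rewrite fp hp.
Qed.

(** Each difference of products is expanded as [(a - b) a' + b (a' - b')], which
    leaves four bilinear terms with one factor [u]. *)
Let difference_sqr (f h u : V -> R) z : (forall v, u v = f v - h v) ->
  (((integrand f z - integrand h z) ^+ 2)%:E <=
   (4 * M ^+ 2)%:E *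
     ((gain u f z + gain h u z) + (loss u f z + loss h u z)))%E.
Proof.
move=> uE.
pose A := z.1 + shift z.2 - enorm z.2.1 *: z.2.2; pose B := z.1 + shift z.2.
pose C := z.1 - z.2.1.
rewrite -[leRHS]/((4 * M ^+ 2 * ((u A ^+ 2 * f B ^+ 2 + h A ^+ 2 * u B ^+ 2) +
  (u C ^+ 2 * f z.1 ^+ 2 + h C ^+ 2 * u z.1 ^+ 2)))%:E) lee_fin /integrand.
rewrite -/A -/B -/C.
rewrite !uE; set w := weight _.
move: (f A) (f B) (f C) (f z.1) (h A) (h B) (h C) (h z.1).
move=> a1 a2 a3 a4 b1 b2 b3 b4.
rewrite (_ : _ - _ = w * ((a1 - b1) * a2 + b1 * (a2 - b2) -
  ((a3 - b3) * a4 + b3 * (a4 - b4)))); last by ring.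
rewrite -!exprMn.
have wM : w ^+ 2 <= M ^+ 2.
  by rewrite -(real_normK (num_real w)) lerXn2r ?nnegrE// weight_bound.
move: ((a1 - b1) * a2) (b1 * (a2 - b2)) ((a3 - b3) * a4) (b3 * (a4 - b4)).
move=> x1 x2 x3 x4.
have four : (x1 + x2 - (x3 + x4)) ^+ 2 <= 4 * (x1 ^+ 2 + x2 ^+ 2 + (x3 ^+ 2 + x4 ^+ 2)).
  rewrite -subr_ge0 (_ : _ - _ = (x1 - x2) ^+ 2 + (x1 + x3) ^+ 2 + (x1 + x4) ^+ 2
    + (x2 + x3) ^+ 2 + (x2 + x4) ^+ 2 + (x3 - x4) ^+ 2); last by ring.
  by rewrite !addr_ge0 ?sqr_ge0.
rewrite exprMn.
rewrite [leRHS](_ : _ = M ^+ 2 * (4 * (x1 ^+ 2 + x2 ^+ 2 + (x3 ^+ 2 + x4 ^+ 2)))).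
  by apply: ler_pM; rewrite ?sqr_ge0.
by ring.
Qed.

Let difference_le f h : periodic_L2 f -> periodic_L2 h ->
  (\int[nu]_z ((integrand f z - integrand h z) ^+ 2)%:E <=
   (8 * M ^+ 2 * K * (nrm bmu f ^+ 2 + nrm bmu h ^+ 2) *
     nrm bmu (fun v => (f v - h v)%R) ^+ 2)%:E)%E.
Proof.
move=> Lf Lh; have Lu := periodic_L2B Lf Lh; pose u v := f v - h v.
have mf := Lf.1.1; have mh := Lh.1.1; have mu : measurable_fun setT u := Lu.1.1.
have mg1 := measurable_gain mu mf; have mg2 := measurable_gain mh mu.
have ml1 := measurable_loss mu mf; have ml2 := measurable_loss mh mu.
have mg12 : measurable_fun setT (fun z => gain u f z + gain h u z)%E.
  exact: emeasurable_funD.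
have ml12 : measurable_fun setT (fun z => loss u f z + loss h u z)%E.
  exact: emeasurable_funD.
have sg z : (0 <= gain u f z + gain h u z)%E by rewrite adde_ge0.
have sl z : (0 <= loss u f z + loss h u z)%E by rewrite adde_ge0.
apply: (@le_trans _ _ (\int[nu]_z ((4 * M ^+ 2)%:E *
     ((gain u f z + gain h u z) + (loss u f z + loss h u z))))%E).
  apply: ge0_le_integral => //.
  - by move=> z _; rewrite lee_fin sqr_ge0.
  - apply/measurable_EFinP; apply: measurable_funX.
    by apply: measurable_funB; exact: measurable_integrand.
  - by apply: measurable_funeM; exact: emeasurable_funD.
  - by move=> z _; apply: difference_sqr => v.
rewrite ge0_integralZl_EFin//; last 3 first.
- by move=> z _; rewrite adde_ge0.
- exact: emeasurable_funD.
- by rewrite mulr_ge0// sqr_ge0.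
rewrite ge0_integralD// ge0_integralD// ge0_integralD//.
apply: (@le_trans _ _ ((4 * M ^+ 2)%:E *
  ((K * nrm bmu u ^+ 2 * nrm bmu f ^+ 2)%:E + (K * nrm bmu h ^+ 2 * nrm bmu u ^+ 2)%:E
  + ((K * nrm bmu u ^+ 2 * nrm bmu f ^+ 2)%:E + (K * nrm bmu h ^+ 2 * nrm bmu u ^+ 2)%:E)))%E).
  apply: lee_wpmul2l; first by rewrite lee_fin mulr_ge0// sqr_ge0.
  by apply: leeD; apply: leeD; [exact: gain_le|exact: gain_le|exact: loss_le|exact: loss_le].
rewrite -!EFinD -EFinM lee_fin le_eqVlt; apply/orP; left; apply/eqP; ring.
Qed.

Let integrand0 z : integrand (fun=> 0) z = 0.
Proof. by rewrite /integrand !mul0r subr0 mulr0. Qed.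

Let periodic_L2_0 : periodic_L2 (fun=> 0 : R).
Proof. by split => //; exact: square_integrable_cst. Qed.

Let measurable_section f v : measurable_fun setT f ->
  measurable_fun setT (fun p => integrand f (v, p)).
Proof.
move=> mf; apply: (measurableT_comp (measurable_integrand mf)).
exact: pair1_measurable.
Qed.

(** By Tonelli's theorem the integral over the collision parameters is itself an
    integrable function of the velocity, hence finite almost everywhere. *)
Let section_L2 f : periodic_L2 f ->
  {ae bmu, forall v, square_integrable cmu (fun p => integrand f (v, p))}.
Proof.
move=> Lf; have mf := Lf.1.1.
pose g z := ((integrand f z) ^+ 2)%:E.
have mg : measurable_fun setT g.
  by apply/measurable_EFinP; apply: measurable_funX; exact: measurable_integrand.
have g0 z : (0 <= g z)%E by rewrite lee_fin sqr_ge0.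
have mG := measurable_fun_fubini_tonelli_F (m2 := cmu) g mg g0.
have G0 v : (0 <= fubini_F cmu g v)%E by exact: integral_ge0.
have iG : bmu.-integrable setT (fubini_F cmu g).
  apply/integrableP; split => //.
  under eq_integral do rewrite gee0_abs//.
  rewrite -(fubini_tonelli1 (m1 := bmu) g mg g0).
  have := difference_le Lf periodic_L2_0.
  under eq_integral do rewrite integrand0 subr0.
  by move=> /le_lt_trans; apply; exact: ltry.
apply: filterS (integrable_ae measurableT iG) => v /(_ I) fin.
split; first exact: measurable_section.
by rewrite -ge0_fin_numE//; exact: G0.
Qed.

(** The mass of the parameter space comes from the Cauchy-Schwarz inequality in
    the collision parameters, a factor [4] from squaring a sum of four terms and
    a factor [2] from having a gain and a loss. *)
Definition lipschitz_constant : R :=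
  fine (cmu setT) * (8 * M ^+ 2 * collision_constant n (2 * Rt)).

Lemma lipschitz_constant_ge0 : 0 <= lipschitz_constant.
Proof.
apply: mulr_ge0; first exact: fine_ge0.
by apply: mulr_ge0; [rewrite mulr_ge0// sqr_ge0|exact: K0].
Qed.

Let collision_difference f h : periodic_L2 f -> periodic_L2 h ->
  (\int[bmu]_v ((collision sec Rt f v - collision sec Rt h v) ^+ 2)%:E <=
   (lipschitz_constant * (nrm bmu f ^+ 2 + nrm bmu h ^+ 2) *
     nrm bmu (fun v => (f v - h v)%R) ^+ 2)%:E)%E.
Proof.
move=> Lf Lh; have mf := Lf.1.1; have mh := Lh.1.1.
pose g z := ((integrand f z - integrand h z) ^+ 2)%:E.
have mg : measurable_fun setT g.
  apply/measurable_EFinP; apply: measurable_funX.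
  by apply: measurable_funB; exact: measurable_integrand.
have g0 z : (0 <= g z)%E by rewrite lee_fin sqr_ge0.
have mG := measurable_fun_fubini_tonelli_F (m2 := cmu) g mg g0.
have G0 v : (0 <= fubini_F cmu g v)%E by exact: integral_ge0.
have m0 : 0 <= fine (cmu setT) by exact: fine_ge0.
apply: (@le_trans _ _ (\int[bmu]_v ((fine (cmu setT))%:E * fubini_F cmu g v))%E).
  apply: ae_ge0_le_integral => //.
  - by move=> v _; rewrite lee_fin sqr_ge0.
  - apply/measurable_EFinP; apply: measurable_funX.
    by apply: measurable_funB; exact: measurable_collision.
  - by move=> v _; rewrite mule_ge0.
  - exact: measurable_funeM.
  apply: filterS2 (section_L2 Lf) (section_L2 Lh) => v Sf Sh _.
  have Sfh := square_integrableB Sf Sh.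
  have S1 := square_integrable_cst cmu 1.
  rewrite /fubini_F /g -sqr_nrmE// -EFinM lee_fin !collisionE//.
  have -> : (\int[cmu]_p integrand f (v, p) - \int[cmu]_p integrand h (v, p) =
      ip cmu (fun=> 1) (fun p => integrand f (v, p) - integrand h (v, p)))%R.
    rewrite ipBr// /ip; congr (_ - _)%R; apply: eq_Rintegral => p _;
    by rewrite mul1r.
  rewrite -(real_normK (num_real (ip _ _ _))).
  have -> : fine (cmu setT) = nrm cmu (fun=> 1) ^+ 2.
    rewrite sqr_nrm /ip; under eq_Rintegral do rewrite mul1r.
    by rewrite Rintegral_cst// mul1r.
  rewrite -exprMn lerXn2r ?nnegrE ?mulr_ge0 ?nrm_ge0//.
  exact: cauchy_schwarz.
rewrite ge0_integralZl_EFin// -(fubini_tonelli1 (m1 := bmu) g mg g0).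
rewrite /lipschitz_constant -(mulrA (fine _)) -(mulrA (fine _)) EFinM.
rewrite lee_wpmul2l ?lee_fin//.
exact: difference_le.
Qed.

Lemma collision_L2 f : periodic_L2 f ->
  square_integrable bmu (collision sec Rt f).
Proof.
move=> Lf; split; first exact: measurable_collision Lf.1.1.
have c0 (v : V) : collision sec Rt (fun=> 0) v = 0.
  rewrite collisionE//; under eq_Rintegral do rewrite integrand0.
  by rewrite Rintegral_cst// mul0r.
have := collision_difference Lf periodic_L2_0.
under eq_integral do rewrite c0 subr0.
by move=> /le_lt_trans; apply; exact: ltry.
Qed.

(** The difference of the quadratic terms is linear in [f - h], the other factor
    being [f] or [h]. *)
Lemma collision_lipschitz f h : periodic_L2 f -> periodic_L2 h ->
  nrm bmu (fun v => collision sec Rt f v - collision sec Rt h v) <=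
  Num.sqrt lipschitz_constant * (nrm bmu f + nrm bmu h) *
    nrm bmu (fun v => f v - h v).
Proof.
move=> Lf Lh.
have LQ := square_integrableB (collision_L2 Lf) (collision_L2 Lh).
have sum0 : 0 <= nrm bmu f + nrm bmu h by rewrite addr_ge0 ?nrm_ge0.
rewrite -ler_sqr ?nnegrE ?nrm_ge0 ?mulr_ge0 ?sqrtr_ge0//.
rewrite !exprMn (sqr_sqrtr lipschitz_constant_ge0).
apply: (@le_trans _ _ (lipschitz_constant * (nrm bmu f ^+ 2 + nrm bmu h ^+ 2) *
     nrm bmu (fun v => (f v - h v)%R) ^+ 2)).
  by rewrite -lee_fin sqr_nrmE//; exact: collision_difference.
rewrite ler_wpM2r ?sqr_ge0// ler_wpM2l ?lipschitz_constant_ge0//.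
by rewrite sqrrD -addrA lerD2l lerDr mulrn_wge0// mulr_ge0 ?nrm_ge0.
Qed.

End collision_estimate.

(** * Waves and real trigonometric polynomials *)

Section waves.
Context {R : realType} (n : nat).
Local Notation V := 'rV[R]_n.
Implicit Types (k l : 'I_n -> int) (a b : R).

Definition phase k (v : V) : R := \sum_(j < n) (k j)%:~R * v ord0 j.

(** Waves with a phase are used in place of complex exponentials: derivatives and
    products of waves are again combinations of waves. *)
Definition wave k a (v : V) : R := cos (phase k v + a).

Lemma phase_shift k (v w : V) : phase k (v + w) = phase k v + phase k w.
Proof.
by rewrite /phase -big_split/=; apply: eq_bigr => j _; rewrite mxE mulrDr.
Qed.

Lemma phase_delta k (t : R) i : phase k (t *: delta_mx ord0 i) = (k i)%:~R * t.
Proof.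
rewrite /phase (bigD1 i)//= big1 ?addr0; first by rewrite !mxE !eqxx mulr1.
by move=> j ji; rewrite !mxE (negbTE ji) !mulr0.
Qed.

Lemma phase0 v : phase (fun=> 0%R) v = 0.
Proof. by rewrite /phase big1// => j _; rewrite mul0r. Qed.

Lemma phaseN k v : phase (fun j => - k j) v = - phase k v.
Proof.
by rewrite /phase -sumrN; apply: eq_bigr => j _; rewrite rmorphN mulNr.
Qed.

Lemma phaseD k l v : phase (fun j => k j + l j) v = phase k v + phase l v.
Proof.
by rewrite /phase -big_split/=; apply: eq_bigr => j _; rewrite rmorphD mulrDl.
Qed.

Definition axis_freq (i j : 'I_n) : int := if j == i then 1 else 0.

Lemma phase_axis i (v : V) : phase (axis_freq i) v = v ord0 i.
Proof.
rewrite /phase (bigD1 i)//= /axis_freq eqxx mul1r big1 ?addr0// => j /negbTE ->.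
by rewrite mul0r.
Qed.

Lemma wave_periodic k a : Defs.periodic (wave k a).
Proof.
move=> v i; rewrite /wave phase_shift phase_delta addrAC.
apply: (@periodic_intmul R R cos (2 * pi)) => x.
by rewrite mulr_natl cosD2pi.
Qed.

Lemma measurable_wave k a : measurable_fun setT (wave k a).
Proof.
apply: (measurableT_comp (continuous_measurable_fun (@continuous_cos R))).
apply: measurable_funD; last exact: measurable_cst.
apply: measurable_sum => j; apply: measurable_funM; first exact: measurable_cst.
exact: measurable_coor.
Qed.

Lemma wave_le1 k a v : `|wave k a v| <= 1.
Proof. exact: cos_max. Qed.

Lemma wave_mul k l a b v :
  wave k a v * wave l b v =
  2^-1 * wave (fun j => k j + l j) (a + b) v +
  2^-1 * wave (fun j => k j - l j) (a - b) v.
Proof.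
rewrite /wave phaseD (phaseD k (fun j => - l j)) phaseN.
set x := phase k v; set y := phase l v.
rewrite (_ : x + y + (a + b) = (x + a) + (y + b)); last by ring.
rewrite (_ : x - y + (a - b) = (x + a) - (y + b)); last by ring.
by move: (x + a) (y + b) => X Y; rewrite cosD cosB; field.
Qed.

Lemma waveDpi k a v : wave k (a + pi) v = - wave k a v.
Proof. by rewrite /wave addrA cosDpi. Qed.

Lemma wave_phase k a v :
  wave k a v = cos a * wave k 0 v - sin a * wave k (- (pi / 2)) v.
Proof. by rewrite /wave addr0 cosBpihalf cosD; ring. Qed.

Lemma waveN k a v : wave (fun j => - k j) a v = wave k (- a) v.
Proof. by rewrite /wave phaseN -[in RHS]cosN opprD opprK. Qed.

(** The real span of the waves with frequencies in the cube of half side [N];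
   see [trig_polyP]. *)
Inductive trig (N : nat) : (V -> R) -> Prop :=
| trig_wave k a : (forall j, `|k j| <= N%:Z) -> trig N (wave k a)
| trig_add g h : trig N g -> trig N h -> trig N (fun v => g v + h v)
| trig_scale a g : trig N g -> trig N (fun v => a * g v).

Lemma trig_axis i a N : (0 < N)%N -> trig N (wave (axis_freq i) a : V -> R).
Proof.
move=> N0; apply: trig_wave => j; rewrite /axis_freq.
by case: (j == i); rewrite ?normr0// normr1 lez_nat.
Qed.

Lemma trig_cst N a : trig N (fun=> a).
Proof.
rewrite (_ : (fun=> a) = (fun v => a * wave (fun=> 0%R) 0 v)).
  by apply: trig_scale; apply: trig_wave => j; rewrite normr0.
by apply/funext => v; rewrite /wave phase0 addr0 cos0 mulr1.
Qed.

Lemma trigB N g h : trig N g -> trig N h -> trig N (fun v => g v - h v).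
Proof.
move=> tg th; rewrite (_ : (fun _ => _) = fun v => g v + (-1) * h v).
  by apply: trig_add => //; exact: trig_scale.
by apply/funext => v; rewrite mulN1r.
Qed.

Lemma trig_sum N (I : Type) (s : seq I) (P : pred I) (F : I -> V -> R) :
  (forall i, P i -> trig N (F i)) -> trig N (fun v => \sum_(i <- s | P i) F i v).
Proof.
move=> tF; elim: s => [|i s IHs].
  by under eq_fun do rewrite big_nil; exact: trig_cst.
under eq_fun do rewrite big_cons.
by case Pi : (P i) => //; apply: trig_add => //; exact: tF.
Qed.

Lemma trig_le N M g : (N <= M)%N -> trig N g -> trig M g.
Proof.
move=> NM; elim => [k a kN|g1 g2 _ t1 _ t2|a g1 _ t1].
- by apply: trig_wave => j; apply: le_trans (kN j) _; rewrite lez_nat.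
- exact: trig_add.
- exact: trig_scale.
Qed.

Lemma trigM N M g h : trig N g -> trig M h -> trig (N + M) (fun v => g v * h v).
Proof.
move=> tg th; elim: tg => [k a kN|g1 g2 _ t1 _ t2|a g1 _ t1].
- elim: th => [l b lM|h1 h2 _ t1 _ t2|b h1 _ t1].
  + under eq_fun do rewrite wave_mul.
    apply: trig_add; apply: trig_scale; apply: trig_wave => j.
      by rewrite PoszD; apply: le_trans (ler_normD _ _) _; exact: lerD.
    by rewrite PoszD; apply: le_trans (ler_normB _ _) _; exact: lerD.
  + by under eq_fun do rewrite mulrDr; exact: trig_add.
  + by under eq_fun do rewrite mulrCA; exact: trig_scale.
- by under eq_fun do rewrite mulrDl; exact: trig_add.
- by under eq_fun do rewrite -mulrA; exact: trig_scale.
Qed.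

Lemma trig_measurable N g : trig N g -> measurable_fun setT g.
Proof.
elim => [k a _|g1 g2 _ t1 _ t2|a g1 _ t1].
- exact: measurable_wave.
- exact: measurable_funD.
- by apply: measurable_funM => //; exact: measurable_cst.
Qed.

Lemma trig_periodic N g : trig N g -> Defs.periodic g.
Proof.
elim => [k a _|g1 g2 _ t1 _ t2|a g1 _ t1].
- exact: wave_periodic.
- by move=> v i; rewrite t1 t2.
- by move=> v i; rewrite t1.
Qed.

Lemma trig_L2 N g : trig N g -> square_integrable (@box_measure R n) g.
Proof.
elim => [k a _|g1 g2 _ t1 _ t2|a g1 _ t1].
- apply: (@square_integrable_bounded _ _ _ _ _ 1); first exact: measurable_wave.
  exact: wave_le1.
- exact: square_integrableD.
- exact: square_integrableZ.
Qed.

Section frequencies.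
Variable N : nat.

Definition freq (m : {ffun 'I_n -> 'I_(2 * N).+1}) : 'I_n -> int :=
  fun j => (m j)%:Z - N%:Z.

Lemma freq_le m j : `|freq m j| <= N%:Z.
Proof.
rewrite ler_norml /freq; apply/andP; split; first by rewrite lerBrDl subrr.
by rewrite lerBlDr -PoszD addnn -mul2n lez_nat -ltnS.
Qed.

Lemma freq_inj : injective freq.
Proof.
move=> m1 m2 /funeqP m12; apply/ffunP => j; have := m12 j; rewrite /freq.
by move=> /addIr [] /val_inj.
Qed.

Lemma freq_surj k : (forall j, `|k j| <= N%:Z) -> exists m, freq m = k.
Proof.
move=> kN; exists [ffun j => inord (absz (k j + N%:Z))].
apply/funext => j; rewrite /freq ffunE.
have := kN j; rewrite ler_norml => /andP[k1 k2].
have k0 : 0 <= k j + N%:Z by rewrite -lerBlDr sub0r.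
rewrite inordK; last first.
  by rewrite ltnS -lez_nat gez0_abs// mul2n -addnn PoszD lerD2r.
by rewrite gez0_abs// addrK.
Qed.

Lemma phase_freq m (v : V) :
  phase (freq m) v = \sum_(j < n) ((m j)%:R - N%:R) * v ord0 j.
Proof. by apply: eq_bigr => j _; rewrite /freq rmorphB. Qed.

End frequencies.

(** A wave is half the sum of two conjugate exponentials; conversely the real part
    of a coefficient times an exponential is a combination of two waves. *)
Lemma trig_polyP N g : trig_poly N g <-> trig N g.
Proof.
have ReD (x y : R[i]) : complex.Re (x + y) = complex.Re x + complex.Re y.
  by case: x; case: y.
have pick m0 (x : R[i]) (E : {ffun 'I_n -> 'I_(2 * N).+1} -> R[i]) :
    \sum_m (if m == m0 then x else 0) * E m = x * E m0.
  rewrite (bigD1 m0)//= eqxx big1 ?addr0// => m mm.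
  by rewrite (negbTE mm) mul0r.
split=> [[c gE]|].
  have -> : g = fun v => \sum_m (complex.Re (c m) * wave (freq m) 0 v +
      (- complex.Im (c m)) * wave (freq m) (- (pi / 2)) v).
    apply/funext => v; have /(congr1 (@complex.Re R)) := gE v.
    rewrite (big_morph _ ReD (erefl _))/= => ->; apply: eq_bigr => m _.
    rewrite /wave addr0 cosBpihalf phase_freq; case: (c m) => x y /=.
    by rewrite mulNr.
  by apply: trig_sum => m _; apply: trig_add; apply: trig_scale; apply: trig_wave => j; exact: freq_le.
elim => [k a kN|g1 g2 _ [c1 E1] _ [c2 E2]|a g1 _ [c1 E1]].
- have [m1 m1E] := freq_surj kN.
  have [|m2 m2E] := @freq_surj N (fun j => - k j); first by move=> j; rewrite normrN.
  exists (fun m => (if m == m1 then (2^-1 * cos a +i* (2^-1 * sin a))%C else 0) +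
    (if m == m2 then (2^-1 * cos a +i* - (2^-1 * sin a))%C else 0)) => v.
  under eq_bigr do rewrite mulrDl.
  rewrite big_split/= !pick.
  rewrite -!phase_freq m1E m2E phaseN cosN sinN /wave cosD.
  by apply/eqP; rewrite eq_complex /=; apply/andP; split; apply/eqP; field.
- exists (fun m => c1 m + c2 m) => v.
  rewrite rmorphD/= E1 E2 -big_split/=; apply: eq_bigr => m _.
  by rewrite mulrDl.
- exists (fun m => (a%:C)%C * c1 m) => v.
  rewrite rmorphM/= E1 mulr_sumr; apply: eq_bigr => m _.
  by rewrite mulrA.
Qed.

End waves.

(** * Orthogonality of waves and Bessel's inequality *)

Lemma Rintegral_box_translate (R : realType) n (a : 'rV[R]_n) (f : 'rV[R]_n -> R) :
  measurable_fun setT f ->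
  (forall i, a ord0 i = 0 \/ forall v, f (v + (2 * pi) *: delta_mx ord0 i) = f v) ->
  \int[@box_measure R n]_v f (v + a) = \int[@box_measure R n]_v f v.
Proof.
move=> mf fp; apply: (congr1 fine); rewrite [LHS]integralE [RHS]integralE.
have mF : measurable_fun setT (EFin \o f) by exact/measurable_EFinP.
congr (_ - _)%E.
  rewrite -[RHS](integral_box_translate (a := a))//.
  - by apply: eq_integral => v _; rewrite !funeposE.
  - exact: measurable_funepos.
  - move=> i; have [ai|fi] := fp i; [by left|right => v].
    by rewrite !funeposE /= fi.
rewrite -[RHS](integral_box_translate (a := a))//.
- by apply: eq_integral => v _; rewrite !funenegE.
- exact: measurable_funeneg.
- move=> i; have [ai|fi] := fp i; [by left|right => v].
  by rewrite !funenegE /= fi.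
Qed.

Lemma Rintegral_box_opp (R : realType) n (f : 'rV[R]_n -> R) :
  measurable_fun setT f ->
  \int[@box_measure R n]_v f (- v) = \int[@box_measure R n]_v f v.
Proof.
move=> mf; apply: (congr1 fine); rewrite [LHS]integralE [RHS]integralE.
have mF : measurable_fun setT (EFin \o f) by exact/measurable_EFinP.
congr (_ - _)%E.
  rewrite -[RHS]integral_box_opp//; last exact: measurable_funepos.
  by apply: eq_integral => v _; rewrite !funeposE.
rewrite -[RHS]integral_box_opp//; last exact: measurable_funeneg.
by apply: eq_integral => v _; rewrite !funenegE.
Qed.

Section orthogonality.
Context {R : realType} (n : nat).
Local Notation V := 'rV[R]_n.
Local Notation bmu := (@box_measure R n).
Implicit Types (k l : 'I_n -> int) (a b : R).

Definition cell_volume : R := (2 * pi) ^+ n.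

Lemma cell_volume_gt0 : 0 < cell_volume.
Proof. by rewrite exprn_gt0// mulr_gt0// pi_gt0. Qed.

Lemma box_measureT : fine (bmu setT) = cell_volume.
Proof.
rewrite /box_measure /mrestr setTI lebesgue_rV_cube; last first.
  by rewrite ge0_cp// pi_ge0.
by rewrite /cell_volume /= opprK; congr (_ ^+ _); ring.
Qed.

Lemma wave_L2 k a : square_integrable bmu (wave k a).
Proof.
apply: (@square_integrable_bounded _ _ _ _ _ 1); first exact: measurable_wave.
exact: wave_le1.
Qed.

(** A translation by half a wavelength along the axis [j] changes the sign of the
    wave and leaves [f] unchanged. *)
Lemma ip_wave_eq0 k a j (f : V -> R) :
  k j != 0 -> square_integrable bmu f ->
  (forall (t : R) v, f (v + t *: delta_mx ord0 j) = f v) ->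
  ip bmu f (wave k a) = 0.
Proof.
move=> kj Lf fj; have mf := Lf.1; have Lw := wave_L2 k a.
have kj0 : (k j)%:~R != 0 :> R by rewrite intr_eq0.
have mfw : measurable_fun setT (fun v => f v * wave k a v).
  by apply: measurable_funM => //; exact: measurable_wave.
set I := LHS; suff : I = - I.
  by move=> /eqP; rewrite -addr_eq0 -mulr2n mulrn_eq0/= => /eqP.
rewrite {1}/I /ip -(Rintegral_box_translate (a := (pi / (k j)%:~R) *: delta_mx ord0 j))//.
  rewrite /I ipC -ipNl// ipC; apply: eq_Rintegral => v _.
  rewrite fj; congr (_ * _); rewrite /wave phase_shift phase_delta.
  by rewrite mulrCA divff// mulr1 addrAC cosDpi.
move=> i; have [->|ij] := eqVneq i j; last first.
  by left; rewrite !mxE (negbTE ij) andbF mulr0.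
by right => v; rewrite fj wave_periodic.
Qed.

Lemma ip_wave1 k a : ip bmu (fun=> 1) (wave k a) =
  if [forall j, k j == 0] then cell_volume * cos a else 0.
Proof.
case: ifPn => [/forallP k0|]; last first.
  rewrite negb_forall => /existsP[j kj]; apply: (@ip_wave_eq0 k a j (fun=> 1) kj) => //.
  exact: square_integrable_cst.
have -> : k = fun=> 0%R by apply/funext => j; exact/eqP.
rewrite /ip; under eq_Rintegral do rewrite mul1r /wave phase0 add0r.
by rewrite Rintegral_cst// mulrC box_measureT.
Qed.

Lemma ip_wave k l a b : ip bmu (wave k a) (wave l b) =
  2^-1 * cell_volume *
   ((if [forall j, k j + l j == 0] then cos (a + b) else 0) +
    (if [forall j, k j - l j == 0] then cos (a - b) else 0)).
Proof.
have -> : ip bmu (wave k a) (wave l b) = ip bmu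
   (fun v => 2^-1 * wave (fun j => k j + l j) (a + b) v +
             2^-1 * wave (fun j => k j - l j) (a - b) v) (fun=> 1).
  by apply: eq_Rintegral => v _; rewrite wave_mul mulr1.
have L1 := square_integrable_cst bmu 1.
have Lp := wave_L2 (fun j => k j + l j) (a + b).
have Lm := wave_L2 (fun j => k j - l j) (a - b).
rewrite ipDl//; try exact: square_integrableZ.
rewrite !ipZl// !(ipC _ (wave _ _)) !ip_wave1.
by case: ifPn => _; case: ifPn => _; ring.
Qed.

Section fourier.
Variable M : nat.
Local Notation index := {ffun 'I_n -> 'I_(2 * M).+1}.
Implicit Types (P : ('I_n -> int) -> bool) (G : V -> R).

Definition fcos G k : R := ip bmu G (wave k 0).
Definition fsin G k : R := ip bmu G (wave k (- (pi / 2))).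

(** The squared modulus of the complex Fourier coefficient, up to
    normalisation. *)
Definition fpower G k : R := fcos G k ^+ 2 + fsin G k ^+ 2.

Lemma ip_wave_coef G k a : square_integrable bmu G ->
  ip bmu G (wave k a) = cos a * fcos G k - sin a * fsin G k.
Proof.
move=> LG; have L0 := wave_L2 k 0; have L1 := wave_L2 k (- (pi / 2)).
rewrite -!ipZr// -ipBr//; try exact: square_integrableZ.
by congr ip; apply/funext => v; exact: wave_phase.
Qed.

Lemma fcosN G k : fcos G (fun j => - k j) = fcos G k.
Proof. by congr ip; apply/funext => v; rewrite waveN oppr0. Qed.

Lemma fsinN G k : square_integrable bmu G ->
  fsin G (fun j => - k j) = - fsin G k.
Proof.
move=> LG; have L1 := wave_L2 k (- (pi / 2)).
rewrite -[RHS]mulN1r /fsin -ipZr//; congr ip; apply/funext => v.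
by rewrite waveN opprK mulN1r -waveDpi; congr (wave k _ v); field.
Qed.

(** For a symmetric selection [P], a nonzero frequency occurs together with its
    opposite and with the same contribution; this makes up for the factor
    [2^-1] in [ip_wave]. *)
Definition fourier_sum P G (v : V) : R := cell_volume^-1 *
  \sum_(m : index | P (freq m)) (fcos G (freq m) * wave (freq m) 0 v +
    fsin G (freq m) * wave (freq m) (- (pi / 2)) v).

Lemma fourier_sum_trig P G N :
  (forall k, P k -> forall j, `|k j| <= N%:Z) -> trig N (fourier_sum P G).
Proof.
move=> PN; apply: trig_scale; apply: trig_sum => m Pm.
by apply: trig_add; apply: trig_scale; apply: trig_wave => j; exact: PN.
Qed.

Lemma fourier_sum_trigM P G : trig M (fourier_sum P G).
Proof.
apply: trig_scale; apply: trig_sum => m _.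
by apply: trig_add; apply: trig_scale; apply: trig_wave => j; exact: freq_le.
Qed.

Lemma fourier_sum_L2 P G : square_integrable bmu (fourier_sum P G).
Proof. exact: trig_L2 (fourier_sum_trigM P G). Qed.

Let pick_freq P m0 (E : index -> R) :
  \sum_(m : index | P (freq m)) (if m == m0 then E m else 0) =
  if P (freq m0) then E m0 else 0.
Proof.
case: ifPn => Pm.
  rewrite (bigD1 m0)//= eqxx big1 ?addr0// => m /andP[_ mm].
  by rewrite (negbTE mm).
apply: big1 => m Pm'; case: eqP => // e; move: Pm'; rewrite e.
by rewrite (negbTE Pm).
Qed.

Lemma ip_fourier_sum P G l b : (forall k, P (fun j => - k j) = P k) ->
  (forall j, `|l j| <= M%:Z) -> square_integrable bmu G ->
  ip bmu (fourier_sum P G) (wave l b) = if P l then ip bmu G (wave l b) else 0.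
Proof.
move=> Psym lM LG.
have [m1 m1E] := freq_surj lM.
have [|m2 m2E] := @freq_surj n M (fun j => - l j); first by move=> j; rewrite normrN.
have Lw := wave_L2.
have Lt m : square_integrable bmu (fun v => fcos G (freq m) * wave (freq m) 0 v +
    fsin G (freq m) * wave (freq m) (- (pi / 2)) v).
  by apply: square_integrableD; exact: square_integrableZ.
rewrite /fourier_sum ipZl//; last exact: square_integrable_sum.
rewrite ip_suml//.
have E1 m : [forall j, freq m j - l j == 0] = (m == m1).
  apply/forallP/eqP => [e|->]; last by move=> j; rewrite m1E subrr.
  by apply: freq_inj; rewrite m1E; apply/funext => j; apply/eqP; rewrite -subr_eq0.
have E2 m : [forall j, freq m j + l j == 0] = (m == m2).
  apply/forallP/eqP => [e|->]; last by move=> j; rewrite m2E addNr.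
  by apply: freq_inj; rewrite m2E; apply/funext => j; apply/eqP; rewrite -addr_eq0.
transitivity (cell_volume^-1 * (2^-1 * cell_volume) *
  ((\sum_(m : index | P (freq m)) (if m == m2 then
      fcos G (freq m) * cos b + fsin G (freq m) * sin b else 0)) +
   \sum_(m : index | P (freq m)) (if m == m1 then
      fcos G (freq m) * cos b - fsin G (freq m) * sin b else 0))).
  rewrite -big_split/= -mulrA; congr (_ * _); rewrite mulr_sumr.
  apply: eq_bigr => m _.
  rewrite ipDl//; try exact: square_integrableZ.
  rewrite !ipZl// !ip_wave E1 E2 sub0r add0r cosN.
  have -> : cos (- (pi / 2) + b) = sin b by rewrite addrC cosBpihalf.
  have -> : cos (- (pi / 2) - b) = - sin b.
    by rewrite -opprD cosN addrC cosDpihalf.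
  by case: ifPn => _; case: ifPn => _; ring.
rewrite !pick_freq m1E m2E Psym fcosN fsinN// ip_wave_coef//.
have cv0 : cell_volume != 0 by rewrite gt_eqF// cell_volume_gt0.
by case: ifPn => _; field.
Qed.

Lemma ip_fourier_sum_trig P G N g : (forall k, P (fun j => - k j) = P k) ->
  (forall k, (forall j, `|k j| <= N%:Z) -> P k) -> (N <= M)%N ->
  square_integrable bmu G -> trig N g ->
  ip bmu (fourier_sum P G) g = ip bmu G g.
Proof.
move=> Psym PN NM LG; have LS := fourier_sum_L2 P G.
elim => [k a kN|g1 g2 t1 e1 t2 e2|a g1 t1 e1].
- rewrite ip_fourier_sum// ?PN// => j.
  by apply: le_trans (kN j) _; rewrite lez_nat.
- have L1 := trig_L2 t1; have L2 := trig_L2 t2.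
  by rewrite !ipDr// e1 e2.
- by have L1 := trig_L2 t1; rewrite !ipZr// e1.
Qed.

Lemma nrm_fourier_sum P G : (forall k, P (fun j => - k j) = P k) ->
  square_integrable bmu G ->
  nrm bmu (fourier_sum P G) ^+ 2 =
  cell_volume^-1 * \sum_(m : index | P (freq m)) fpower G (freq m).
Proof.
move=> Psym LG; have LS := fourier_sum_L2 P G.
rewrite sqr_nrm {1}/fourier_sum ipZl//; last first.
  apply: square_integrable_sum => m _.
  by apply: square_integrableD; apply: square_integrableZ; exact: wave_L2.
congr (_ * _); rewrite ip_suml//; last first.
  move=> m _.
  by apply: square_integrableD; apply: square_integrableZ; exact: wave_L2.
apply: eq_bigr => m Pm.
have L0 := wave_L2 (freq m) 0; have L1 := wave_L2 (freq m) (- (pi / 2)).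
rewrite ipDl//; try exact: square_integrableZ.
rewrite !ipZl// !(ipC _ (wave _ _)).
rewrite !ip_fourier_sum//; try (by move=> j; exact: freq_le).
by rewrite Pm /fpower !expr2.
Qed.

(** The full sum is an orthogonal projection of [G]. *)
Lemma fourier_bessel G : square_integrable bmu G ->
  cell_volume^-1 * \sum_(m : index) fpower G (freq m) <= nrm bmu G ^+ 2.
Proof.
move=> LG; pose S := fourier_sum xpredT G; have LS : square_integrable bmu S.
  exact: fourier_sum_L2.
rewrite -(@nrm_fourier_sum xpredT)// -/S.
have ipS : ip bmu G S = ip bmu S S.
  rewrite [RHS](@ip_fourier_sum_trig xpredT G M)//.
  exact: fourier_sum_trigM.
have := sqr_ge0 (nrm bmu (fun v => G v - S v)).
by rewrite !sqr_nrm ipBl ?ipBr ?ipS ?(ipC _ S G) ?ipS//; [lra|exact: square_integrableB..].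
Qed.

End fourier.

End orthogonality.

(** * Weak derivatives of pure order *)

Lemma is_derive_cos_affine (R : realType) (x y : R) (z : R) :
  is_derive z 1 (fun h : R => cos (x * h + y)) (- x * sin (x * z + y)).
Proof.
have d1 : is_derive z 1 (fun h : R => x * h + y) x.
  by apply: is_derive_eq; rewrite addr0 [LHS]mulr1.
have := @is_derive1_comp R cos (fun h : R => x * h + y) z _ _ (is_derive_cos _) d1.
by move=> /is_derive_eq; apply; rewrite mulNr mulrC mulNr.
Qed.

Section wave_derivatives.
Context {R : realType} (n : nat).
Local Notation V := 'rV[R]_n.
Implicit Types (k : 'I_n -> int) (a : R).

Lemma is_derive_wave k a i (v : V) (c : R) :
  is_derive v (delta_mx ord0 i) (fun w => c * wave k a w)
    (c * (k i)%:~R * wave k (a + pi / 2) v).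
Proof.
pose x : R := (k i)%:~R; pose y := phase k v + a.
have E : (fun h : R => c * wave k a (h *: delta_mx ord0 i + v)) =
    (fun h : R => c * cos (x * h + y)).
  by apply/funext => h; rewrite /wave phase_shift phase_delta addrA.
have d0 : is_derive (0 : R) 1 (fun h : R => c * cos (x * h + y))
    (c * (- x * sin (x * 0 + y))).
  exact: (is_deriveZ c (is_derive_cos_affine x y 0)).
have D : derivable (fun w => c * wave k a w) v (delta_mx ord0 i).
  by apply/derivable1P; rewrite E; exact: ex_derive.
apply: DeriveDef => //.
have -> : 'D_(delta_mx ord0 i) (fun w => c * wave k a w) v =
    'D_1 (fun h : R => c * cos (x * h + y)) 0.
  rewrite -E /derive; set g1 := fun h => h^-1 *: _; set g2 := fun h => h^-1 *: _.
  suff -> : g1 = g2 by []; apply/funext => h; rewrite /g1 /g2 /=.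
  by rewrite addr0 scale0r add0r [_%:A]mulr1.
rewrite derive_val mulr0 add0r -mulrA; congr (_ * _).
rewrite /wave addrA cosDpihalf -/y mulrN mulNr.
by [].
Qed.

Lemma partials_wave k a s (c : R) :
  partials s (fun v : V => c * wave k a v) =
  fun v => c * (\prod_(i <- s) (k i)%:~R) * wave k (a + (size s)%:R * (pi / 2)) v.
Proof.
elim: s => [|i s IHs] /=.
  by apply/funext => v; rewrite big_nil mulr1 mul0r addr0.
rewrite -/(partials s _) IHs; apply/funext => v.
rewrite (@derive_val _ _ _ _ _ _ _ (is_derive_wave _ _ _ _ _)) big_cons.
have -> : (size s).+1%:R = (size s)%:R + 1 :> R by rewrite natr1.
rewrite (mulrDl (size s)%:R) mul1r addrA; congr (_ * _).
by ring.
Qed.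

Lemma continuous_phase k : continuous (phase k : V -> R).
Proof.
rewrite /phase; elim: (index_enum _) => [|j s IHs].
  have -> : (fun v : V => \sum_(j <- [::]) (k j)%:~R * v ord0 j) = fun=> 0.
    by apply/funext => v; rewrite big_nil.
  exact: cst_continuous.
have -> : (fun v : V => \sum_(i <- j :: s) (k i)%:~R * v ord0 i) =
    fun v => (k j)%:~R * v ord0 j + \sum_(i <- s) (k i)%:~R * v ord0 i.
  by apply/funext => v; rewrite big_cons.
move=> v; apply: (@continuousD _ _ _ (fun v : V => (k j)%:~R * v ord0 j)); last exact: IHs.
apply: (@continuousM _ _ (fun=> (k j)%:~R) (fun v : V => v ord0 j)).
  exact: cst_continuous.
exact: coord_continuous.
Qed.

Lemma continuous_wave k a : continuous (wave k a : V -> R).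
Proof.
move=> v; apply: (@continuous_comp _ _ _ (fun w => phase k w + a) cos).
  apply: (@continuousD _ _ _ (phase k) (fun=> a)); first exact: continuous_phase.
  exact: cst_continuous.
exact: continuous_cos.
Qed.

Lemma smooth_wave k a : smooth (wave k a : V -> R).
Proof.
have E : (wave k a : V -> R) = fun v => 1 * wave k a v.
  by apply/funext => v; rewrite mul1r.
move=> s; rewrite E partials_wave; split=> [v|i v].
  apply: (@continuousM _ _ (fun=> _) (wave k _)); first exact: cst_continuous.
  exact: continuous_wave.
exact: (@ex_derive _ _ _ _ _ _ _ (is_derive_wave _ _ _ _ _)).
Qed.

(** Derivatives along a single axis are enough to detect a large frequency, since
    some component of it is large. *)
Definition pure_index (r : nat) (j : 'I_n) : multi_index n r :=
  [ffun i => if i == j then ord_max else ord0].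

Lemma mlength_pure_index r j : mlength (pure_index r j) = r.
Proof.
rewrite /mlength (bigD1 j)//= ffunE eqxx big1 ?addn0// => i ij.
by rewrite ffunE (negbTE ij).
Qed.

Lemma flatten_pure_index r j :
  flatten [seq nseq (pure_index r j i) i | i <- enum 'I_n] = nseq r j.
Proof.
have nil (s : seq 'I_n) : j \notin s ->
    flatten [seq nseq (pure_index r j i) i | i <- s] = [::].
  elim: s => //= i s IHs; rewrite inE negb_or eq_sym => /andP[ij js].
  by rewrite ffunE (negbTE ij) IHs.
have [s1 [s2 E]] : exists s1 s2, enum 'I_n = s1 ++ j :: s2.
  have jin : j \in enum 'I_n by rewrite mem_enum.
  by case/splitPr: jin => s1 s2; exists s1, s2.
have := enum_uniq 'I_n; rewrite E cat_uniq /= => /and4P[_ /norP[j1 _] j2 _].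
by rewrite map_cat flatten_cat/= !nil// ffunE eqxx cats0.
Qed.

Lemma weak_partial_wave r j (G D : V -> R) k a :
  square_integrable (@box_measure R n) G ->
  weak_partial (pure_index r j) G D ->
  (k j)%:~R ^+ r * ip (@box_measure R n) G (wave k (a + r%:R * (pi / 2))) =
  (-1) ^+ r * ip (@box_measure R n) D (wave k a).
Proof.
move=> LG /(_ (wave k a) (@wave_periodic R n k a) (smooth_wave k a)).
rewrite mlength_pure_index -[inner D _]/(ip (@box_measure R n) D (wave k a)) => <-.
rewrite /mpartial flatten_pure_index -ipZr//; last exact: wave_L2.
congr ip; rewrite (_ : wave k a = fun v => 1 * wave k a v); last first.
  by apply/funext => v; rewrite mul1r.
rewrite partials_wave size_nseq big_nseq iter_mulr_1; apply/funext => v.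
by rewrite mul1r.
Qed.

Lemma fpower_rotate (G : V -> R) k a : square_integrable (@box_measure R n) G ->
  fpower G k = ip (@box_measure R n) G (wave k (0 + a)) ^+ 2 +
    ip (@box_measure R n) G (wave k (- (pi / 2) + a)) ^+ 2.
Proof.
move=> LG; rewrite !ip_wave_coef// add0r.
have -> : cos (- (pi / 2) + a) = sin a by rewrite addrC cosBpihalf.
have -> : sin (- (pi / 2) + a) = - cos a by rewrite addrC sinBpihalf.
have := cos2Dsin2 a; rewrite /fpower; move: (cos a) (sin a) => x y xy.
rewrite -[LHS]mul1r -xy; ring.
Qed.

(** Testing the weak derivative against a wave multiplies the coefficient by a
    power of the frequency and rotates it by a quarter turn [r] times; rotations
    do not affect the modulus. *)
Lemma fpower_weak_partial r j (G D : V -> R) k :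
  square_integrable (@box_measure R n) G ->
  weak_partial (pure_index r j) G D ->
  (k j)%:~R ^+ (2 * r) * fpower G k = fpower D k.
Proof.
move=> LG w; rewrite (fpower_rotate _ (r%:R * (pi / 2)) LG).
rewrite mulnC exprM mulrDr -!exprMn !(weak_partial_wave _ _ LG w).
have e : ((-1) ^+ r) ^+ 2 = 1 :> R by rewrite -exprM mulnC exprM sqrrN !expr1n.
by rewrite !exprMn e !mul1r.
Qed.

End wave_derivatives.

(** * Density of trigonometric polynomials *)

Section L2_convergence.
Context d (T : measurableType d) (R : realType).
Variable mu : {finite_measure set T -> \bar R}.

Lemma L2_dominated (f g : T -> R) (f_ : nat -> T -> R) :
  measurable_fun setT f -> (forall m, measurable_fun setT (f_ m)) ->
  square_integrable mu g ->
  (forall x, `|f x| <= g x) -> (forall m x, `|f_ m x| <= g x) ->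
  {ae mu, forall x, f_ ^~ x @ \oo --> f x} ->
  forall e, 0 < e -> exists m, nrm mu (fun x => f x - f_ m x) < e.
Proof.
move=> mf mf_ Lg fg f_g cvf e e0; have mg := Lg.1.
pose F_ m x := ((f x - f_ m x) ^+ 2)%:E.
pose G x := ((2 * g x) ^+ 2)%:E.
have Ldiff m : square_integrable mu (fun x => f x - f_ m x).
  by apply: square_integrableB; apply: (square_integrable_le _ Lg) => // x;
    rewrite (le_trans _ (ler_norm _)).
have mF_ m : measurable_fun setT (F_ m).
  by apply/measurable_EFinP; apply: measurable_funX; exact: measurable_funB.
have iG : mu.-integrable setT G.
  have := square_integrableZ 2 Lg => L2g.
  by apply/square_integrableP => //; exact: L2g.1.
have F_G : {ae mu, forall x m, [set: T] x -> (`|F_ m x| <= G x)%E}.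
  apply: aeW => x m _; rewrite /F_ /G /= lee_fin ger0_norm ?sqr_ge0//.
  rewrite -(real_normK (num_real (_ - _))) lerXn2r ?nnegrE//.
    by rewrite mulr_ge0// (le_trans _ (fg x)).
  by rewrite (le_trans (ler_normB _ _))// mulr_natl mulr2n lerD.
have cvF : {ae mu, forall x, [set: T] x -> F_ ^~ x @ \oo --> 0%E}.
  apply: filterS cvf => x cx _; rewrite /F_.
  apply: cvg_EFin; first exact: nearW.
  have cd : (f x - f_ m x) @[m --> \oo] --> (0 : R).
    rewrite -[X in _ --> X](subrr (f x)); apply: cvgB => //; exact: cvg_cst.
  rewrite (_ : fine \o _ = (fun m => f x - f_ m x) \* (fun m => f x - f_ m x)).
    by rewrite -[X in _ --> X](mul0r 0); exact: cvgM.
  by apply/funext => m; rewrite /= expr2.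
have [_ _] := dominated_convergence measurableT mF_
  (measurable_cst (0%E : \bar R)) cvF iG F_G.
rewrite integral0 => /fine_cvgP[_ cI].
have e2 : 0 < e ^+ 2 by rewrite exprn_gt0.
have := @cvgr_lt R nat \oo _ _ _ cI _ e2.
case=> m _ /(_ m (leqnn m)) /= Hm; exists m.
rewrite -(ltr_pXn2r (n := 2)) ?nnegrE ?nrm_ge0 ?ltW//.
by move: Hm; rewrite -(sqr_nrmE (Ldiff m)).
Qed.

End L2_convergence.

Section sharp_threshold.
Context {R : realType}.
Implicit Types (x y q s : R) (n : nat).

Lemma bernoulli_ge y n : -1 <= y -> 1 + n%:R * y <= (1 + y) ^+ n.
Proof.
move=> y1; elim: n => [|n IHn]; first by rewrite mul0r addr0 expr0.
have y10 : 0 <= 1 + y by lra.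
rewrite exprS; apply: le_trans (ler_wpM2l y10 IHn).
have -> : n.+1%:R = n%:R + 1 :> R by rewrite natr1.
have := mulr_ge0 (ler0n R n) (sqr_ge0 y); set N := n%:R; nra.
Qed.

(** A polynomial in [s] that tends to a step function with its jump at [2^-1]:
    by Bernoulli's inequality it is at least [1 - (2 s)^n], and it is at most
    the inverse of [(1 + s^n)^(2^n)], hence of [(2 s)^n]. *)
Definition sharpen n s := (1 - s ^+ n) ^+ (2 ^ n).

Lemma sharpen_itv n s : 0 <= s <= 1 -> 0 <= sharpen n s <= 1.
Proof.
move=> /andP[s0 s1]; have sn : 0 <= 1 - s ^+ n by rewrite subr_ge0 exprn_ile1.
rewrite /sharpen exprn_ge0//= exprn_ile1// gerBl exprn_ge0//.
Qed.

Lemma cvg_sharpen_lo s : 0 <= s < 2^-1 -> sharpen n s @[n --> \oo] --> (1 : R).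
Proof.
move=> /andP[s0 s1].
apply: (@squeeze_cvgr _ _ _ _ (fun n => 1 - (2 * s) ^+ n) (fun=> 1)).
- apply: nearW => n; have sn1 : s ^+ n <= 1 by apply: exprn_ile1 => //; lra.
  have sn0 : 0 <= s ^+ n by exact: exprn_ge0.
  apply/andP; split; last first.
    by have /andP[] : 0 <= sharpen n s <= 1 by apply: sharpen_itv; lra.
  have := @bernoulli_ge (- s ^+ n) (2 ^ n)%N; rewrite natrX exprMn mulrN.
  by apply; lra.
- rewrite -[X in _ --> X]subr0; apply: cvgB; first exact: cvg_cst.
  by apply: cvg_expr; rewrite ger0_norm; lra.
- exact: cvg_cst.
Qed.

Lemma cvg_sharpen_hi s : 2^-1 < s <= 1 -> sharpen n s @[n --> \oo] --> (0 : R).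
Proof.
move=> /andP[s0 s1].
apply: (@squeeze_cvgr _ _ _ _ (fun=> 0) (fun n => ((2 * s)^-1) ^+ n)).
- apply: nearW => n; have sn1 : s ^+ n <= 1 by apply: exprn_ile1 => //; lra.
  have sn0 : 0 <= s ^+ n by apply: exprn_ge0; lra.
  apply/andP; split.
    by have /andP[] : 0 <= sharpen n s <= 1 by apply: sharpen_itv; lra.
  have s2 : 0 < (2 * s) ^+ n by apply: exprn_gt0; lra.
  rewrite exprVn -[leRHS]div1r ler_pdivlMr//.
  have B : (2 * s) ^+ n <= (1 + s ^+ n) ^+ (2 ^ n).
    apply: le_trans (@bernoulli_ge (s ^+ n) (2 ^ n)%N _); last lra.
    by rewrite natrX exprMn lerDr.
  apply: le_trans (ler_wpM2l _ B) _.
    by rewrite exprn_ge0; lra.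
  by rewrite -exprMn exprn_ile1//; nra.
- exact: cvg_cst.
- apply: cvg_expr; rewrite ger0_norm ?invr_ge0; last lra.
  by rewrite invf_lt1; lra.
Qed.

End sharp_threshold.

Section null_sets.
Context {R : realType}.

Definition hyperplane n (j : 'I_n) (c : R) : set 'rV[R]_n :=
  [set v | v ord0 j = c].

Lemma measurable_hyperplane n (j : 'I_n) (c : R) :
  measurable (@hyperplane n j c).
Proof.
rewrite (_ : hyperplane _ _ =
    (fun v : 'rV[R]_n => v ord0 j : measurableTypeR R) @^-1` [set c]) //.
by rewrite -[X in measurable X]setTI; apply: measurable_coor.
Qed.

Lemma lebesgue_hyperplane n (j : 'I_n) (c : R) :
  lebesgue_rV n (hyperplane j c) = 0%E.
Proof.
elim: n j => [[]//|n IHn] j /=; rewrite /lebesgue_rV_step /pushforward.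
case: (unliftP ord0 j) => [i|] ->.
  transitivity ((@lebesgue_measure R \x lebesgue_rV n)%E
      (setT `*` hyperplane i c)); last first.
    by rewrite product_measure1E ?IHn ?mule0//; exact: measurable_hyperplane.
  by congr (_ _); apply/seteqP; split => -[x v]; rewrite /hyperplane /= mxE liftK //; case.
transitivity ((@lebesgue_measure R \x lebesgue_rV n)%E ([set c] `*` setT)).
  by congr (_ _); apply/seteqP; split => -[x v]; rewrite /hyperplane /= mxE unlift_none //; case.
by rewrite product_measure1E// [X in (X * _)%E]lebesgue_measure_set1 mul0e.
Qed.

(** The sharpened cosine converges everywhere except at its jump and at the
    faces of the cell, where periodicity creates a second jump. *)
Lemma box_interior n (j : 'I_n) (c : R) :
  {ae @box_measure R n, forall v : 'rV[R]_n, - pi < v ord0 j < pi /\ v ord0 j != c}.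
Proof.
exists (~` cube (- pi) pi `|` hyperplane j (- pi)
  `|` hyperplane j pi `|` hyperplane j c); split.
- apply: measurableU; last exact: measurable_hyperplane.
  apply: measurableU; last exact: measurable_hyperplane.
  apply: measurableU; last exact: measurable_hyperplane.
  by apply: measurableC; exact: measurable_cube.
- have H x : box_measure (@hyperplane n j x) = 0%E.
    rewrite /box_measure /mrestr; apply/eqP; rewrite eq_le measure_ge0 andbT.
    rewrite -(lebesgue_hyperplane j x); apply: le_measure; rewrite ?inE.
    + apply: measurableI; [exact: measurable_hyperplane|exact: measurable_cube].
    + exact: measurable_hyperplane.
    + by move=> v [].
  have C0 : box_measure (~` @cube R n (- pi) pi) = 0%E.
    by rewrite /box_measure /mrestr setICl measure0.
  have mh x : measurable (@hyperplane n j x) by exact: measurable_hyperplane.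
  have mC : measurable (~` @cube R n (- pi) pi).
    by apply: measurableC; exact: measurable_cube.
  by rewrite !measureU0; do ?[exact: H|exact: C0|exact: mh|exact: mC|apply: measurableU].
- move=> v /= /not_andP[/negP|/negP/negPn/eqP]; last by right.
  move=> H; have [vc|?] := pselect (cube (- pi) pi v); last by left; left; left.
  have := vc j; rewrite in_itv/= => /andP[v1 v2].
  move: H; rewrite negb_and -!leNgt => /orP[v3|v3].
    by left; left; right; apply/eqP; rewrite eq_le v1 v3.
  by left; right; apply/eqP; rewrite eq_le v2 v3.
Qed.

End null_sets.

Section trig_dense.
Context {R : realType} (n : nat).
Local Notation V := 'rV[R]_n.
Local Notation bmu := (@box_measure R n).
Implicit Types (A B : set V) (G : V -> R).

Definition trig_approx G :=
  forall e : R, 0 < e -> exists M g, trig M g /\ nrm bmu (fun v => G v - g v) < e.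

(** The bounds [0 <= g <= 1] make the class stable under products, hence under
    intersections. *)
Definition trig_approx_set A := measurable A /\
  forall e : R, 0 < e -> exists M g,
    [/\ trig M g, forall v, 0 <= g v <= 1 & nrm bmu (fun v => \1_A v - g v) < e].

Lemma indic_L2 A : measurable A -> square_integrable bmu (\1_A : V -> R).
Proof.
move=> mA; apply: (@square_integrable_bounded _ _ _ _ _ 1).
  exact: measurable_indic.
by move=> v; rewrite indicE ger0_norm ?ler0n// lern1 leq_b1.
Qed.

Lemma trig_approx_setC A : trig_approx_set A -> trig_approx_set (~` A).
Proof.
move=> [mA hA]; split; first exact: measurableC.
move=> e e0; have [M [g [tg g01 ge]]] := hA e e0.
exists M, (fun v => 1 - g v); split.
- by apply: trigB => //; exact: trig_cst.
- by move=> v; have := g01 v; lra.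
- rewrite nrm_distC in ge; [|exact: indic_L2|exact: trig_L2 tg].
  move: ge; congr (nrm _ _ < _); apply/funext => v; rewrite !indicE in_setC.
  by case: (v \in A) => /=; ring.
Qed.

Lemma trig_approx_setI A B :
  trig_approx_set A -> trig_approx_set B -> trig_approx_set (A `&` B).
Proof.
move=> [mA hA] [mB hB]; split; first exact: measurableI.
move=> e e0; have e20 : 0 < e / 2 by lra.
have [M [g [tg g01 ge]]] := hA _ e20; have [K [h [th h01 he]]] := hB _ e20.
exists (M + K)%N, (fun v => g v * h v); split; first exact: trigM.
  by move=> v; have := g01 v; have := h01 v; nra.
have LA := indic_L2 mA; have LB := indic_L2 mB.
have Lg := trig_L2 tg; have Lh := trig_L2 th.
have [mh _] := Lh; have [mAf _] := LA.
have LBh := square_integrableB LB Lh; have LAg := square_integrableB LA Lg.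
have mul_L2 (f1 f2 : V -> R) : measurable_fun setT f1 -> (forall v, `|f1 v| <= 1) ->
    square_integrable bmu f2 -> square_integrable bmu (fun v => f1 v * f2 v) /\
    nrm bmu (fun v => f1 v * f2 v) <= nrm bmu f2.
  move=> m1 b1 L2; have b12 v : `|f1 v * f2 v| <= `|f2 v|.
    by rewrite normrM ler_piMl.
  have L12 : square_integrable bmu (fun v => f1 v * f2 v).
    by apply: (square_integrable_le _ L2 b12); apply: measurable_funM => //; exact: L2.1.
  by split => //; apply: nrm_le.
have [L1 N1] := mul_L2 (\1_A) (fun v => \1_B v - h v) mAf
  ltac:(by move=> v; rewrite indicE ger0_norm ?ler0n// lern1 leq_b1) LBh.
have [L2 N2] := mul_L2 h (fun v => \1_A v - g v) mh
  ltac:(by move=> v; have /andP[h0 h1] := h01 v; rewrite ger0_norm) LAg.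
rewrite (_ : (fun _ => _) = fun v => \1_A v * (\1_B v - h v) + h v * (\1_A v - g v)).
  by apply: le_lt_trans (nrmD L1 L2) _; lra.
by apply/funext => v; rewrite indicI /=; ring.
Qed.

Lemma trig_approx_setU A B :
  trig_approx_set A -> trig_approx_set B -> trig_approx_set (A `|` B).
Proof.
move=> hA hB; rewrite -[_ `|` _]setCK setCU; apply: trig_approx_setC.
by apply: trig_approx_setI; exact: trig_approx_setC.
Qed.

Lemma trig_approx_set0 : trig_approx_set set0.
Proof.
split => // e e0; exists 0%N, (fun=> 0); split; first exact: trig_cst.
  by move=> v; rewrite lexx ler01.
rewrite (_ : (fun _ => _) = fun=> 0).
  by rewrite /nrm /ip (_ : (fun _ => _) = fun=> 0) ?Rintegral_cst ?mul0r ?sqrtr0//;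
     apply/funext => v; rewrite mul0r.
by apply/funext => v; rewrite indic0 subr0.
Qed.

Lemma trig_approx_bigcup (F : (set V)^nat) :
  (forall i, trig_approx_set (F i)) -> trig_approx_set (\bigcup_i F i).
Proof.
move=> hF; have mF : measurable (\bigcup_i F i).
  by apply: bigcup_measurable => i _; have [] := hF i.
split => // e e0; have e20 : 0 < e / 2 by lra.
pose U m := \big[setU/set0]_(i < m) F i.
have hU m : trig_approx_set (U m).
  rewrite /U; elim/big_ind : _ => //; first exact: trig_approx_set0.
  exact: trig_approx_setU.
have mU m : measurable (U m) by have [] := hU m.
have b1 A v : `|\1_A v| <= (cst 1 v : R).
  by rewrite indicE ger0_norm ?ler0n// lern1 leq_b1.
have cvU v : (\1_(U m) v : R) @[m --> \oo] --> (\1_(\bigcup_i F i) v : R).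
  apply: cvg_near_cst.
  have [[k _ Fk]|nF] := pselect ((\bigcup_i F i) v).
    exists k.+1 => //= m km; rewrite !indicE !mem_set//.
      by exists k.
    by rewrite /U -bigcup_mkord; exists k.
  apply: nearW => m; rewrite !indicE !memNset//.
  by rewrite /U -bigcup_mkord => -[k _ Fk]; apply: nF; exists k.
have [m Hm] := @L2_dominated _ _ _ bmu (\1_(\bigcup_i F i)) (cst 1)
  (fun m => \1_(U m)) (indic_L2 mF).1 (fun m => (indic_L2 (mU m)).1)
  (square_integrable_cst _ 1) (b1 _) (fun m => b1 (U m)) (aeW _ cvU) _ e20.
have [_ /(_ _ e20) [M [g [tg g01 ge]]]] := hU m.
exists M, g; split => //.
have := nrm_triangle (indic_L2 mF) (indic_L2 (mU m)) (trig_L2 tg).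
by move=> H; apply: le_lt_trans H _; rewrite [e]splitr; exact: ltrD.
Qed.


Lemma trig_expr N g k : trig N g -> exists M, trig M (fun v : V => g v ^+ k).
Proof.
move=> tg; elim: k => [|k [M IH]].
  by exists 0%N; under eq_fun do rewrite expr0; exact: trig_cst.
by exists (N + M)%N; under eq_fun do rewrite exprS; exact: trigM.
Qed.

Lemma trig_sharpen N g k : trig N g -> exists M, trig M (fun v : V => sharpen k (g v)).
Proof.
move=> /(trig_expr k)[M tM]; apply: (@trig_expr M); apply: trigB => //.
exact: trig_cst.
Qed.

(** The sign of the left side is that of [x - c] on the period cell: the cosine
    is centred at the midpoint of [c] and [pi]. *)
Lemma cos_ray (c x : R) :
  cos (x - (c + pi) / 2) - cos ((pi - c) / 2) =
  2 * (sin ((x - c) / 2) * sin ((pi - x) / 2)).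
Proof.
have -> : x - (c + pi) / 2 = (x - c) / 2 - (pi - x) / 2 by field.
have -> : (pi - c) / 2 = (x - c) / 2 + (pi - x) / 2 by field.
by rewrite cosB cosD; ring.
Qed.

Lemma trig_approx_ray (j : 'I_n) (c : R) :
  trig_approx_set [set v : V | c < v ord0 j].
Proof.
have mA : measurable [set v : V | c < v ord0 j].
  rewrite (_ : [set _ | _] =
    (fun v : V => v ord0 j : measurableTypeR R) @^-1` `]c, +oo[%classic).
    by rewrite -[X in measurable X]setTI; apply: measurable_coor.
  by apply/seteqP; split => v /=; rewrite in_itv/= andbT.
split=> // e e0.
have pi0 := @pi_gt0 R.
(* Only the part of the ray inside the period cell matters. *)
pose c' := Num.max (- pi) (Num.min c pi).
pose s (v : V) := 2^-1 + (cos ((pi - c') / 2) - wave (axis_freq j) (- ((c' + pi) / 2)) v) / 4.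
have ts : trig 1 s.
  rewrite (_ : s = fun v => (2^-1 + cos ((pi - c') / 2) / 4) -
    4^-1 * wave (axis_freq j) (- ((c' + pi) / 2)) v).
    apply: trigB; first exact: trig_cst.
    by apply: trig_scale; exact: trig_axis.
  by apply/funext => v; rewrite /s; field.
have s01 v : 0 <= s v <= 1.
  have := @cos_max R ((pi - c') / 2); have := wave_le1 (axis_freq j) (- ((c' + pi) / 2)) v.
  by rewrite /s !ler_norml; lra.
have sE v : s v = 2^-1 - 2^-1 * (sin ((v ord0 j - c') / 2) * sin ((pi - v ord0 j) / 2)).
  by have := cos_ray c' (v ord0 j); rewrite /s /wave phase_axis; lra.
have c'pi : - pi <= c' <= pi.
  rewrite /c' le_max lexx/= ge_max; apply/andP; split; first lra.
  by rewrite ge_min lexx orbT.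
have cvs : {ae bmu, forall v : V,
    sharpen m (s v) @[m --> \oo] --> (\1_[set v : V | c < v ord0 j] v : R)}.
  apply: filterS (box_interior j c') => v [/andP[v1 v2] vc].
  have sb : 0 < sin ((pi - v ord0 j) / 2).
    by apply: sin_gt0_pi; apply/andP; split; lra.
  have [cv|cv] := ltP c (v ord0 j).
    rewrite indicE mem_set//=; apply: cvg_sharpen_lo.
    have /andP[-> _] := s01 v; rewrite sE.
    have c'v : c' < v ord0 j.
      by rewrite /c' gt_max v1 gt_min cv.
    have sa : 0 < sin ((v ord0 j - c') / 2).
      by apply: sin_gt0_pi; apply/andP; split; lra.
    by have := mulr_gt0 sa sb; lra.
  rewrite indicE memNset//=; last by apply/negP; rewrite -leNgt.
  apply: cvg_sharpen_hi; have /andP[_ ->] := s01 v; rewrite andbT sE.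
  have c'v : v ord0 j < c'.
    rewrite lt_neqAle vc /c' le_max le_min cv (ltW v2) orbT //.
  have sa : 0 < sin ((c' - v ord0 j) / 2).
    by apply: sin_gt0_pi; apply/andP; split; lra.
  have -> : (v ord0 j - c') / 2 = - ((c' - v ord0 j) / 2) by ring.
  by rewrite sinN; have := mulr_gt0 sa sb; lra.
have tm m := trig_sharpen m ts.
have b1 m v : `|sharpen m (s v)| <= (cst 1 v : R).
  by have /andP[? ?] := sharpen_itv m (s01 v); rewrite ger0_norm.
have bA v : `|\1_[set v : V | c < v ord0 j] v| <= (cst 1 v : R).
  by rewrite indicE ger0_norm ?ler0n// lern1 leq_b1.
have mm m : measurable_fun setT (fun v => sharpen m (s v)).
  by have [M tM] := tm m; exact: trig_measurable tM.
have [m Hm] := @L2_dominated _ _ _ bmu _ (cst 1) (fun m v => sharpen m (s v))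
  (indic_L2 mA).1 mm (square_integrable_cst _ 1) bA b1 cvs _ e0.
have [M tM] := tm m; exists M, (fun v => sharpen m (s v)); split => // v.
exact: sharpen_itv.
Qed.

(** The half-spaces orthogonal to the axes generate the sigma-algebra. *)
Lemma trig_approx_measurable A : measurable A -> trig_approx_set A.
Proof.
move: A; apply: smallest_sub.
  split; first exact: trig_approx_set0.
    by move=> A hA; rewrite setTD; exact: trig_approx_setC.
  exact: trig_approx_bigcup.
rewrite -bigcup_seq; apply: bigcup_sub => i _ _ [B mB <-]; rewrite setTI.
move: mB; rewrite RGenOInfty.measurableE => mB.
suff H : (@RGenOInfty.G R).-sigma.-measurable `<=`
  [set B : set R | trig_approx_set ((fun v : V => v ord0 i) @^-1` B)].
  exact: H _ mB.
apply: smallest_sub.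
  split => /=.
  - by rewrite preimage_set0; exact: trig_approx_set0.
  - by move=> C hC; rewrite setTD preimage_setC; exact: trig_approx_setC.
  - by move=> F hF; rewrite preimage_bigcup; exact: trig_approx_bigcup.
move=> _ [c ->] /=; rewrite (_ : _ @^-1` _ = [set v : V | c < v ord0 i]).
  exact: trig_approx_ray.
by apply/seteqP; split => v /=; rewrite in_itv/= andbT.
Qed.

Lemma trig_approxD G H : square_integrable bmu G -> square_integrable bmu H ->
  trig_approx G -> trig_approx H -> trig_approx (fun v => G v + H v).
Proof.
move=> LG LH aG aH e e0; have e20 : 0 < e / 2 by lra.
have [M [g [tg ge]]] := aG _ e20; have [K [h [th he]]] := aH _ e20.
exists (maxn M K), (fun v => g v + h v); split.
  apply: trig_add; [apply: trig_le tg; exact: leq_maxl|].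
  by apply: trig_le th; exact: leq_maxr.
have := nrmD (square_integrableB LG (trig_L2 tg)) (square_integrableB LH (trig_L2 th)).
have -> : (fun x => G x - g x + (H x - h x)) = (fun v => G v + H v - (g v + h v)).
  by apply/funext => v; ring.
by move=> X; apply: le_lt_trans X _; rewrite [e]splitr; exact: ltrD.
Qed.

Lemma trig_approxZ a G : square_integrable bmu G ->
  trig_approx G -> trig_approx (fun v => a * G v).
Proof.
move=> LG aG e e0; have a1 : 0 < `|a| + 1 by rewrite ltr_wpDl.
have [|M [g [tg ge]]] := aG (e / (`|a| + 1)); first exact: divr_gt0.
exists M, (fun v => a * g v); split; first exact: trig_scale.
have -> : (fun v => a * G v - a * g v) = (fun v => a * (G v - g v)).
  by apply/funext => v; rewrite mulrBr.
rewrite nrmZ; last by apply: square_integrableB => //; exact: trig_L2 tg.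
move: ge; rewrite ltr_pdivlMr// mulrC mulrDl mul1r => /le_lt_trans; apply.
by rewrite lerDl nrm_ge0.
Qed.

Lemma trig_approx_limit G g (F : nat -> V -> R) :
  measurable_fun setT G -> (forall m, square_integrable bmu (F m)) ->
  square_integrable bmu g -> (forall v, `|G v| <= g v) ->
  (forall m v, `|F m v| <= g v) -> (forall v, F ^~ v @ \oo --> G v) ->
  (forall m, trig_approx (F m)) -> square_integrable bmu G -> trig_approx G.
Proof.
move=> mG LF Lg Gg Fg cvF aF LG e e0; have e20 : 0 < e / 2 by lra.
have [m Hm] := L2_dominated mG (fun m => (LF m).1) Lg Gg Fg (aeW _ cvF) e20.
have [M [h [th he]]] := aF m _ e20; exists M, h; split => //.
have := nrm_triangle LG (LF m) (trig_L2 th).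
by move=> H; apply: le_lt_trans H _; rewrite [e]splitr; exact: ltrD.
Qed.

Import HBNNSimple.

Lemma trig_approx_ge0 G : square_integrable bmu G -> (forall v, 0 <= G v) ->
  trig_approx G.
Proof.
move=> LG G0; have mG := LG.1.
have mGE : measurable_fun [set: V] (EFin \o G) by apply/measurable_EFinP.
pose F m := nnsfun_approx (@measurableT _ V) mGE m.
have FG m v : F m v <= G v.
  have GE0 x : [set: V] x -> (0 <= (EFin \o G) x)%E by rewrite lee_fin.
  by have := @le_approx _ _ _ _ _ m v GE0 I; rewrite lee_fin /F nnsfun_approxE.
have Fabs m v : `|F m v| <= G v by rewrite ger0_norm.
have LF m : square_integrable bmu (F m).
  apply: (square_integrable_le _ LG); first exact: measurable_funTS.
  by move=> v; rewrite (le_trans (Fabs m v))// ler_norm.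
apply: (@trig_approx_limit G G (fun m => F m)) => //.
- by move=> v; rewrite ger0_norm.
- move=> v; have GE0 x : [set: V] x -> (0 <= (EFin \o G) x)%E by rewrite lee_fin.
  have := @cvg_approx _ _ _ _ _ v GE0 I (ltry _).
  by under eq_cvg do rewrite -(nnsfun_approxE measurableT mGE).
move=> m; rewrite (_ : (F m : V -> R) = fun v =>
    \sum_(y \in range (F m)) y * \1_(F m @^-1` [set y]) v); last first.
  by apply/funext => v; exact: fimfunE.
have fin : finite_set (range (F m)) by exact: fimfunP.
under eq_fun do rewrite fsbig_finite//=.
have mF y : measurable (F m @^-1` [set y]) by exact: measurable_sfunP.
suff H s : trig_approx (fun v => \sum_(y <- s) y * \1_(F m @^-1` [set y]) v).
  exact: H.
elim: s => [|y s IHs].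
  under eq_fun do rewrite big_nil; move=> e e0; exists 0%N, (fun=> 0).
  split; first exact: trig_cst.
  under [X in nrm _ X]eq_fun do rewrite subrr.
  have := @nrmZ _ _ _ bmu 0 (fun=> 0) (square_integrable_cst _ 0).
  by under [X in nrm _ X = _]eq_fun do rewrite mul0r; rewrite normr0 mul0r => ->.
have L1 (z : R) : square_integrable bmu (fun v => z * \1_(F m @^-1` [set z]) v).
  by apply: square_integrableZ; exact: indic_L2.
rewrite (_ : (fun _ => _) = fun v => y * \1_(F m @^-1` [set y]) v +
    \sum_(z <- s) z * \1_(F m @^-1` [set z]) v); last first.
  by apply/funext => v; rewrite big_cons.
apply: trig_approxD => //; first exact: square_integrable_sum.
apply: trig_approxZ; first exact: indic_L2.
move=> e e0; have [_ /(_ e e0) [M [g [tg _ ge]]]] := trig_approx_measurable (mF y).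
by exists M, g.
Qed.

Lemma trig_dense G : square_integrable bmu G -> trig_approx G.
Proof.
move=> LG; have mG := LG.1.
have part (u : R -> R) : measurable_fun setT u -> (forall x, `|u x| <= `|x|) ->
    square_integrable bmu (fun v => u (G v)).
  move=> mu ub; apply: (square_integrable_le _ LG) => //.
  exact: measurableT_comp.
have Lp : square_integrable bmu (fun v => Num.max (G v) 0).
  apply: (part (fun x => Num.max x 0)); first exact: measurable_maxr.
  by move=> x; rewrite /Num.max; case: ifP; rewrite ?normr0.
have Ln : square_integrable bmu (fun v => Num.max (- G v) 0).
  apply: (part (fun x => Num.max (- x) 0)).
    by apply: measurable_maxr => //; exact: measurableT_comp.
  by move=> x; rewrite /Num.max; case: ifP; rewrite ?normr0 ?normrN.
rewrite (_ : G = fun v => Num.max (G v) 0 + -1 * Num.max (- G v) 0).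
  apply: trig_approxD => //; first exact: square_integrableZ.
    by apply: trig_approx_ge0 => // v; rewrite le_max lexx orbT.
  apply: trig_approxZ => //.
  by apply: trig_approx_ge0 => // v; rewrite le_max lexx orbT.
apply/funext => v; rewrite /Num.max oppr_lt0; case: ltgtP => [||->]; lra.
Qed.

End trig_dense.

(** * Truncation error of Fourier sums *)

Section best_approximation.
Context d (T : measurableType d) (R : realType).
Variable mu : {finite_measure set T -> \bar R}.
Implicit Types f g h : T -> R.

Lemma pythagoras f g h : square_integrable mu f -> square_integrable mu g ->
  square_integrable mu h ->
  ip mu (fun x => f x - g x) (fun x => g x - h x) = 0 ->
  nrm mu (fun x => f x - h x) ^+ 2 =
  nrm mu (fun x => f x - g x) ^+ 2 + nrm mu (fun x => g x - h x) ^+ 2.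
Proof.
move=> Lf Lg Lh fgh.
have := sqr_nrmD (square_integrableB Lf Lg) (square_integrableB Lg Lh).
rewrite fgh mulr0 addr0 => <-; congr (nrm _ _ ^+ 2).
by apply/funext => x; ring.
Qed.

Lemma best_approximation f g h : square_integrable mu f ->
  square_integrable mu g -> square_integrable mu h ->
  ip mu (fun x => f x - g x) (fun x => g x - h x) = 0 ->
  nrm mu (fun x => f x - g x) <= nrm mu (fun x => f x - h x).
Proof.
move=> Lf Lg Lh fgh; rewrite -(ler_pXn2r (n := 2)) ?nnegrE ?nrm_ge0//.
by rewrite (pythagoras Lf Lg Lh fgh) lerDl sqr_ge0.
Qed.

End best_approximation.

Section jackson.
Context {R : realType} (n : nat).
Local Notation V := 'rV[R]_n.
Local Notation bmu := (@box_measure R n).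
Implicit Types (G g : V -> R).

Definition fproj N G : V -> R := fourier_sum N xpredT G.

Lemma fproj_trig N G : trig N (fproj N G).
Proof. exact: fourier_sum_trigM. Qed.

Lemma fproj_L2 N G : square_integrable bmu (fproj N G).
Proof. exact: fourier_sum_L2. Qed.

Lemma ip_fproj N G g : square_integrable bmu G -> trig N g ->
  ip bmu (fproj N G) g = ip bmu G g.
Proof. by move=> LG tg; apply: (@ip_fourier_sum_trig _ _ _ _ _ N). Qed.

Lemma fproj_best N G g : square_integrable bmu G -> trig N g ->
  nrm bmu (fun v => G v - fproj N G v) <= nrm bmu (fun v => G v - g v).
Proof.
move=> LG tg; have Lg := trig_L2 tg; have LP := fproj_L2 N G.
apply: best_approximation => //; have tP := trigB (fproj_trig N G) tg.
by rewrite ipBl ?(ip_fproj LG tP) ?subrr//; exact: trig_L2 tP.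
Qed.

(** Outside the cube of half side [N] some component of the frequency exceeds
    [N], so the Fourier coefficient is at most [N ^- r] times that of a pure derivative
    of order [r]; Bessel's inequality then bounds the tail. *)
Lemma jackson N r G (D : 'I_n -> V -> R) : (0 < N)%N ->
  square_integrable bmu G ->
  (forall j, square_integrable bmu (D j) /\ weak_partial (pure_index r j) G (D j)) ->
  (nrm bmu (fun v => G v - fproj N G v) * N%:R ^+ r) ^+ 2 <=
  \sum_j nrm bmu (D j) ^+ 2.
Proof.
move=> N0 LG hD.
pose s := Num.sqrt (\sum_j nrm bmu (D j) ^+ 2).
have s0 : 0 <= \sum_j nrm bmu (D j) ^+ 2 by apply: sumr_ge0 => j _; exact: sqr_ge0.
have Nr : 0 < (N%:R : R) ^+ r by rewrite exprn_gt0// ltr0n.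
suff H : nrm bmu (fun v => G v - fproj N G v) <= s / N%:R ^+ r.
  rewrite -[leRHS]sqr_sqrtr// lerXn2r ?nnegrE ?sqrtr_ge0//.
    by rewrite mulr_ge0 ?nrm_ge0// ltW.
  by rewrite -ler_pdivlMr.
apply/ler_addgt0Pl => e e0.
(* The full sum of degree [M] is within [e] of [G]; its part of degree at most
   [N] competes with [fproj N G], and the rest is [W]. *)
have [M0 [g [tg ge]]] := trig_dense LG e0.
pose M := maxn N M0; have NM : (N <= M)%N := leq_maxl _ _.
have {}tg : trig M g by apply: trig_le tg; exact: leq_maxr.
pose P (k : 'I_n -> int) := [forall j, `|k j| <= N%:Z].
have P_sym k : P (fun j => - k j) = P k by apply: eq_forallb => j; rewrite normrN.
pose L := fourier_sum M P G; pose W := fourier_sum M (fun k => ~~ P k) G.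
have tL : trig N L by apply: fourier_sum_trig => k /forallP.
have LL := trig_L2 tL; have LW : square_integrable bmu W by exact: fourier_sum_L2.
have LPW : fproj M G = fun v => L v + W v.
  apply/funext => v; rewrite /fproj /L /W /fourier_sum -mulrDr; congr (_ * _).
  by rewrite [LHS](bigID (fun m => P (freq m))).
apply: le_trans (fproj_best LG tL) _.
have LP := fproj_L2 M G.
apply: le_trans (nrm_triangle LG LP LL) _; apply: lerD.
  by apply: le_trans (fproj_best LG tg) _; exact: ltW.
rewrite (_ : (fun _ => _) = W); last first.
  by apply/funext => v; rewrite LPW [L v + W v]addrC addrK.
rewrite -(ler_pXn2r (n := 2)) ?nnegrE ?nrm_ge0 ?divr_ge0 ?sqrtr_ge0 ?(ltW Nr)//.
rewrite nrm_fourier_sum//; last by move=> k; rewrite P_sym.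
rewrite expr_div_n sqr_sqrtr// ler_pdivlMr ?exprn_gt0 ?ltr0n//.
apply: (@le_trans _ _ (\sum_j (cell_volume n)^-1 *
    \sum_(m : {ffun 'I_n -> 'I_(2 * M).+1}) fpower (D j) (freq m))); last first.
  by apply: ler_sum => j _; apply: fourier_bessel; have [] := hD j.
rewrite -mulr_sumr -mulrA ler_pM2l ?invr_gt0 ?cell_volume_gt0//.
rewrite exchange_big/= mulr_suml big_mkcond/=.
have fp0 (H : V -> R) k : 0 <= fpower H k by rewrite addr_ge0 ?sqr_ge0.
apply: ler_sum => m _; case: ifPn => [|_]; last first.
  by apply: sumr_ge0 => j _; exact: fp0.
rewrite negb_forall => /existsP[j]; rewrite -ltNge => kj.
apply: (@le_trans _ _ (fpower (D j) (freq m))); last first.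
  by rewrite [leRHS](bigD1 j)//= lerDl sumr_ge0// => i _; exact: fp0.
have [LD wD] := hD j; rewrite -(fpower_weak_partial _ LG wD) mulrC.
apply: ler_wpM2r; first exact: fp0.
rewrite -exprM mulnC.
rewrite (exprM (freq m j)%:~R) -(@real_normK _ ((freq m j)%:~R)) ?num_real// -exprM.
rewrite lerXn2r ?nnegrE// -intr_norm.
by rewrite -[leLHS]/(N%:Z%:~R) ler_int ltW.
Qed.

Lemma jackson_sobolev N r G : (0 < N)%N -> (0 < n)%N ->
  square_integrable bmu G ->
  ((nrm bmu (fun v => G v - fproj N G v) * N%:R ^+ r / Num.sqrt n%:R)%:E
     <= sobolev_norm r G)%E.
Proof.
move=> N0 n0 LG; apply: le_ereal_inf_tmp => _ [D hD <-].
have LD (a : multi_index n r) : (mlength a <= r)%N ->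
    square_integrable bmu (D a) /\ weak_partial a G (D a).
  by move=> /hD[[_ /Lfun2P]].
under eq_bigr => a ar do rewrite /L2norm (Lnorm2E (LD a ar).1) -EFin_expe.
rewrite sumEFin /= lee_fin ler_pdivrMr ?sqrtr_gt0 ?ltr0n//.
rewrite -sqrtrM ?sumr_ge0// => [|a _]; last exact: sqr_ge0.
rewrite -(ler_pXn2r (n := 2)) ?nnegrE ?sqrtr_ge0 ?mulr_ge0 ?nrm_ge0 ?exprn_ge0//.
rewrite sqr_sqrtr; last by rewrite mulr_ge0// sumr_ge0// => a _; exact: sqr_ge0.
apply: le_trans (jackson (D := fun j => D (pure_index r j)) N0 LG _) _.
  by move=> j; apply: LD; rewrite mlength_pure_index.
(* Each of the [n] pure derivatives is one term of the Sobolev sum. *)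
rewrite mulrC -[n in n%:R]card_ord -sum1_card natr_sum mulr_suml.
apply: ler_sum => j _; rewrite mul1r (bigD1 (pure_index r j)) ?mlength_pure_index//=.
by rewrite lerDl sumr_ge0// => a _; exact: sqr_ge0.
Qed.

End jackson.

(** * Moments and their lifts *)

Section collision_invariants.
Context {R : realType} (n : nat).
Local Notation V := 'rV[R]_n.
Local Notation bmu := (@box_measure R n).
Implicit Types (f g h G : V -> R) (t : 'rV[R]_(1 + n + 1)).

(** The collision invariants [1], [v_i] and [|v|^2], indexed as in [Phi]. *)
Definition invariant (j : 'I_(1 + n + 1)) : V -> R := fun v => Phi v ord0 j.

Definition mass_index : 'I_(1 + n + 1) := lshift 1 (lshift n ord0).
Definition momentum_index (i : 'I_n) : 'I_(1 + n + 1) := lshift 1 (rshift 1 i).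
Definition energy_index : 'I_(1 + n + 1) := rshift (1 + n) ord0.

Lemma invariant_mass : invariant mass_index = fun=> 1.
Proof.
by apply/funext => v; rewrite /invariant /Phi /mass_index !row_mxEl mxE eqxx.
Qed.

Lemma invariant_momentum i : invariant (momentum_index i) = fun v => v ord0 i.
Proof.
by apply/funext => v; rewrite /invariant /Phi /momentum_index row_mxEl row_mxEr.
Qed.

Lemma invariant_energy :
  invariant energy_index = fun v => \sum_(i < n) v ord0 i ^+ 2.
Proof.
apply/funext => v; rewrite /invariant /Phi /energy_index row_mxEr mxE eqxx mulr1n.
by rewrite /enorm sqr_sqrtr ?dot_ge0//; apply: eq_bigr => i _; rewrite expr2.
Qed.

Variant index_spec : 'I_(1 + n + 1) -> Prop :=
| MassIndex : index_spec mass_index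
| MomentumIndex i : index_spec (momentum_index i)
| EnergyIndex : index_spec energy_index.

Lemma indexP j : index_spec j.
Proof.
case: (split_ordP j) => [k|k] ->; last by rewrite (ord1 k); constructor.
by case: (split_ordP k) => [l|l] ->; rewrite ?(ord1 l); constructor.
Qed.

(** The invariants are unbounded, but the measure lives on a cube. *)
Lemma square_integrable_cube f (C : R) : measurable_fun setT f ->
  (forall v, cube (- pi) pi v -> `|f v| <= C) -> square_integrable bmu f.
Proof.
move=> mf fC; have mf2 : measurable_fun setT (fun v => (f v ^+ 2)%:E).
  by apply/measurable_EFinP; exact: measurable_funX.
split => //; rewrite integral_box// => [|v]; last by rewrite lee_fin sqr_ge0.
have mc := @measurable_cube R n (- pi) pi.
apply: (@le_lt_trans _ _ (\int[lebesgue_rV n]_(v in cube (- pi) pi) (C ^+ 2)%:E)%E).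
  apply: ge0_le_integral => //.
  - by move=> v _; rewrite lee_fin sqr_ge0.
  - exact: measurable_funTS.
  - move=> v /fC vC; rewrite lee_fin -(real_normK (num_real (f v))).
    by rewrite lerXn2r ?nnegrE// (le_trans _ vC).
rewrite integral_cst//= lebesgue_rV_cube; first exact: ltry.
by rewrite ge0_cp// pi_ge0.
Qed.

Lemma coor_L2 i : square_integrable bmu (fun v : V => v ord0 i).
Proof.
apply: (@square_integrable_cube _ pi); first exact: measurable_coor.
by move=> v /(_ i); rewrite in_itv/= ler_norml.
Qed.

Lemma coor2_L2 i : square_integrable bmu (fun v : V => v ord0 i ^+ 2).
Proof.
apply: (@square_integrable_cube _ (pi ^+ 2)).
  by apply: measurable_funX; exact: measurable_coor.
move=> v /(_ i); rewrite in_itv/= -ler_norml => vi.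
by rewrite normrX lerXn2r ?nnegrE// pi_ge0.
Qed.

Lemma invariant_L2 j : square_integrable bmu (invariant j).
Proof.
case: (indexP j) => [|i|].
- by rewrite invariant_mass; exact: square_integrable_cst.
- by rewrite invariant_momentum; exact: coor_L2.
- by rewrite invariant_energy; apply: square_integrable_sum => i _; exact: coor2_L2.
Qed.

Lemma momentsE f j : moments f ord0 j = ip bmu f (invariant j).
Proof. by rewrite mxE. Qed.

Lemma momentsD f g : square_integrable bmu f -> square_integrable bmu g ->
  moments (fun v => f v + g v) = moments f + moments g.
Proof.
move=> Lf Lg; apply/rowP => j.
by rewrite [in RHS]mxE !momentsE ipDl//; exact: invariant_L2.
Qed.

Lemma momentsB f g : square_integrable bmu f -> square_integrable bmu g ->
  moments (fun v => f v - g v) = moments f - moments g.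
Proof.
move=> Lf Lg; apply/rowP => j.
by rewrite [in RHS]mxE [X in _ = _ + X]mxE !momentsE ipBl//; exact: invariant_L2.
Qed.

Lemma momentsZ (a : R) f : square_integrable bmu f ->
  moments (fun v => a * f v) = a *: moments f.
Proof.
move=> Lf; apply/rowP => j.
by rewrite [in RHS]mxE !momentsE ipZl//; exact: invariant_L2.
Qed.

Definition norm1 t : R := \sum_j `|t ord0 j|.

Definition moment_constant : R := \sum_j nrm bmu (invariant j).

Lemma moment_constant_ge0 : 0 <= moment_constant.
Proof. by apply: sumr_ge0 => j _; exact: nrm_ge0. Qed.

Lemma norm1_moments f : square_integrable bmu f ->
  norm1 (moments f) <= moment_constant * nrm bmu f.
Proof.
move=> Lf; rewrite mulr_suml; apply: ler_sum => j _; rewrite momentsE mulrC.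
by apply: cauchy_schwarz => //; exact: invariant_L2.
Qed.

End collision_invariants.

Section positivity.
Context d (T : measurableType d) (R : realType).
Variable mu : {finite_measure set T -> \bar R}.

Lemma Rintegral_gt0 (F : T -> R) : (0 < mu setT)%E ->
  mu.-integrable setT (EFin \o F) -> {ae mu, forall x, 0 < F x} ->
  0 < \int[mu]_x F x.
Proof.
move=> mu0 iF F0; have mF := measurable_int _ iF.
have FE : (\int[mu]_x (F x)%:E = \int[mu]_x `|(F x)%:E|)%E.
  apply: ae_eq_integral => //; first exact: measurableT_comp.
  by apply: filterS F0 => x x0 _; rewrite /= gtr0_norm.
have I0 : (0 <= \int[mu]_x (F x)%:E)%E.
  by rewrite FE; apply: integral_ge0 => x _; exact: abse_ge0.
rewrite lt_neqAle fine_ge0// andbT; apply/eqP => /esym /eqP E.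
have : (\int[mu]_x (F x)%:E)%E = 0%E.
  have := integrable_fin_num measurableT iF => /fineK <-.
  by congr EFin; exact/eqP.
rewrite FE => /(ae_eq_integral_abs mu measurableT mF) F00.
have : {ae mu, forall x : T, False}.
  by apply: filterS2 F0 F00 => x x0 /(_ I) [] x00; rewrite x00 ltxx in x0.
case=> A [mA A0 sA]; suff : mu setT = 0%E by move=> X; rewrite X ltxx in mu0.
apply/eqP; rewrite eq_le measure_ge0 andbT -A0; apply: le_measure; rewrite ?inE//.
by move=> x _; apply: sA.
Qed.

End positivity.

Section moment_lift.
Context {R : realType} (n : nat).
Local Notation V := 'rV[R]_n.
Local Notation bmu := (@box_measure R n).
Implicit Types (f g h G : V -> R) (t : 'rV[R]_(1 + n + 1)).

Lemma box_measureT_gt0 : (0 < bmu setT)%E.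
Proof.
rewrite lt_neqAle measure_ge0 andbT; apply/eqP => E.
by have := @cell_volume_gt0 R n; rewrite -box_measureT -E ltxx.
Qed.

Lemma ip_gt0 f g : square_integrable bmu f -> square_integrable bmu g ->
  {ae bmu, forall v, 0 < f v * g v} -> 0 < ip bmu f g.
Proof.
move=> Lf Lg; apply: Rintegral_gt0; first exact: box_measureT_gt0.
exact: integrable_mul.
Qed.

Lemma ip_odd f g : square_integrable bmu f -> square_integrable bmu g ->
  (forall v, f (- v) * g (- v) = - (f v * g v)) -> ip bmu f g = 0.
Proof.
move=> Lf Lg odd.
have := @Rintegral_box_opp R n _ (measurable_funM Lf.1 Lg.1).
under eq_Rintegral do rewrite /= odd -mulN1r.
rewrite RintegralZl//; last exact: integrable_mul.
by rewrite /ip /=; lra.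
Qed.

Definition axis_sin i : V -> R := wave (axis_freq i) (- (pi / 2)).
Definition axis_cos i : V -> R := wave (axis_freq i) 0.

Lemma axis_sinE i : axis_sin i = fun v => sin (v ord0 i).
Proof. by apply/funext => v; rewrite /axis_sin /wave phase_axis cosBpihalf. Qed.

Lemma axis_cosE i : axis_cos i = fun v => cos (v ord0 i).
Proof. by apply/funext => v; rewrite /axis_cos /wave phase_axis addr0. Qed.

Lemma ip_axis_eq0 i a f : square_integrable bmu f ->
  (forall (s : R) v, f (v + s *: delta_mx ord0 i) = f v) ->
  ip bmu f (wave (axis_freq i) a) = 0.
Proof. by apply: ip_wave_eq0; rewrite /axis_freq eqxx. Qed.

Lemma coor_translate (i j : 'I_n) (s : R) (v : V) : i != j ->
  (v + s *: delta_mx ord0 j) ord0 i = v ord0 i.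
Proof. by move=> ij; rewrite !mxE (negbTE ij) andbF mulr0 addr0. Qed.

(** The other moments vanish, by invariance in the direction [i] or by parity, and
    [x sin x] is positive on the period cell. *)
Lemma moments_axis_sin i : exists2 s : R, 0 < s &
  forall j, moments (axis_sin i) ord0 j = s * (j == momentum_index i)%:R.
Proof.
have LS : square_integrable bmu (axis_sin i) by exact: wave_L2.
exists (ip bmu (fun v : V => v ord0 i) (axis_sin i)).
  apply: ip_gt0 => //; first exact: coor_L2.
  apply: filterS (box_interior i 0) => v [/andP[v1 v2] v0].
  rewrite axis_sinE; have [vp|vn|v00] := ltgtP (v ord0 i) 0.
  - rewrite -mulrNN -sinN mulr_gt0 ?oppr_gt0// sin_gt0_pi//.
    by rewrite oppr_gt0 vp/= ltrNl.
  - by rewrite mulr_gt0// sin_gt0_pi// vn v2.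
  - by rewrite v00 eqxx in v0.
move=> j; rewrite momentsE ipC; case: (indexP j) => [|k|].
- rewrite invariant_mass ip_axis_eq0//; last exact: square_integrable_cst.
  by rewrite (_ : (_ == _) = false) ?mulr0.
- rewrite invariant_momentum; have [->|ki] := eqVneq k i.
    by rewrite eqxx mulr1.
  rewrite ip_axis_eq0; [|exact: coor_L2|by move=> s v; rewrite coor_translate].
  rewrite (_ : (_ == _) = false) ?mulr0//; apply: contraNF ki => /eqP.
  by move=> /lshift_inj /rshift_inj ->.
- rewrite ip_odd//; first by rewrite eq_rlshift mulr0.
    exact: invariant_L2.
  move=> v; rewrite invariant_energy axis_sinE mxE sinN mulrN.
  by congr (- (_ * _)); apply: eq_bigr => k _; rewrite mxE sqrrN.
Qed.

(** Again by invariance or parity, only the energy moment survives; its sign is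
    that of the integral of [v_i^2 cos v_i]. *)
Lemma moments_axis_cos i : exists2 s : R, s != 0 &
  forall j, moments (axis_cos i) ord0 j = s * (j == energy_index n)%:R.
Proof.
have LC : square_integrable bmu (axis_cos i) by exact: wave_L2.
have L1 a : square_integrable bmu (fun v : V => v ord0 i ^+ 2 - a).
  by apply: square_integrableB; [exact: coor2_L2|exact: square_integrable_cst].
exists (ip bmu (invariant (energy_index n)) (axis_cos i)).
  (* Constants are orthogonal to the cosine, and subtracting [(pi / 2)^2] from
     [v_i^2] makes the integrand of one sign. *)
  suff : 0 < ip bmu (fun v : V => - (v ord0 i ^+ 2 - (pi / 2) ^+ 2)) (axis_cos i).
    rewrite ipNl// ipBl//; [|exact: coor2_L2|exact: square_integrable_cst].
    rewrite (ip_axis_eq0 0 (square_integrable_cst bmu ((pi / 2) ^+ 2))) //.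
    rewrite invariant_energy.
    rewrite ip_suml// => [|j _]; last exact: coor2_L2.
    rewrite (bigD1 i)//= big1 ?addr0 => [|j ji]; last first.
      rewrite ip_axis_eq0 //; first exact: coor2_L2.
      by move=> s v; rewrite coor_translate.
    by rewrite subr0 oppr_gt0 => /lt_eqF ->.
  apply: ip_gt0 => //; first exact: square_integrableN.
  have pi0 := @pi_gt0 R.
  apply: filterS2 (box_interior i (pi / 2)) (box_interior i (- (pi / 2))).
  move=> v [/andP[v1 v2] vp] [_ vn]; rewrite axis_cosE opprB subr_sqr.
  have [H|H|H] := ltgtP `|v ord0 i| (pi / 2).
  - move: H; rewrite ltr_norml => H; have /andP[h1 h2] := H.
    by rewrite mulr_gt0 ?cos_gt0_pihalf// mulr_gt0; lra.
  - rewrite -mulrNN -cosDpi.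
    have s0 : 0 < sin (`|v ord0 i| - pi / 2).
      have vpi : `|v ord0 i| < pi by rewrite ltr_norml v1.
      by apply: sin_gt0_pi; apply/andP; split; lra.
    have cE : cos (v ord0 i + pi) = sin (`|v ord0 i| - pi / 2).
      rewrite cosDpi -sinBpihalf; have [v0|v0] := ger0P (v ord0 i) => //.
      by rewrite sinBpihalf sinBpihalf cosN.
    rewrite cE mulr_gt0//.
    rewrite -subr_sqr opprB -[v ord0 i ^+ 2]real_normK ?num_real//.
    by rewrite subr_gt0 ltrXn2r ?nnegrE ?divr_ge0// ltW.
  - move: vp vn; move: H; case: (ger0P (v ord0 i)) => _ H.
      by rewrite H eqxx.
    by rewrite -H opprK eqxx.
move=> j; rewrite momentsE ipC; case: (indexP j) => [|k|].
- rewrite invariant_mass ip_axis_eq0//; last exact: square_integrable_cst.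
  by rewrite (_ : (_ == _) = false) ?mulr0.
- rewrite invariant_momentum ip_odd//; last 2 first.
  + exact: coor_L2.
  + by move=> v; rewrite axis_cosE !mxE cosN mulNr.
  by rewrite eq_lrshift mulr0.
- by rewrite eqxx mulr1.
Qed.

(** Multiples of the sines for the momenta, of one cosine for the energy, and a
    constant corrected by that cosine for the mass. *)
Lemma moment_dual_basis : (0 < n)%N -> exists e : 'I_(1 + n + 1) -> V -> R,
  forall j, (forall N, (0 < N)%N -> trig N (e j)) /\
    moments (e j) = delta_mx ord0 j.
Proof.
move=> n0; suff H j : exists e : V -> R,
    (forall N, (0 < N)%N -> trig N e) /\ moments e = delta_mx ord0 j.
  by have [e He] := choice H; exists e.
pose i0 := Ordinal n0.
have [c c0 cE] := moments_axis_cos i0.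
have LC : square_integrable bmu (axis_cos i0) by exact: wave_L2.
have tC a N : (0 < N)%N -> trig N (fun v => a * axis_cos i0 v).
  by move=> N0; apply: trig_scale; exact: trig_axis.
case: (indexP j) => [|i|].
- pose m2 := ip bmu (fun=> 1) (invariant (energy_index n)).
  have V0 := @cell_volume_gt0 R n.
  exists (fun v => (cell_volume n)^-1 - (m2 / cell_volume n / c) * axis_cos i0 v).
  split=> [N N0|]; first by apply: trigB; [exact: trig_cst|exact: tC].
  have L1 := @square_integrable_cst _ _ _ bmu (cell_volume n)^-1.
  have L1' := @square_integrable_cst _ _ _ bmu 1.
  rewrite momentsB ?momentsZ//; last exact: square_integrableZ.
  apply/rowP => j'; rewrite [LHS]mxE [X in _ + X = _]mxE [X in _ - X = _]mxE cE [RHS]mxE eqxx/=.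
  rewrite momentsE.
  have -> : ip bmu (fun=> (cell_volume n)^-1) (invariant j') =
      (cell_volume n)^-1 * ip bmu (fun=> 1) (invariant j').
    rewrite -ipZl//; last exact: invariant_L2.
    by congr ip; apply/funext => v; rewrite mulr1.
  case: (indexP j') => [|k|].
  + rewrite invariant_mass eqxx (_ : (_ == energy_index n) = false)// !mulr0 subr0.
    rewrite (_ : ip _ _ _ = cell_volume n) ?mulVf ?gt_eqF//.
    by rewrite /ip Rintegral_cst// mulr1 mul1r box_measureT.
  + rewrite invariant_momentum ip_odd//; last 2 first.
    * exact: coor_L2.
    * by move=> v; rewrite mxE mulrN.
    rewrite eq_lrshift !mulr0 subr0 (_ : (_ == _) = false)//.
  + rewrite eqxx eq_rlshift -/m2 mulr1 mulr0n; field.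
    by rewrite c0 gt_eqF.
- have [s s0 sE] := moments_axis_sin i.
  exists (fun v => s^-1 * axis_sin i v); split=> [N N0|].
    by apply: trig_scale; exact: trig_axis.
  rewrite momentsZ; last exact: wave_L2.
  have s00 : s != 0 by rewrite gt_eqF.
  apply/rowP => j'; rewrite [LHS]mxE sE mulrA mulVf// mul1r mxE eqxx.
  by rewrite andTb.
- exists (fun v => c^-1 * axis_cos i0 v); split=> [N N0|]; first exact: tC.
  rewrite momentsZ//; apply/rowP => j'.
  by rewrite [LHS]mxE cE mulrA mulVf// mul1r mxE eqxx andTb.
Qed.

Lemma moments_sum (I : Type) (s : seq I) (F : I -> V -> R) :
  (forall i, square_integrable bmu (F i)) ->
  moments (fun v => \sum_(i <- s) F i v) = \sum_(i <- s) moments (F i).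
Proof.
move=> LF; apply/rowP => j; rewrite momentsE ip_suml//; last exact: invariant_L2.
by rewrite summxE; apply: eq_bigr => i _; rewrite momentsE.
Qed.

(** The linear combination of the dual basis with coefficients [t]; the constant
    depends on neither [t] nor the degree. *)
Lemma moment_lift : (0 < n)%N -> exists2 Cl : R, 0 <= Cl &
  forall t, exists g : V -> R, [/\ forall N, (0 < N)%N -> trig N g,
    moments g = t & nrm bmu g <= Cl * norm1 t].
Proof.
move=> /moment_dual_basis[e He].
have Le j : square_integrable bmu (e j) by exact: trig_L2 ((He j).1 1%N isT).
exists (\sum_j nrm bmu (e j)); first by apply: sumr_ge0 => j _; exact: nrm_ge0.
move=> t; have Lte j : square_integrable bmu (fun v => t ord0 j * e j v).
  exact: square_integrableZ.
exists (fun v => \sum_j t ord0 j * e j v); split=> [N N0||].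
- by apply: trig_sum => j _; apply: trig_scale; apply: (He j).1.
- rewrite moments_sum// [RHS]row_sum_delta; apply: eq_bigr => j _.
  by rewrite momentsZ// (He j).2.
have nrm_sum (s : seq 'I_(1 + n + 1)) :
    nrm bmu (fun v => \sum_(j <- s) t ord0 j * e j v) <=
    \sum_(j <- s) `|t ord0 j| * nrm bmu (e j).
  elim: s => [|j s IHs].
    under [X in nrm _ X]eq_fun do rewrite big_nil.
    have := @nrmZ _ _ _ bmu 0 (fun=> 0) (square_integrable_cst _ 0).
    by under [X in nrm _ X = _]eq_fun do rewrite mul0r; rewrite normr0 mul0r big_nil => ->.
  under [X in nrm _ X]eq_fun do rewrite big_cons.
  rewrite big_cons; apply: le_trans (nrmD (Lte j) (square_integrable_sum _ _)) _ => //.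
  by apply: lerD => //; rewrite nrmZ.
apply: le_trans (nrm_sum _) _; rewrite mulr_sumr; apply: ler_sum => j _.
rewrite mulrC; apply: ler_wpM2r => //.
by rewrite (bigD1 j)//= lerDl sumr_ge0// => i _; exact: nrm_ge0.
Qed.

End moment_lift.

(** * Constrained best approximation *)

Section finite_projection.
Context d (T : measurableType d) (R : realType).
Variable mu : {finite_measure set T -> \bar R}.
Variable Q : (T -> R) -> Prop.
Hypothesis QL2 : forall f, Q f -> square_integrable mu f.
Hypothesis QD : forall f g, Q f -> Q g -> Q (fun x => f x + g x).
Hypothesis QZ : forall a f, Q f -> Q (fun x => a * f x).

(** One step of the Gram-Schmidt process per function. Membership of [u] in the
    span is recorded through its consequence used later, orthogonality to the
    orthogonal complement. *)
Lemma span_projection (I : Type) (s : seq I) (phi : I -> T -> R) :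
  (forall i, Q (phi i)) -> forall p, Q p -> exists u, [/\ Q u,
    forall h, square_integrable mu h ->
      (forall f, List.In f [seq phi i | i <- s] -> ip mu f h = 0) -> ip mu u h = 0 &
    forall f, List.In f [seq phi i | i <- s] ->
      ip mu f (fun x => p x - u x) = 0].
Proof.
move=> Qphi; have QB f g : Q f -> Q g -> Q (fun x => f x - g x).
  move=> Qf Qg; rewrite (_ : (fun _ => _) = fun x => f x + -1 * g x).
    by apply: QD => //; exact: QZ.
  by apply/funext => x; rewrite mulN1r.
elim: s => [|i s IHs] p Qp.
  exists (fun x => 0 * p x); split=> //; first exact: QZ.
  by move=> h Lh _; rewrite ipZl ?mul0r//; exact: QL2.
have [w [Qw wspan worth]] := IHs _ (Qphi i).
have [u [Qu uspan uorth]] := IHs _ Qp.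
pose psi x := phi i x - w x.
have Qpsi : Q psi by exact: QB.
have Lpsi := QL2 Qpsi; have Lu := QL2 Qu; have Lp := QL2 Qp; have Lw := QL2 Qw.
have Lphi := QL2 (Qphi i).
(* When [psi] is null every function is orthogonal to it. *)
pose a := if nrm mu psi == 0 then 0 else ip mu p psi / nrm mu psi ^+ 2.
pose u' x := u x + a * psi x.
have Qu' : Q u' by apply: QD => //; exact: QZ.
have Lpu : square_integrable mu (fun x => p x - u x) by exact: square_integrableB.
have Lapsi : square_integrable mu (fun x => a * psi x) by exact: square_integrableZ.
have Lf f : List.In f [seq phi i | i <- s] -> square_integrable mu f.
  by elim: (s) => //= k s' IH [<-|//]; exact: QL2.
have psi_s f : List.In f [seq phi i | i <- s] -> ip mu f psi = 0.
  by move=> fs; exact: worth.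
have pu'E : (fun x => p x - u' x) = (fun x => (p x - u x) - a * psi x).
  by apply/funext => x; rewrite /u'; ring.
have pu'_s f : List.In f [seq phi i | i <- s] -> ip mu f (fun x => p x - u' x) = 0.
  move=> fs; have LLf := Lf f fs.
  by rewrite pu'E ipBr// uorth// ipZr// psi_s// mulr0 subr0.
have upsi : ip mu u psi = 0 by exact: uspan.
have pu'_psi : ip mu psi (fun x => p x - u' x) = 0.
  rewrite pu'E ipBr// ipBr// ipZr// -sqr_nrm [ip _ psi u]ipC upsi subr0 /a.
  have [p0|p0] := eqVneq (nrm mu psi) 0.
    by rewrite nrm_eq0_ip// mul0r subr0.
  by rewrite divfK ?expf_neq0// ipC subrr.
have Lpu' : square_integrable mu (fun x => p x - u' x).
  by apply: square_integrableB => //; exact: QL2.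
have phiE : phi i = fun x => psi x + w x by apply/funext => x; rewrite subrK.
exists u'; split => //.
- move=> h Lh hs; rewrite ipDl// ipZl// uspan// => [|f fs]; last by apply: hs; right.
  rewrite add0r ipBl// hs; last by left.
  by rewrite wspan ?subrr ?mulr0// => f fs; apply: hs; right.
- move=> f /= [<-|]; last exact: pu'_s.
  by rewrite phiE ipDl// pu'_psi add0r wspan.
Qed.

End finite_projection.

Section constrained_minimisation.
Context {R : realType} (n : nat).
Local Notation V := 'rV[R]_n.
Local Notation bmu := (@box_measure R n).
Implicit Types (f g h G : V -> R) (t : 'rV[R]_(1 + n + 1)).

Lemma L2norm_nrm f g : square_integrable bmu f -> square_integrable bmu g ->
  L2norm (f \- g)%R = (nrm bmu (fun v => f v - g v))%:E.
Proof. by move=> Lf Lg; apply: Lnorm2E; exact: square_integrableB. Qed.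

(** The minimiser is a lift of [t] plus the orthogonal projection of the rest
    onto the trigonometric polynomials whose moments vanish; the latter are
    the orthogonal complement, within degree [N], of the projected
    invariants. *)
Lemma constrained_minimiser N G t : (0 < n)%N -> (0 < N)%N ->
  square_integrable bmu G ->
  exists2 g : V -> R, trig N g /\ moments g = t &
    forall h, trig N h -> moments h = t ->
      nrm bmu (fun v => G v - g v) <= nrm bmu (fun v => G v - h v).
Proof.
move=> n0 N0 LG; have [Cl _ /(_ t)[l [tl lt _]]] := @moment_lift R n n0.
have {}tl := tl N N0; have Ll := trig_L2 tl.
pose G' v := G v - l v; have LG' : square_integrable bmu G' by exact: square_integrableB.
pose p := fproj N G'; have tp : trig N p := fproj_trig N G'; have Lp := trig_L2 tp.
pose phi j := fproj N (@invariant R n j).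
have [u [tu uspan uorth]] := @span_projection _ _ _ bmu (trig N)
  (@trig_L2 _ _ N) (@trig_add _ _ N) (@trig_scale _ _ N) _
  (enum 'I_(1 + n + 1)) phi (fun j => fproj_trig N _) p tp.
have Lu := trig_L2 tu; have Lpu := square_integrableB Lp Lu.
have phiE j g : trig N g -> ip bmu (phi j) g = ip bmu (invariant j) g.
  by move=> tg; apply: ip_fproj => //; exact: invariant_L2.
have in_phi j : List.In (phi j) [seq phi i | i <- enum 'I_(1 + n + 1)].
  have : j \in enum 'I_(1 + n + 1) by rewrite mem_enum.
  elim: (enum _) => //= k s IH; rewrite inE => /orP[/eqP ->|/IH]; first by left.
  by right.
have mpu : moments (fun v => p v - u v) = 0.
  apply/rowP => j; rewrite momentsE ipC -phiE ?uorth ?mxE//; exact: trigB.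
exists (fun v => l v + (p v - u v)).
  split; first by apply: trig_add => //; exact: trigB.
  by rewrite momentsD// mpu addr0.
move=> h th ht; have Lh := trig_L2 th.
apply: best_approximation => //; first exact: square_integrableD.
pose z v := l v + (p v - u v) - h v.
have tz : trig N z by apply: trigB => //; apply: trig_add => //; exact: trigB.
have Lz := trig_L2 tz.
have mz : moments z = 0.
  have Llpu := square_integrableD Ll Lpu.
  by rewrite (momentsB Llpu Lh) (momentsD Ll Lpu) mpu lt ht addr0 subrr.
rewrite -/z (_ : (fun x => _) = fun v => (G' v - p v) + u v); last first.
  by apply/funext => v; rewrite /G'; ring.
rewrite ipDl//; last exact: square_integrableB.
rewrite ipBl// (ip_fproj LG' tz) subrr add0r; apply: uspan => // f.
elim: (enum _) => //= j s IH [<-|//].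
by rewrite phiE// ipC -momentsE mz mxE.
Qed.

(** [argmin] falls back on a default value when there is no minimiser, so its
    properties rest on [constrained_minimiser]. *)
Lemma argminP N G t : (0 < n)%N -> (0 < N)%N -> square_integrable bmu G ->
  let X := argmin (fun g => L2norm (g \- G)%R ^+ 2)%E
    [set g | trig_poly N g /\ moments g = t] in
  trig N X /\ forall h, trig N h -> moments h = t ->
    nrm bmu (fun v => G v - X v) <= nrm bmu (fun v => G v - h v).
Proof.
move=> n0 N0 LG X.
have JE g : trig N g ->
    (L2norm (g \- G)%R ^+ 2)%E = (nrm bmu (fun v => G v - g v) ^+ 2)%:E.
  move=> tg; have Lg := trig_L2 tg.
  by rewrite L2norm_nrm// nrm_distC// EFin_expe.
have [g [tg gt] gmin] := constrained_minimiser t n0 N0 LG.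
rewrite /X /argmin; case: xgetP => [Y _ [[/trig_polyP tY Yt] Ymin]|/(_ g)[]].
  split=> // h th ht; have := Ymin h (conj ((trig_polyP N h).2 th) ht).
  by rewrite !JE// lee_fin ler_pXn2r ?nnegrE ?nrm_ge0.
split; first by split=> //; exact/trig_polyP.
move=> h [/trig_polyP th ht]; rewrite !JE// lee_fin lerXn2r ?nnegrE ?nrm_ge0//.
exact: gmin.
Qed.

End constrained_minimisation.

(** * Error of the constrained collision operator *)

Section projected_operators.
Context {R : realType} (n : nat).
Local Notation V := 'rV[R]_n.
Local Notation bmu := (@box_measure R n).
Implicit Types (f g h G : V -> R) (t : 'rV[R]_(1 + n + 1)).

(** A lift of the moments of [f] is a competitor whose norm is controlled by that
    of [f]. *)
Lemma conservative_proj_stable : (0 < n)%N -> exists2 K : R, 0 <= K &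
  forall N f, (0 < N)%N -> square_integrable bmu f ->
    trig N (conservative_proj N f) /\
    nrm bmu (conservative_proj N f) <= K * nrm bmu f.
Proof.
move=> n0; have [Cl Cl0 lift] := @moment_lift R n n0.
have Cm0 := @moment_constant_ge0 R n; set Cm := moment_constant n in Cm0.
exists (2 + Cl * Cm); first by rewrite addr_ge0// mulr_ge0.
move=> N f N0 Lf; have [tX Xmin] := argminP (moments f) n0 N0 Lf.
rewrite -/(conservative_proj N f) in tX Xmin; split => //.
have [g [tg mg ng]] := lift (moments f).
have LX := trig_L2 tX; have Lg := trig_L2 (tg N N0).
have X1 := Xmin g (tg N N0) mg.
have X2 := nrmB Lf Lg.
have X3 : nrm bmu g <= Cl * (Cm * nrm bmu f).
  by apply: le_trans ng _; apply: ler_wpM2l => //; exact: norm1_moments.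
have := nrmB Lf (square_integrableB Lf LX).
rewrite (_ : (fun x => f x - _) = conservative_proj N f); last first.
  by apply/funext => v; rewrite opprB addrC subrK.
by move=> X4; apply: le_trans X4 _; rewrite mulrDl -mulrA; lra.
Qed.

(** The competitor is the unconstrained projection of [G] corrected by a lift
    of its moments; these are close to the moments of [H]. *)
Lemma zero_moment_approx : (0 < n)%N -> exists C1 C2 : R, [/\ 0 <= C1, 0 <= C2 &
  forall N G H, (0 < N)%N -> square_integrable bmu G -> square_integrable bmu H ->
    let X := argmin (fun g => L2norm (g \- G)%R ^+ 2)%E
      [set g | trig_poly N g /\ moments g = 0] in
    trig N X /\
    nrm bmu (fun v => H v - X v) <=
      C1 * (nrm bmu (fun v => H v - G v) + nrm bmu (fun v => G v - fproj N G v)) +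
      C2 * norm1 (moments H)].
Proof.
move=> n0; have [Cl Cl0 lift] := @moment_lift R n n0.
have Cm0 := @moment_constant_ge0 R n; set Cm := moment_constant n in Cm0.
have ClCm0 : 0 <= Cl * Cm by exact: mulr_ge0.
exists (1 + Cl * Cm), Cl; split => //; first by rewrite addr_ge0.
move=> N G H N0 LG LH X; have [tX Xmin] := argminP 0 n0 N0 LG.
rewrite -/X in tX Xmin; split => //; have LX := trig_L2 tX.
pose S := fproj N G; have LS : square_integrable bmu S := fproj_L2 N G.
have [g [tg mg ng]] := lift (moments S).
have {}tg := tg N N0; have Lg := trig_L2 tg.
have LSg := square_integrableB LS Lg.
have X1 : nrm bmu (fun v => G v - X v) <= nrm bmu (fun v => G v - (S v - g v)).
  apply: Xmin; first exact: trigB (fproj_trig N G) tg.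
  by rewrite momentsB// mg subrr.
have X2 : nrm bmu (fun v => G v - (S v - g v)) <=
    nrm bmu (fun v => G v - S v) + nrm bmu g.
  have := nrmD (square_integrableB LG LS) Lg.
  by congr (nrm _ _ <= _); apply/funext => v; ring.
have X3 : norm1 (moments S) <= norm1 (moments H) +
    Cm * nrm bmu (fun v => H v - S v).
  apply: le_trans (_ : norm1 (moments H) + norm1 (moments (fun v => H v - S v)) <= _).
    rewrite /norm1 -big_split/=; apply: ler_sum => j _.
    rewrite momentsB// [X in _ <= _ + `|X|]mxE [X in _ <= _ + `|_ + X|]mxE.
    rewrite -{1}[moments S ord0 j](subKr (moments H ord0 j)).
    exact: ler_normB.
  by rewrite lerD2l; apply: norm1_moments; exact: square_integrableB.
have X4 := nrm_triangle LH LG LX; have X5 := nrm_triangle LH LG LS.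
have X6 : Cl * norm1 (moments S) <= Cl * norm1 (moments H) + Cl * Cm *
    (nrm bmu (fun v => H v - G v) + nrm bmu (fun v => G v - S v)).
  apply: le_trans (ler_wpM2l Cl0 X3) _; rewrite mulrDr mulrA lerD2l.
  exact: ler_wpM2l.
apply: le_trans X4 _; rewrite -/S; move: X1 X2 X6 ng.
by rewrite mulrDl mul1r; lra.
Qed.

End projected_operators.

Theorem theorem4p2 (R : realType) (d : nat) (sec : R -> R -> R) (Ct : R)
    (hd : (1 <= d <= 3)%N) (hsec : is_collision_kernel sec) (hCt : 0 < Ct) :
  exists C : R -> R -> nat -> R,
    forall (f : 'rV[R]_d -> R) (delta Rt : R),
      L2p f -> 0 < delta -> 0 < Rt -> bounded_kernel sec Rt ->
      enorm (moments (collision sec Rt f)) <= Ct * delta ->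
      forall r N : nat, (1 <= r)%N -> (1 <= N)%N ->
        let fN := conservative_proj N f in
        (L2norm (collision sec Rt f \- constrained_collision sec Rt N fN)%R <=
         (C (fine (L2norm f)) Rt r)%:E *
           (L2norm (f \- fN)%R +
            sobolev_norm r (collision sec Rt fN) * (N%:R ^- r)%:E +
            delta%:E))%E.
Proof.
have d0 : (0 < d)%N by case/andP: hd.
have [K K0 stable] := @conservative_proj_stable R d d0.
have [C1 [C2 [C10 C20 approx]]] := @zero_moment_approx R d d0.
(* The bound of the kernel is chosen as a function of the radius, so that the
   constant depends on [f] through its norm only. *)
pose bound Rt M := forall p, kernel_domain p -> p.1 < 2 * Rt ->
  Defs.kernel sec p.1 p.2 <= M.
pose L Rt := Num.sqrt (lipschitz_constant d Rt (xget 0 [set M | bound Rt M])).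
have L0 Rt : 0 <= L Rt by exact: sqrtr_ge0.
pose D : R := (1 + d + 1)%:R.
exists (fun x Rt _ => 1 + C1 * (L Rt * (x + K * x)) + C1 * Num.sqrt d%:R +
  C2 * (D * Ct)).
move=> f delta Rt [pf /Lfun2P Lf] delta0 Rt0 [M0 hM0] hmom r N r1 N1.
cbv zeta; set fN := conservative_proj N f.
have hM : bound Rt (xget 0 [set M | bound Rt M]) by exact: (@xgetPex _ 0 _ (ex_intro _ M0 hM0)).
have [tfN fN_le] := stable N f N1 Lf.
rewrite -/fN in tfN fN_le; have LfN := trig_L2 tfN.
have Pf : periodic_L2 f by [].
have PfN : periodic_L2 fN by split => //; exact: trig_periodic tfN.
pose H := collision sec Rt f; pose G := collision sec Rt fN.
have LH : square_integrable (@box_measure R d) H by exact: (collision_L2 hsec Rt0 hM).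
have LG : square_integrable (@box_measure R d) G by exact: (collision_L2 hsec Rt0 hM).
have [tX HX] := approx N G H N1 LG LH.
rewrite -/(constrained_collision sec Rt N fN) in tX HX.
have := jackson_sobolev r N1 d0 LG.
rewrite (L2norm_nrm LH (trig_L2 tX)) (L2norm_nrm Lf LfN).
rewrite /L2norm (Lnorm2E Lf) -/G -/H /=.
set x := nrm _ f; set A := nrm _ (fun v => f v - fN v).
have x0 : 0 <= x by exact: nrm_ge0.
have A0 : 0 <= A by exact: nrm_ge0.
have HG : nrm (@box_measure R d) (fun v => H v - G v) <= L Rt * (x + K * x) * A.
  apply: le_trans (collision_lipschitz hsec Rt0 hM Pf PfN) _.
  apply: ler_wpM2r => //; apply: ler_wpM2l; first exact: L0.
  by rewrite lerD2l.
have mom : norm1 (moments H) <= D * (Ct * delta).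
  rewrite /D -[(1 + d + 1)%N]card_ord -sum1_card natr_sum mulr_suml.
  apply: ler_sum => j _; rewrite mul1r.
  exact: le_trans (ler_coor_enorm _ _) hmom.
have N0 : 0 < (N%:R : R) ^+ r by rewrite exprn_gt0// ltr0n.
have sd0 : 0 < Num.sqrt d%:R :> R by rewrite sqrtr_gt0 ltr0n.
set J := nrm _ (fun v => G v - fproj N G v) in HX *.
set LE := L Rt * (x + K * x) in HG *.
have LE0 : 0 <= LE by rewrite mulr_ge0// addr_ge0// mulr_ge0.
have DC0 : 0 <= C2 * (D * Ct) by rewrite !mulr_ge0 ?ler0n// ltW.
have C1s0 : 0 <= C1 * Num.sqrt d%:R :> R by rewrite mulr_ge0// ltW.
have C1L0 : 0 <= C1 * LE by rewrite mulr_ge0.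
set C := 1 + _ + _ + _; have C0 : 0 < C by rewrite /C; lra.
(* When the Sobolev norm is infinite so is the right-hand side. *)
case: (sobolev_norm r G) => [s||]; last 2 first.
- move=> _; rewrite gt0_mulye ?lte_fin ?invr_gt0// addey// addye//.
  by rewrite gt0_muley ?lte_fin// leey.
- by rewrite leeNy_eq.
have -> : (C%:E * (A%:E + s%:E * (N%:R ^- r)%:E + delta%:E) =
    (C * (A + s / N%:R ^+ r + delta))%:E)%E by [].
rewrite !lee_fin ler_pdivrMr// => Js.
have {}Js : J <= Num.sqrt d%:R * (s / N%:R ^+ r).
  by rewrite mulrA ler_pdivlMr// [_ * s]mulrC.
set u := s / N%:R ^+ r in Js *.
have u0 : 0 <= u by rewrite -(pmulr_rge0 _ sd0); apply: le_trans Js; exact: nrm_ge0.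
apply: le_trans HX _.
have X1 : C1 * (nrm (@box_measure R d) (fun v => H v - G v) + J) <=
    C1 * (LE * A + Num.sqrt d%:R * u).
  by apply: ler_wpM2l => //; exact: lerD.
have X2 : C2 * norm1 (moments H) <= C2 * (D * (Ct * delta)) by exact: ler_wpM2l.
apply: le_trans (lerD X1 X2) _.
rewrite (_ : _ + _ = C1 * LE * A + C1 * Num.sqrt d%:R * u + C2 * (D * Ct) * delta); last ring.
rewrite mulrDr mulrDr; apply: lerD; last by apply: ler_wpM2r; [exact: ltW|rewrite /C; lra].
by apply: lerD; apply: ler_wpM2r => //; rewrite /C; lra.
Qed.
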